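(* Let $F$ be an $n$-dimensional Euclidean space, $L\subset F$ an $n$-dimensional even lattice, $I\subset S^1$ a proper interval, and let $\mathcal{A}_F(I)\rtimes_bL$ be the twisted crossed product of $\mathcal{A}_F(I)$ by the restriction to $L$ of the action $t\mapsto\rho_t$ of $F$. For $t\in F$ let $\beta_{\rho_t}\in\mathrm{Aut}(\mathcal{A}_F(I)\rtimes_bL)$ be the $\alpha$-induced automorphism $$\beta_{\rho_t}(\iota(a)\psi_{\rho_\ell})=\iota\big(\rho_t(a)\,\varepsilon(\rho_t,\rho_\ell)^*\big)\psi_{\rho_\ell},\qquad a\in\mathcal{A}_F(I),\ \ell\in L.$$ Then the kernel of the map $F\to\mathrm{Out}(\mathcal{A}_F(I)\rtimes_bL)$, $t\mapsto[\beta_{\rho_t}]$, is $L$; that is, $\beta_{\rho_t}$ is inner if and only if $t\in L$.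
   Context: Even lattice: $\langle x,x\rangle_F\in2\mathbb{Z}$ for all $x\in L$. $S^1=\mathbb{R}/2\pi\mathbb{Z}$; proper interval: non-empty, open, connected, non-dense subset of $S^1$. $H_{0,F}$ is the completion of $C^\infty(S^1,F)/F$ for $\|f\|^2=\sum_{k\ge1}k\|\hat f_k\|^2$ ($\hat f_k$ Fourier coefficients in $F\otimes\mathbb{C}$), with complex structure $\hat f_k\mapsto-i\,\mathrm{sign}(k)\hat f_k$ and $\omega([f],[g])=\mathrm{Im}\langle f,g\rangle=\frac12\int_0^{2\pi}\langle f,g'\rangle_F\frac{d\theta}{2\pi}$. $W(\xi)$ are the Weyl unitaries on the Bosonic Fock space over $H_{0,F}$, determined by $W(\xi)e^0=e^{-\|\xi\|^2/2}e^\xi$ (with $e^\xi=\bigoplus_n\xi^{\otimes n}/\sqrt{n!}$) and $W(\xi)W(\eta)=e^{-i\omega(\xi,\eta)}W(\xi+\eta)$. $\mathcal{A}_F(I)=\{W([f]):f\in C^\infty(S^1,F),\ \mathrm{supp} f\subset I\}''$. Fix a smooth $\ell_0\colon S^1\to\mathbb{R}$ supported in $I$ with $\int_0^{2\pi}\ell_0\frac{d\theta}{2\pi}=1$. For $t\in F$, $\rho_t\in\mathrm{Aut}(\mathcal{A}_F(I))$ is given by $\rho_t(W([f]))=e^{i\int_0^{2\pi}\langle f(\theta),t\,\ell_0(\theta)\rangle_F\frac{d\theta}{2\pi}}W([f])$. The braiding is $\varepsilon(\rho_p,\rho_q)=e^{i\pi\langle p,q\rangle_F}\cdot1$ for $p,q\in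 F$. For a basis $(e_1,\dots,e_n)$ of $L$, $b\colon L\times L\to\{\pm1\}$ is the bicharacter with $b(e_i,e_j)=(-1)^{\langle e_i,e_j\rangle_F}$ if $i<j$ and $1$ otherwise. $\mathcal{A}_F(I)\rtimes_bL$ is generated by $\iota(\mathcal{A}_F(I))$ ($\iota$ the canonical embedding) and unitaries $\psi_{\rho_\ell}$, $\ell\in L$, with $\psi_{\rho_\ell}\iota(a)=\iota(\rho_\ell(a))\psi_{\rho_\ell}$ and $\psi_{\rho_\ell}\psi_{\rho_m}=b(\ell,m)\psi_{\rho_{\ell+m}}$. $\mathrm{Out}(M)=\mathrm{Aut}(M)/\mathrm{Inn}(M)$. *)

(* Defs.v *)
From HB Require Import structures.
From mathcomp Require Import all_boot all_order all_algebra.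
From mathcomp Require Import all_classical all_reals all_analysis.
From mathcomp Require Import complex sesquilinear.
From mathcomp Require Import ring lra.

Set Implicit Arguments.
Unset Strict Implicit.
Unset Printing Implicit Defensive.

Import Order.TTheory GRing.Theory Num.Theory.
Import numFieldNormedType.Exports.

Local Open Scope classical_set_scope.
Local Open Scope ring_scope.
Local Open Scope complex_scope.

(* rsum and csum are unconditional sums over an arbitrary index type, meaningful
   for absolutely summable families. *)
Section Sums.
Variables (R : realType) (X : choiceType).

Definition rsum (f : X -> R) : R :=
  fine (\esum_(x in setT) (Num.max (f x) 0)%:E) -
  fine (\esum_(x in setT) (Num.max (- f x) 0)%:E).

Definition csum (f : X -> R[i]) : R[i] :=
  rsum (fun x => complex.Re (f x)) +i* rsum (fun x => complex.Im (f x)).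

Definition asum (f : X -> R) : Prop :=
  (\esum_(x in setT) `|f x|%:E < +oo)%E.

Lemma asum_le (f g : X -> R) :
  (forall x, `|f x| <= g x) -> asum g -> asum f.
Proof.
move=> fg; apply: le_lt_trans; apply: le_esum => x _.
by rewrite lee_fin (le_trans (fg x))// ler_norm.
Qed.

Lemma asumD (f g : X -> R) : asum f -> asum g -> asum (fun x => f x + g x).
Proof.
move=> sf sg; have := lte_add_pinfty sf sg.
rewrite /asum -esumD//; apply: le_lt_trans; apply: le_esum => x _.
by rewrite -EFinD lee_fin ler_normD.
Qed.

Lemma asumZ (c : R) (f : X -> R) : asum f -> asum (fun x => c * f x).
Proof.
rewrite /asum => sf; apply: (@le_lt_trans _ _
   (`|c|%:E * \esum_(x in setT) `|f x|%:E)%E); last first.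
  by apply: lte_mul_pinfty.
apply: ub_ereal_sup => _ [A [finA _]] <-.
under eq_fsbigr do rewrite normrM EFinM.
rewrite -ge0_mule_fsumr//.
by apply: lee_wpmul2l => //; apply: ereal_sup_ubound; exists A.
Qed.

Lemma asum_parts (f : X -> R) : asum f ->
  asum (fun x => Num.max (f x) 0) /\ asum (fun x => Num.max (- f x) 0).
Proof.
move=> sf; have sN : asum (fun x => `|f x|).
  by move: sf; rewrite /asum; under [in X in _ -> X]eq_esum do rewrite normr_id.
have m0 (r : R) : 0 <= Num.max r 0 by rewrite le_max lexx orbT.
by split; apply: asum_le sN => x; rewrite ger0_norm// ge_max normr_ge0 andbT;
  [exact: ler_norm | rewrite -normrN ler_norm].
Qed.

Lemma asum_fin (f : X -> R) : asum f -> (forall x, 0 <= f x) ->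
  \esum_(x in setT) (f x)%:E \is a fin_num.
Proof.
move=> sf f0; rewrite ge0_fin_numE; last by apply: esum_ge0 => x _; rewrite lee_fin.
rewrite (_ : (fun x => (f x)%:E) = (fun x => `|f x|%:E))//.
by apply/funext => x; rewrite ger0_norm.
Qed.

Lemma rsumE (f a b : X -> R) : asum a -> asum b ->
  (forall x, 0 <= a x) -> (forall x, 0 <= b x) ->
  (forall x, f x = a x - b x) ->
  rsum f = fine (\esum_(x in setT) (a x)%:E) - fine (\esum_(x in setT) (b x)%:E).
Proof.
move=> sa sb a0 b0 fE.
have sf : asum f.
  have := asumD sa (asumZ (-1) sb).
  by congr asum; apply/funext => x; rewrite fE mulN1r.
have [sp sn] := asum_parts sf.
have m0 (r : R) : 0 <= Num.max r 0 by rewrite le_max lexx orbT.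
have fp := asum_fin sp (fun x => m0 _); have fn := asum_fin sn (fun x => m0 _).
have fa := asum_fin sa a0; have fb := asum_fin sb b0.
have key : (\esum_(x in setT) (Num.max (f x) 0)%:E + \esum_(x in setT) (b x)%:E =
  \esum_(x in setT) (Num.max (- f x) 0)%:E + \esum_(x in setT) (a x)%:E)%E.
  rewrite -!esumD; try (by move=> x _; rewrite lee_fin ?m0).
  apply: eq_esum => x _; rewrite -!EFinD fE; congr EFin.
  by case: (leP (a x - b x) 0); case: (leP (- (a x - b x)) 0); lra.
move: key; rewrite /rsum -(fineK fp) -(fineK fn) -(fineK fa) -(fineK fb).
by rewrite -!EFinD /= => -[]; lra.
Qed.

End Sums.

(* Inner products are antilinear in the first argument. *)
Record hilbert (R : realType) := Hilbert {
  hsort :> lmodType R[i];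
  hdot : hsort -> hsort -> R[i];
  hdotP : forall x, linear_for *%R (hdot x);
  hdotC : forall x y, hdot y x = (hdot x y)^*;
  hdot_gt0 : forall x, x != 0 -> 0 < hdot x x;
  hcomplete : forall u : nat -> hsort,
    let nrm x := Num.sqrt (complex.Re (hdot x x)) in
    (forall eps : R, 0 < eps -> exists N, forall m n, (N <= m)%N -> (N <= n)%N ->
       nrm (u m - u n) < eps) ->
    exists l, forall eps : R, 0 < eps -> exists N, forall n, (N <= n)%N ->
      nrm (u n - l) < eps }.

Section HilbertTheory.
Variables (R : realType) (H : hilbert R).
Implicit Types x y z : H.

Definition hnorm2 x : R := complex.Re (hdot x x).
Definition hnorm x : R := Num.sqrt (hnorm2 x).

Lemma hdotDr x y z : hdot x (y + z) = hdot x y + hdot x z.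
Proof. by have := hdotP x 1 y z; rewrite scale1r mul1r. Qed.

Lemma hdot0r x : hdot x 0 = 0.
Proof. by apply: (addrI (hdot x 0)); rewrite -hdotDr !addr0. Qed.

Lemma hdotZr a x y : hdot x (a *: y) = a * hdot x y.
Proof. by have := hdotP x a y 0; rewrite !addr0 hdot0r addr0. Qed.

Lemma hdotDl x y z : hdot (x + y) z = hdot x z + hdot y z.
Proof. by rewrite hdotC hdotDr rmorphD /= -!hdotC. Qed.

Lemma hdotZl a x y : hdot (a *: x) y = a^* * hdot x y.
Proof. by rewrite hdotC hdotZr rmorphM /= -hdotC. Qed.

Lemma hdotxx x : hdot x x = (hnorm2 x)%:C.
Proof.
have := hdotC x x; rewrite /hnorm2; case: (hdot x x) => a b /= [] bE.
by congr (_ +i* _); lra.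
Qed.

Lemma hnorm2_ge0 x : 0 <= hnorm2 x.
Proof.
have [->|x0] := eqVneq x 0; first by rewrite /hnorm2 hdot0r.
by rewrite -lecR -hdotxx ltW// hdot_gt0.
Qed.

Lemma hnorm2_eq0 x : hnorm2 x = 0 -> x = 0.
Proof.
move=> x0; apply/eqP/negP => /negP /hdot_gt0.
by rewrite hdotxx x0 ltxx.
Qed.

Lemma hnorm2_0 : hnorm2 0 = 0.
Proof. by rewrite /hnorm2 hdot0r. Qed.

Lemma hnorm2Z a x : hnorm2 (a *: x) = complex.Re (a^* * a) * hnorm2 x.
Proof.
rewrite /hnorm2 hdotZl hdotZr hdotxx /hnorm2.
by case: a => p q; case: (hdot x x) => r s /=; ring.
Qed.

Lemma hnorm2N x : hnorm2 (- x) = hnorm2 x.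
Proof. by rewrite -scaleN1r hnorm2Z rmorphN rmorph1 mulrNN mulr1 mul1r. Qed.

Lemma hnorm2D x y :
  hnorm2 (x + y) = hnorm2 x + hnorm2 y + 2 * complex.Re (hdot x y).
Proof.
rewrite {1}/hnorm2 hdotDl !hdotDr (hdotC x y) !hdotxx.
by case: (hdot x y) => p q /=; ring.
Qed.

Lemma hnorm2D_le x y : hnorm2 (x + y) <= 2 * (hnorm2 x + hnorm2 y).
Proof.
have := hnorm2_ge0 (x - y); rewrite !hnorm2D hnorm2N -scaleN1r hdotZr.
by case: (hdot x y) => p q /=; lra.
Qed.

Lemma hdotRe_le x y : `|complex.Re (hdot x y)| <= hnorm2 x + hnorm2 y.
Proof.
have := hnorm2_ge0 (x - y); have := hnorm2_ge0 (x + y).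
have := hnorm2_ge0 x; have := hnorm2_ge0 y.
rewrite !hnorm2D hnorm2N -scaleN1r hdotZr ler_norml.
by case: (hdot x y) => p q /=; lra.
Qed.

Lemma hdotIm_le x y : `|complex.Im (hdot x y)| <= hnorm2 x + hnorm2 y.
Proof.
have := hdotRe_le x ('i *: y); rewrite hdotZr hnorm2Z.
by case: (hdot x y) => p q /=; rewrite !ler_norml; lra.
Qed.

Lemma hnorm_lt x (eps : R) : 0 < eps -> (hnorm x < eps) = (hnorm2 x < eps ^+ 2).
Proof.
move=> e0; rewrite /hnorm -{1}(gtr0_norm e0) -sqrtr_sqr ltr_sqrt//.
by rewrite exprn_gt0.
Qed.

End HilbertTheory.

Section ComplexHilbert.
Variable R : realType.

Let cdot (x y : R[i]^o) : R[i] := x^* * y.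

Let cdotP x : linear_for *%R (cdot x).
Proof. by move=> a y z; rewrite /cdot mulrDr mulrCA. Qed.

Let cdotC x y : cdot y x = (cdot x y)^*.
Proof. by rewrite /cdot rmorphM /= conjcK mulrC. Qed.

Let cdot_gt0 x : x != 0 -> 0 < cdot x x.
Proof.
move=> x0; rewrite /cdot mulrC lt0r mulcJ_ge0 andbT.
by rewrite mulf_neq0// conjc_eq0.
Qed.

Let ccomplete (u : nat -> R[i]^o) :
  let nrm x := Num.sqrt (complex.Re (cdot x x)) in
  (forall eps : R, 0 < eps -> exists N, forall m n, (N <= m)%N -> (N <= n)%N ->
     nrm (u m - u n) < eps) ->
  exists l, forall eps : R, 0 < eps -> exists N, forall n, (N <= n)%N ->
    nrm (u n - l) < eps.
Proof.
move=> nrm uc.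
have Re_le z : `|complex.Re z| <= nrm z.
  rewrite -sqrtr_sqr; apply: ler_wsqrtr; rewrite /cdot.
  by case: z => a b /=; have := sqr_ge0 b; nra.
have Im_le z : `|complex.Im z| <= nrm z.
  rewrite -sqrtr_sqr; apply: ler_wsqrtr; rewrite /cdot.
  by case: z => a b /=; have := sqr_ge0 a; nra.
have part (f : R[i] -> R) : (forall a b, `|f a - f b| <= nrm (a - b)) ->
    exists l : R, forall eps : R, 0 < eps -> exists N, forall n, (N <= n)%N ->
      `|f (u n) - l| < eps.
  move=> fle; have cf : cvgn (fun n => f (u n)).
    apply/cauchy_cvgP; apply: cauchy_exP => eps e0.
    have [N uN] := uc _ e0; exists (f (u N)).
    exists N => // n Nn; rewrite /ball /=.
    by apply: le_lt_trans (fle _ _) _; exact: uN.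
  exists (limn (fun n => f (u n))) => eps e0.
  have /cvgrPdist_lt/(_ _ e0)[N _ NP] := cf.
  by exists N => n Nn; rewrite distrC; exact: NP.
have ReB (x y : R[i]) : complex.Re (x - y) = complex.Re x - complex.Re y.
  by case: x y => ? ? [].
have ImB (x y : R[i]) : complex.Im (x - y) = complex.Im x - complex.Im y.
  by case: x y => ? ? [].
have [a aP] := part (@complex.Re R) (fun x y => ltac:(rewrite -ReB; exact: Re_le)).
have [b bP] := part (@complex.Im R) (fun x y => ltac:(rewrite -ImB; exact: Im_le)).
exists (a +i* b) => eps e0.
have e20 : 0 < eps / 2 by rewrite divr_gt0.
have [N1 N1P] := aP _ e20; have [N2 N2P] := bP _ e20.
exists (maxn N1 N2) => n; rewrite geq_max => /andP[/N1P h1 /N2P h2].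
rewrite -(gtr0_norm e0) -sqrtr_sqr ltr_sqrt ?exprn_gt0// /cdot.
move: h1 h2; rewrite !ltr_norml; case: (u n) => p q /=.
by move=> /andP[? ?] /andP[? ?]; nra.
Qed.

Definition complexH : hilbert R := Hilbert cdotP cdotC cdot_gt0 ccomplete.

End ComplexHilbert.

Section SumTheory.
Variables (R : realType) (X : choiceType).
Implicit Types f g : X -> R.

Lemma rsum_ge0E f : (forall x, 0 <= f x) ->
  rsum f = fine (\esum_(x in setT) (f x)%:E).
Proof.
move=> f0; rewrite /rsum [in X in _ - X]esum1 ?subr0; last first.
  by move=> x _; rewrite max_r ?oppr_le0.
by congr fine; apply: eq_esum => x _; rewrite max_l.
Qed.

Lemma rsumD f g : asum f -> asum g ->
  rsum (fun x => f x + g x) = rsum f + rsum g.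
Proof.
move=> sf sg; have [fp fn] := asum_parts sf; have [gp gn] := asum_parts sg.
have m0 (r : R) : 0 <= Num.max r 0 by rewrite le_max lexx orbT.
have mE (r : R) : r = Num.max r 0 - Num.max (- r) 0.
  by case: (leP r 0); case: (leP (- r) 0); lra.
rewrite (rsumE (asumD fp gp) (asumD fn gn)); first last.
- by move=> x; rewrite [in LHS](mE (f x)) [in LHS](mE (g x)); ring.
- by move=> x; rewrite addr_ge0 ?m0.
- by move=> x; rewrite addr_ge0 ?m0.
under eq_esum do rewrite EFinD.
under [in X in _ - X]eq_esum do rewrite EFinD.
rewrite !esumD; try (by move=> x _; rewrite lee_fin ?m0).
rewrite !fineD; try (by apply: asum_fin => // x; rewrite m0).
by rewrite /rsum; ring.
Qed.

Lemma rsumN f : rsum (fun x => - f x) = - rsum f.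
Proof. by rewrite /rsum opprB; under [in X in _ - X]eq_esum do rewrite opprK. Qed.

Lemma esumZ (c : R) f : 0 <= c -> (forall x, 0 <= f x) ->
  (\esum_(x in setT) (c * f x)%:E = c%:E * \esum_(x in setT) (f x)%:E)%E.
Proof.
have le (a : R) (h : X -> R) : 0 <= a -> (forall x, 0 <= h x) ->
  (\esum_(x in setT) (a * h x)%:E <= a%:E * \esum_(x in setT) (h x)%:E)%E.
  move=> a0 h0; apply: ub_ereal_sup => _ [A [finA _]] <-.
  under eq_fsbigr do rewrite EFinM.
  rewrite -ge0_mule_fsumr//.
  by apply: lee_wpmul2l => //; apply: ereal_sup_ubound; exists A.
rewrite le_eqVlt => /predU1P[<- f0|c0 f0].
  by rewrite mul0e esum1// => x _; rewrite mul0r.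
apply/eqP; rewrite eq_le le ?(ltW c0)//=.
rewrite -[leRHS]mul1e -(mulfV (lt0r_neq0 c0)) EFinM -muleA.
apply: lee_wpmul2l; first by rewrite lee_fin ltW.
have cf0 x : 0 <= c * f x by rewrite mulr_ge0// ltW.
have ci0 : 0 <= c^-1 by rewrite invr_ge0 ltW.
apply: le_trans (le _ _ ci0 cf0).
by apply: le_esum => x _; rewrite lee_fin mulKf// gt_eqF.
Qed.

Lemma rsumZ c f : asum f -> rsum (fun x => c * f x) = c * rsum f.
Proof.
wlog c0 : c / 0 <= c => [hw|] sf.
  have [c0|c0] := leP 0 c; first exact: hw.
  have /hw/(_ sf) : 0 <= - c by lra.
  rewrite (_ : (fun x => - c * f x) = (fun x => - (c * f x))).
    by rewrite rsumN; lra.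
  by apply/funext => x; rewrite mulNr.
have [fp fn] := asum_parts sf.
have m0 (r : R) : 0 <= Num.max r 0 by rewrite le_max lexx orbT.
have mE (r : R) : r = Num.max r 0 - Num.max (- r) 0.
  by case: (leP r 0); case: (leP (- r) 0); lra.
rewrite (rsumE (asumZ c fp) (asumZ c fn)); first last.
- move=> x; rewrite [in LHS](mE (f x)); ring.
- by move=> x; rewrite mulr_ge0.
- by move=> x; rewrite mulr_ge0.
by rewrite !esumZ// !fineM ?asum_fin// /rsum mulrBr.
Qed.

Lemma ge0_rsum_le f g : asum g -> (forall x, 0 <= f x) -> (forall x, f x <= g x) ->
  rsum f <= rsum g.
Proof.
move=> sg f0 fg; have g0 x : 0 <= g x by rewrite (le_trans (f0 x)).
rewrite !rsum_ge0E// fine_le ?asum_fin//; last by apply: le_esum => x _; rewrite lee_fin.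
by apply: asum_le sg => x; rewrite ger0_norm.
Qed.

Lemma rsum_ge f x : asum f -> (forall x, 0 <= f x) -> f x <= rsum f.
Proof.
move=> sf f0; rewrite rsum_ge0E// -lee_fin fineK ?asum_fin//.
have := @esum_set1 R X x (fun x => (f x)%:E); rewrite lee_fin => /(_ (f0 x)) <-.
by rewrite esum_mkcond; apply: le_esum => y _; case: ifP; rewrite ?lee_fin.
Qed.

End SumTheory.

Section ComplexSumTheory.
Variables (R : realType) (X : choiceType).
Implicit Types f g : X -> R[i].

Definition casum f :=
  asum (fun x => complex.Re (f x)) /\ asum (fun x => complex.Im (f x)).

Lemma csumP a f g : casum f -> casum g ->
  csum (fun x => a * f x + g x) = a * csum f + csum g.
Proof.
move=> [fr fi] [gr gi]; case: a => p q; rewrite /csum /=.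
congr (_ +i* _).
  rewrite -mulNr -!rsumZ// -(rsumD (asumZ p fr) (asumZ (- q) fi)).
  rewrite -(rsumD (asumD (asumZ p fr) (asumZ (- q) fi)) gr).
  by congr rsum; apply/funext => x; case: (f x) (g x) => ? ? [? ?] /=; ring.
rewrite -!rsumZ// -(rsumD (asumZ p fi) (asumZ q fr)).
rewrite -(rsumD (asumD (asumZ p fi) (asumZ q fr)) gi).
by congr rsum; apply/funext => x; case: (f x) (g x) => ? ? [? ?] /=; ring.
Qed.

Lemma csumC f : csum (fun x => (f x)^*) = (csum f)^*.
Proof.
rewrite /csum /= -rsumN; congr (_ +i* _); congr rsum; apply/funext => x;
  by case: (f x).
Qed.

Lemma csum_real (h : X -> R) : csum (fun x => (h x)%:C) = (rsum h)%:C.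
Proof. by rewrite /csum /= [X in _ +i* X]rsum_ge0E// esum1. Qed.

End ComplexSumTheory.

(* Square-summable H-valued functions on X that are constant along e. *)
Section L2.
Variables (R : realType) (X : choiceType) (e : rel X) (H : hilbert R).

Definition l2_pred : {pred X -> H} := fun f =>
  `[< (forall x y, e x y -> f x = f y) /\ asum (fun x => hnorm2 (f x)) >].

Fact l2_submod_closed : submod_closed l2_pred.
Proof.
split.
  apply/asboolP; split=> //; rewrite /asum esum1 ?ltry// => x _ /=.
  by rewrite hnorm2_0 normr0.
move=> a f g /asboolP[fe fs] /asboolP[ge gs]; apply/asboolP; split.
  by move=> x y exy; rewrite !fctE (fe _ _ exy) (ge _ _ exy).
have := asumZ 2 (asumD (asumZ (complex.Re (a^* * a)) fs) gs).
apply: asum_le => x; rewrite !fctE ger0_norm ?hnorm2_ge0//.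
by rewrite (le_trans (hnorm2D_le _ _))// hnorm2Z.
Qed.

HB.instance Definition _ :=
  GRing.isSubmodClosed.Build R[i] (X -> H) l2_pred l2_submod_closed.

Record l2inv := L2 { l2val :> X -> H; l2valP : l2val \in l2_pred }.

HB.instance Definition _ := [isSub for l2val].
HB.instance Definition _ := [Choice of l2inv by <:].
HB.instance Definition _ := [SubChoice_isSubLmodule of l2inv by <:].

Definition l2dot (f g : l2inv) : R[i] := csum (fun x => hdot (f x) (g x)).

Implicit Types f g : l2inv.

Lemma l2inv_sum f : asum (fun x => hnorm2 (f x)).
Proof. by have /asboolP[] := l2valP f. Qed.

Lemma l2inv_inv f x y : e x y -> f x = f y.
Proof. by have /asboolP[+ _] := l2valP f; exact. Qed.

Lemma l2dot_casum f g : casum (fun x => hdot (f x) (g x)).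
Proof.
by split; apply: asum_le (asumD (l2inv_sum f) (l2inv_sum g)) => x;
  [exact: hdotRe_le | exact: hdotIm_le].
Qed.

Lemma l2dotxx f : l2dot f f = (rsum (fun x => hnorm2 (f x)))%:C.
Proof.
rewrite -csum_real /l2dot; congr csum; apply/funext => x; exact: hdotxx.
Qed.

Fact l2dotP f : linear_for *%R (l2dot f).
Proof.
move=> a g h; rewrite /l2dot -csumP; try exact: l2dot_casum.
by congr csum; apply/funext => x; rewrite /= hdotP.
Qed.

Fact l2dotC f g : l2dot g f = (l2dot f g)^*.
Proof. by rewrite /l2dot -csumC; congr csum; apply/funext => x; exact: hdotC. Qed.

Fact l2dot_gt0 f : f != 0 -> 0 < l2dot f f.
Proof.
move=> f0; rewrite l2dotxx ltcR.
have [x fx] : exists x, f x != 0.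
  apply: contrapT => h; move/eqP: f0; apply; apply/val_inj/funext => x /=.
  by apply: contrapT => /eqP fx; apply: h; exists x.
apply: lt_le_trans (rsum_ge x (l2inv_sum f) (fun x => hnorm2_ge0 (f x))).
rewrite lt0r hnorm2_ge0 andbT; apply/eqP => /hnorm2_eq0 fx0.
by rewrite fx0 eqxx in fx.
Qed.

Fact l2complete (u : nat -> l2inv) :
  let nrm f := Num.sqrt (complex.Re (l2dot f f)) in
  (forall eps : R, 0 < eps -> exists N, forall m n, (N <= m)%N -> (N <= n)%N ->
     nrm (u m - u n) < eps) ->
  exists l, forall eps : R, 0 < eps -> exists N, forall n, (N <= n)%N ->
    nrm (u n - l) < eps.
Proof.
move=> nrm.
have nrmE f (eps : R) : 0 < eps ->
    (nrm f < eps) = (rsum (fun x => hnorm2 (f x)) < eps ^+ 2).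
  move=> e0; rewrite /nrm l2dotxx /= -{1}(gtr0_norm e0) -sqrtr_sqr ltr_sqrt//.
  by rewrite exprn_gt0.
move=> uc.
have uc2 (d : R) : 0 < d -> exists N, forall m n, (N <= m)%N -> (N <= n)%N ->
    rsum (fun x => hnorm2 (u m x - u n x)) < d.
  move=> d0; have s0 : 0 < Num.sqrt d by rewrite sqrtr_gt0.
  have [N NP] := uc _ s0; exists N => m n Nm Nn.
  by have := NP _ _ Nm Nn; rewrite nrmE// sqr_sqrtr ?ltW.
have lim x : exists l : H, forall d : R, 0 < d -> exists N, forall n, (N <= n)%N ->
    hnorm2 (u n x - l) < d.
  have [eps e0|l lP] := @hcomplete R H (fun n => u n x).
    have [N NP] := uc _ e0; exists N => m n Nm Nn.
    have := NP _ _ Nm Nn; rewrite nrmE// -[X in X < _ -> _]/(rsum _) => h.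
    rewrite -/(hnorm2 _) -/(hnorm _) hnorm_lt//; apply: le_lt_trans h.
    exact: (rsum_ge x (l2inv_sum (u m - u n)) (fun x => hnorm2_ge0 _)).
  exists l => d d0; have s0 : 0 < Num.sqrt d by rewrite sqrtr_gt0.
  have [N NP] := lP _ s0; exists N => n Nn.
  have := NP _ Nn; rewrite -/(hnorm2 _) -/(hnorm _) hnorm_lt//.
  by rewrite sqr_sqrtr ?ltW.
have [l lP] := choice lim.
have limA (s : seq X) (d : R) : 0 < d -> exists N, forall n, (N <= n)%N ->
    \sum_(x <- s) hnorm2 (u n x - l x) < d.
  elim: s d => [|x s IH] d d0; first by exists 0%N => n _; rewrite big_nil.
  have d2 : 0 < d / 2 by rewrite divr_gt0.
  have [N1 P1] := IH _ d2; have [N2 P2] := lP x _ d2.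
  exists (maxn N1 N2) => n; rewrite geq_max => /andP[/P1 h1 /P2 h2].
  by rewrite big_cons; lra.
have bnd (d : R) : 0 < d -> exists N, forall n, (N <= n)%N ->
    (\esum_(x in setT) (hnorm2 (u n x - l x))%:E <= d%:E)%E.
  move=> d0; have d4 : 0 < d / 4 by rewrite divr_gt0.
  have [N NP] := uc2 _ d4; exists N => n Nn.
  apply: ub_ereal_sup => _ [A [finA _]] <-.
  rewrite fsbig_finite//= sumEFin lee_fin; set s := finmap.enum_fset (fset_set A).
  have [M MP] := limA s _ d4.
  pose m := maxn N M.
  have hm : \sum_(x <- s) hnorm2 (u m x - l x) < d / 4 by apply: MP; exact: leq_maxr.
  have hn : \sum_(x <- s) hnorm2 (u n x - u m x) < d / 4.
    apply: le_lt_trans (NP _ m Nn (leq_maxl _ _)).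
    rewrite rsum_ge0E; last by move=> x; exact: hnorm2_ge0.
    rewrite -lee_fin fineK; last first.
      by apply: asum_fin => [|x]; [exact: l2inv_sum (u n - u m) | exact: hnorm2_ge0].
    apply: ereal_sup_ubound; exists A; first by split.
    by rewrite fsbig_finite//= sumEFin.
  have : \sum_(x <- s) hnorm2 (u n x - l x) <=
      \sum_(x <- s) 2 * (hnorm2 (u n x - u m x) + hnorm2 (u m x - l x)).
    apply: ler_sum => x _; apply: le_trans (hnorm2D_le _ _).
    by rewrite addrA subrK.
  by rewrite -mulr_sumr big_split /=; lra.
have absE (f : X -> H) : (fun x => `|hnorm2 (f x)|%:E) = (fun x => (hnorm2 (f x))%:E).
  by apply/funext => x; rewrite ger0_norm// hnorm2_ge0.
have linv x y : e x y -> l x = l y.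
  move=> exy; apply/eqP; rewrite -subr_eq0; apply/eqP/hnorm2_eq0.
  apply/eqP; rewrite eq_le hnorm2_ge0 andbT; apply/ler_addgt0Pl => d d0.
  have d4 : 0 < d / 4 by rewrite divr_gt0.
  have [N1 P1] := lP x _ d4; have [N2 P2] := lP y _ d4.
  have h1 := P1 _ (leq_maxl N1 N2); have h2 := P2 _ (leq_maxr N1 N2).
  move: h1 h2; set n := maxn N1 N2 => h1 h2.
  rewrite addr0 (_ : l x - l y = (u n y - l y) - (u n x - l x)); last first.
    by rewrite (l2inv_inv (u n) exy) opprB [RHS]addrC addrA subrK.
  by apply: le_trans (hnorm2D_le _ _) _; rewrite hnorm2N; lra.
have lin : l \in l2_pred.
  have [N NP] := bnd 1 ltr01.
  have dP : (fun x => u N x - l x) \in l2_pred.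
    apply/asboolP; split=> [x y exy|].
      by rewrite (l2inv_inv _ exy) (linv _ _ exy).
    by rewrite /asum absE; apply: le_lt_trans (NP _ (leqnn N)) (ltry _).
  rewrite (_ : l = l2val (u N) - (fun x => u N x - l x)); last first.
    by apply/funext => x; rewrite !fctE opprB addrC subrK.
  by apply: rpredB => //; exact: l2valP.
exists (L2 lin) => eps e0.
have e20 : 0 < eps ^+ 2 / 2 by rewrite divr_gt0// exprn_gt0.
have [N NP] := bnd _ e20; exists N => n Nn; rewrite nrmE//.
rewrite rsum_ge0E; last by move=> x; exact: hnorm2_ge0.
rewrite -lte_fin fineK; last first.
  by apply: asum_fin => [|x]; [exact: l2inv_sum (u n - L2 lin) | exact: hnorm2_ge0].
apply: le_lt_trans (NP _ Nn) _; rewrite lte_fin.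
have : 0 < eps ^+ 2 by rewrite exprn_gt0.
lra.
Qed.

Definition l2invH : hilbert R := Hilbert l2dotP l2dotC l2dot_gt0 l2complete.

End L2.

Section HilbertSpaces.
Variables (R : realType) (X : choiceType).

(* The Hilbert direct sum of copies of H indexed by X. *)
Definition dsum (H : hilbert R) : hilbert R := l2invH (@eq_op X) H.

Definition l2 : hilbert R := dsum (complexH R).

(* The bosonic Fock space over l2 X.  The n-th tensor power of l2 X is the
   space of square-summable functions on X^n and its symmetric part consists
   of the permutation-invariant ones; seq X is the disjoint union of the X^n,
   and phi : fock has n-particle component phi restricted to sequences of
   size n. *)
Definition fock : hilbert R := l2invH (@perm_eq X) (complexH R).

End HilbertSpaces.

(* The vector with components f if f is square-summable and e-invariant, 0
   otherwise. The default is never reached by the exponential vectors, by the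
   classes of smooth loops, and by the operators of the crossed product applied
   to elements of the algebra. *)
Definition mkl2 (R : realType) (X : choiceType) (e : rel X) (H : hilbert R)
  (f : X -> H) : l2invH e H := insubd (0 : l2inv e H) f.

Section Operators.
Variables (R : realType) (H : hilbert R).
Implicit Types (S T : H -> H) (A M : set (H -> H)).

Definition bounded_op T :=
  linear T /\ exists c : R, forall x, hnorm (T x) <= c * hnorm x.

Definition adjoint T T' := forall x y, hdot x (T y) = hdot (T' x) y.

Definition unitary T :=
  [/\ linear T, forall x y, hdot (T x) (T y) = hdot x y
    & forall y, exists x, T x = y].

Definition commutant A : set (H -> H) :=
  [set T | bounded_op T /\ forall S, A S -> T \o S = S \o T].

Definition bicommutant A := commutant (commutant A).

Definition vN_generated A :=
  bicommutant (A `|` [set T | exists2 S, A S & adjoint S T]).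

(* Elements of the predual: phi = sum_n <x_n, . y_n> on M. *)
Definition sigma_weakly_continuous M (phi : (H -> H) -> R[i]) :=
  exists x y : dsum nat H,
    forall T, M T -> phi T = csum (fun n => hdot (x n) (T (y n))).

(* Automorphisms of a von Neumann algebra are *-automorphisms continuous for
   the sigma-weak topology (every *-automorphism is); it is this continuity
   that makes an automorphism determined by its values on generators. *)
Record vN_automorphism M (alpha : (H -> H) -> (H -> H)) : Prop := {
  aut_bij : set_bij M M alpha;
  aut_linear : forall c S T, M S -> M T ->
    alpha (c *: S + T) = c *: alpha S + alpha T;
  aut_mul : forall S T, M S -> M T -> alpha (S \o T) = alpha S \o alpha T;
  aut_star : forall S T, M S -> M T -> adjoint S T ->
    adjoint (alpha S) (alpha T);
  aut_normal : forall phi, sigma_weakly_continuous M phi ->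
    sigma_weakly_continuous M (phi \o alpha) }.

Definition inner M (alpha : (H -> H) -> (H -> H)) :=
  exists u v, [/\ M u, M v, unitary u, adjoint u v
    & forall T, M T -> alpha T = u \o T \o v].

End Operators.

Definition expi (R : realType) (x : R) : R[i] := cos x +i* sin x.

Section Weyl.
Variables (R : realType) (X : choiceType).
Implicit Types xi eta : l2 R X.

Definition omega xi eta : R := complex.Im (hdot xi eta).

Definition expvec xi : fock R X :=
  mkl2 _ (fun s : seq X =>
    (\prod_(x <- s) (xi x : R[i])) / (Num.sqrt (size s)`!%:R)%:C : complexH R).

Record weyl (W : l2 R X -> fock R X -> fock R X) : Prop := {
  weyl_unitary : forall xi, unitary (W xi);
  weyl_vacuum : forall xi,
    W xi (expvec 0) = (expR (- hnorm2 xi / 2))%:C *: expvec xi;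
  weyl_mul : forall xi eta,
    W xi \o W eta = expi (- omega xi eta) *: W (xi + eta) }.

End Weyl.

(* S^1 = R / 2 pi Z: functions on S^1 are 2 pi-periodic functions on R and
   subsets of S^1 are 2 pi-periodic subsets of R, with the quotient topology. *)
Section Circle.
Variable R : realType.
Implicit Types (I U V : set R) (g : R -> R).

Definition periodic2pi (T : Type) (f : R -> T) :=
  forall theta, f (theta + 2 * pi) = f theta.

Definition circle_connected I := forall U V, periodic2pi U -> periodic2pi V ->
  open U -> open V -> U `&` V = set0 -> U `|` V = I -> U = set0 \/ V = set0.

(* For the open set I, relatively open subsets are open subsets. *)
Definition proper_interval I :=
  [/\ periodic2pi I, I !=set0, open I, circle_connected I & closure I <> setT].

Definition supported (V : nmodType) (f : R -> V) I :=
  closure [set theta | f theta != 0] `<=` I.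

Definition smooth g :=
  forall k theta, derivable (derive1n k g) theta 1.

Definition mean g : R :=
  (2 * pi)^-1 * \int[lebesgue_measure]_(theta in `[0, 2 * pi]) g theta.

Definition fourier g (k : nat) : R[i] :=
  mean (fun theta => g theta * cos (k%:R * theta)) -i*
  mean (fun theta => g theta * sin (k%:R * theta)).

End Circle.

Section Lattice.
Variables (R : realType) (F : vectType R) (ip : {dot F for idfun}) (n : nat).

Definition smooth_loop (f : R -> F) :=
  periodic2pi f /\ forall v, smooth (fun theta => ip (f theta) v).

Definition orthonormal_basis (u : 'I_n -> F) :=
  \dim {:F} = n /\ forall i j, ip (u i) (u j) = (i == j)%:R.

(* One-particle space H_{0,F} in the coordinates given by an orthonormal basis
   u of F.  Since f is real, f is determined modulo constants by its Fourier
   coefficients f_k, k >= 1; the complex structure f_k |-> - i f_k (k >= 1)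
   becomes multiplication by i after conjugation, so that
     [f] = (sqrt k * conj <f_k, u_j>)_(k >= 1, j)
   is the isometry onto a dense subspace of l2.  The index k is shifted by
   one. *)
Definition one_particle : hilbert R := l2 R (nat * 'I_n)%type.

Definition loop_class (u : 'I_n -> F) (f : R -> F) : one_particle :=
  mkl2 _ (fun kj : nat * 'I_n => (Num.sqrt kj.1.+1%:R)%:C *
    (fourier (fun theta => ip (f theta) (u kj.2)) kj.1.+1)^* : complexH R).

Definition fockF : hilbert R := fock R (nat * 'I_n)%type.

(* The von Neumann algebra A_F(I). *)
Definition local_algebra (u : 'I_n -> F) (W : one_particle -> fockF -> fockF)
    (I : set R) : set (fockF -> fockF) :=
  bicommutant [set W (loop_class u f) | f in
    [set f | smooth_loop f /\ supported f I]].

Definition latvec (e : 'I_n -> F) (l : 'rV[int]_n) : F :=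
  \sum_(i < n) e i *~ l 0 i.

Definition lattice_basis (e : 'I_n -> F) (L : set F) :=
  basis_of fullv [seq e i | i <- enum 'I_n] /\ L = range (latvec e).

Definition even_lattice (L : set F) :=
  forall x, L x -> exists k : int, ip x x = (2 * k)%:~R.

(* <e_i, e_j> is an integer when the lattice is even, and floor extracts it. *)
Definition bichar (e : 'I_n -> F) (l m : 'rV[int]_n) : R[i] :=
  \prod_(i < n) \prod_(j < n | (i < j)%N)
    (-1) ^ (Num.floor (ip (e i) (e j)) * l 0 i * m 0 j).

Definition braiding (p q : F) : R[i] := expi (pi * ip p q).

(* The twisted crossed product of A by L acts on the direct sum of copies of
   the Hilbert space of A indexed by L, with L identified with Z^n through its
   basis e:
     (iota(a) phi)(m) = rho_{-m}(a) phi(m)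
     (psi_l phi)(m) = b(l, m - l) phi(m - l). *)
Section CrossedProduct.
Variables (H : hilbert R) (e : 'I_n -> F).
Variable rho : F -> (H -> H) -> (H -> H).

Definition crossed_space : hilbert R := dsum 'rV[int]_n H.

Definition cp_iota (a : H -> H) : crossed_space -> crossed_space :=
  fun phi => mkl2 _ (fun m => rho (- latvec e m) a (phi m)).

Definition cp_psi (l : 'rV[int]_n) : crossed_space -> crossed_space :=
  fun phi => mkl2 _ (fun m => bichar e l (m - l) *: phi (m - l)).

Definition crossed_product (A : set (H -> H)) :
    set (crossed_space -> crossed_space) :=
  vN_generated ([set cp_iota a | a in A] `|` range cp_psi).

End CrossedProduct.

End Lattice.

(* Main.v *)
(* If t = latvec l lies in L, then conjugation by psi_l agrees with beta_t on
   iota(a), and on psi_m because evenness of L identifies b(l, m) b(m, l) with the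
   conjugate braiding; by normality the two automorphisms coincide.

   Conversely let a unitary U implement beta_t, and let E be the matrix entry of U
   from the summand m' to the summand m of the crossed space. The Weyl operators
   W([g]) with g locally constant on I commute with A_F(I), hence, acting
   diagonally, with U; so E commutes with W([g]). Evaluating U iota(W([f])) =
   beta_t(iota(W([f]))) U for f supported in I gives
     E W([f]) = exp(i int <f, l0 s>) W([f]) E,   s = t - latvec m + latvec m'.
   If t is not in L then s <> 0. Let c be the multiple of s with <c, s> = pi and
   let f_l, g_l be c times smooth cutoffs increasing to the indicator functions of
   I and of the exterior of I. The phase tends to pi, whereas [f_l + g_l] =
   [f_l + g_l - c] is bounded in the Sobolev norm of order 1/2 and tends weakly to
   0, because its Fourier coefficients do. Hence exp(|xi_l|^2 / 2) W(xi_l) tends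
   weakly to 1 for xi_l = [f_l + g_l], and E = - E. So U = 0, a contradiction.

   An automorphism is bounded and determined by generators through normality only:
   two vector functionals that agree on a *-algebra agree on its bicommutant. *)

Require Import Defs.
From HB Require Import structures.
From mathcomp Require Import all_boot all_order all_algebra.
From mathcomp Require Import all_classical all_reals all_analysis.
From mathcomp Require Import complex sesquilinear.
From mathcomp Require Import ring lra.

Set Implicit Arguments.
Unset Strict Implicit.
Unset Printing Implicit Defensive.

Import Order.TTheory GRing.Theory Num.Theory.
Import numFieldNormedType.Exports.

Local Open Scope classical_set_scope.
Local Open Scope ring_scope.
Local Open Scope complex_scope.

(** * Unconditional sums *)

(** The half-order Sobolev norm decides the form of the cutoffs. A jump has infinite norm, growing
    like log l after smoothing at scale 1/l, so neither [f_l] nor [g_l] stays bounded alone. In the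
    sum the jumps cancel and only a dip of width about 1/l remains at each end point of I. The
    squared dip has mean of order 1/l and its squared derivative has mean of order l; the norm is
    controlled by the product of the two, so it stays bounded but need not tend to 0, and the limit
    of the Weyl operators is only weak.

    The form omega is computed from Fourier coefficients, where disjointness of supports is
    invisible. Its vanishing on separated supports is recovered from Cesaro means of the coefficient
    sum.

    The operator iota(a) involves all rho_{-m}(a) at once, so a norm bound uniform in m is needed
    before iota(a) is a bounded operator at all; this is the use of the boundedness of
    automorphisms. *)

Section RealSums.
Variables (R : realType).

Lemma asum_partial_sums (X : choiceType) (f : X -> R) (B : R) :
  (forall s : seq X, uniq s -> \sum_(x <- s) `|f x| <= B) ->
  (\esum_(x in setT) `|f x|%:E <= B%:E)%E.
Proof.
move=> fB; apply: ge_ereal_sup => _ [A [finA _]] <-.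
by rewrite fsbig_finite//= sumEFin lee_fin; apply: fB; exact: finmap.fset_uniq.
Qed.

Lemma asum_bounded (X : choiceType) (f : X -> R) (B : R) :
  (forall s : seq X, uniq s -> \sum_(x <- s) `|f x| <= B) -> asum f.
Proof. by move=> /asum_partial_sums h; apply: le_lt_trans h (ltry _). Qed.

Lemma rsum_le_bound (X : choiceType) (f : X -> R) (B : R) : (forall x, 0 <= f x) ->
  (forall s : seq X, uniq s -> \sum_(x <- s) f x <= B) -> rsum f <= B.
Proof.
move=> f0 fB; have fB' (s : seq X) : uniq s -> \sum_(x <- s) `|f x| <= B.
  by move=> us; under eq_bigr do rewrite ger0_norm//; exact: fB.
rewrite rsum_ge0E// -lee_fin fineK; last by apply: asum_fin => //; exact: asum_bounded fB'.
by under eq_esum do rewrite -[f _]ger0_norm//; exact: asum_partial_sums.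
Qed.

Lemma partial_sum_le_rsum (X : choiceType) (f : X -> R) (s : seq X) :
  asum f -> (forall x, 0 <= f x) -> uniq s -> \sum_(x <- s) f x <= rsum f.
Proof.
move=> sf f0 us; rewrite rsum_ge0E// -lee_fin fineK ?asum_fin//.
apply: ereal_sup_ubound; exists [set` s]; first by split => //; exact: finite_seq.
by rewrite -fsbig_seq// sumEFin.
Qed.

Lemma asumN (X : choiceType) (f : X -> R) : asum f -> asum (fun x => - f x).
Proof. by rewrite /asum; under [in X in _ -> X]eq_esum do rewrite normrN. Qed.

Lemma asumB (X : choiceType) (f g : X -> R) : asum f -> asum g -> asum (fun x => f x - g x).
Proof. by move=> sf /asumN; exact: asumD. Qed.

Lemma asum_norm (X : choiceType) (f : X -> R) : asum f -> asum (fun x => `|f x|).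
Proof. by rewrite /asum; under [in X in _ -> X]eq_esum do rewrite normr_id. Qed.

Lemma asum0 (X : choiceType) : asum (fun _ : X => 0 : R).
Proof. by rewrite /asum esum1 ?ltry// => x _; rewrite normr0. Qed.

Lemma rsum0 (X : choiceType) : rsum (fun _ : X => 0 : R) = 0.
Proof. by rewrite rsum_ge0E// esum1. Qed.

Lemma rsumB (X : choiceType) (f g : X -> R) : asum f -> asum g ->
  rsum (fun x => f x - g x) = rsum f - rsum g.
Proof. by move=> sf sg; rewrite rsumD ?rsumN//; exact: asumN. Qed.

Lemma rsum_ge0 (X : choiceType) (f : X -> R) : (forall x, 0 <= f x) -> 0 <= rsum f.
Proof.
by move=> f0; rewrite rsum_ge0E// fine_ge0// esum_ge0// => x _; rewrite lee_fin.
Qed.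

Lemma rsum_le (X : choiceType) (f g : X -> R) : asum f -> asum g ->
  (forall x, f x <= g x) -> rsum f <= rsum g.
Proof.
move=> sf sg fg; rewrite -subr_ge0 -rsumB//; apply: rsum_ge0 => x.
by rewrite subr_ge0.
Qed.

Lemma rsum_norm (X : choiceType) (f : X -> R) : asum f -> `|rsum f| <= rsum (fun x => `|f x|).
Proof.
move=> sf; have sN := asum_norm sf; rewrite ler_norml -rsumN; apply/andP; split.
  by apply: rsum_le => // [|x]; [exact: asumN | rewrite lerNl -normrN ler_norm].
by apply: rsum_le => // x; rewrite ler_norm.
Qed.

Lemma esum_inj (X Y : choiceType) (h : X -> Y) (g : Y -> \bar R) : injective h ->
  (forall y, (forall x, h x <> y) -> g y = 0%E) ->
  \esum_(y in setT) g y = \esum_(x in setT) g (h x).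
Proof.
move=> hi g0; rewrite -(esum_image setT h g); last by move=> ? ? _ _; exact: hi.
rewrite [RHS]esum_mkcond; apply: eq_esum => y _; case: ifPn => //.
move=> /negP yn; rewrite g0// => x hx; apply: yn; rewrite inE; by exists x.
Qed.

Lemma rsum_inj (X Y : choiceType) (h : X -> Y) (f : Y -> R) : injective h ->
  (forall y, (forall x, h x <> y) -> f y = 0) -> rsum f = rsum (f \o h).
Proof.
move=> hi f0; rewrite /rsum.
by rewrite !(esum_inj hi) // => y /f0 ->; rewrite ?oppr0 maxxx.
Qed.

Lemma asum_injE (X Y : choiceType) (h : X -> Y) (f : Y -> R) : injective h ->
  (forall y, (forall x, h x <> y) -> f y = 0) -> asum (f \o h) -> asum f.
Proof.
move=> hi f0; rewrite /asum (esum_inj hi)// => y /f0 ->; by rewrite normr0.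
Qed.

Lemma asum_inj (X Y : choiceType) (h : X -> Y) (f : Y -> R) : injective h ->
  asum f -> asum (f \o h).
Proof.
rewrite /asum => hi sf; rewrite -(esum_image setT h (fun y => `|f y|%:E)); last first.
  by move=> ? ? _ _; exact: hi.
apply: le_lt_trans sf; rewrite [leLHS]esum_mkcond; apply: le_esum => y _.
by case: ifP.
Qed.

Lemma rsum_supp1 (X : choiceType) (x : X) (f : X -> R) :
  (forall y, y != x -> f y = 0) -> rsum f = f x.
Proof.
move=> f0; have E (g : X -> R) : (forall y, y != x -> g y = 0) -> 0 <= g x ->
    \esum_(y in setT) (g y)%:E = (g x)%:E.
  move=> g0 gx; rewrite -(@esum_set1 R X x (fun x => (g x)%:E)) ?lee_fin//.
  rewrite [RHS]esum_mkcond; apply: eq_esum => y _; case: ifPn => //.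
  by move=> /negP yx; rewrite g0//; apply/eqP => yx'; apply: yx; rewrite inE.
rewrite /rsum (E (fun y => Num.max (f y) 0)) ?(E (fun y => Num.max (- f y) 0)) /=;
  do ?[by move=> y /f0 ->; rewrite ?oppr0 maxxx | by rewrite le_max lexx orbT].
by case: (leP (f x) 0); case: (leP (- f x) 0); lra.
Qed.

Lemma asum_supp1 (X : choiceType) (x : X) (f : X -> R) :
  (forall y, y != x -> f y = 0) -> asum f.
Proof.
move=> f0; apply: (@asum_bounded _ _ `|f x|) => s us.
have [xs|xs] := boolP (x \in s).
  rewrite (bigD1_seq x)//= big1 ?addr0// => y /f0 ->; exact: normr0.
rewrite big_seq big1// => y ys; rewrite f0 ?normr0//.
by apply: contraNneq xs => <-.
Qed.

Lemma asum_sum (X : choiceType) (J : Type) (s : seq J) (F : J -> X -> R) :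
  (forall j, asum (F j)) -> asum (fun x => \sum_(j <- s) F j x).
Proof.
move=> sF; elim: s => [|j s IH].
  by under eq_fun do rewrite big_nil; exact: asum0.
by under eq_fun do rewrite big_cons; exact: asumD.
Qed.

Lemma rsum_sum (X : choiceType) (J : Type) (s : seq J) (F : J -> X -> R) :
  (forall j, asum (F j)) -> rsum (fun x => \sum_(j <- s) F j x) = \sum_(j <- s) rsum (F j).
Proof.
move=> sF; elim: s => [|j s IH].
  by under eq_fun do rewrite big_nil; rewrite big_nil rsum0.
under eq_fun do rewrite big_cons; rewrite rsumD// ?IH ?big_cons//.
exact: asum_sum.
Qed.

Section Product.
Variables (X : choiceType) (J : finType).
Implicit Types a : X * J -> R.

Let pick a (j : J) (p : X * J) : R := if p.2 == j then a p else 0.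

Let pick_sum a : a = (fun p => \sum_j pick a j p).
Proof.
apply/funext => p; rewrite (bigD1 p.2)//= /pick eqxx big1 ?addr0// => j.
by rewrite eq_sym => /negPf ->.
Qed.

Lemma asum_slice a j : asum a -> asum (fun x => a (x, j)).
Proof. by apply: (@asum_inj _ _ (fun x => (x, j))) => x y []. Qed.

Let pick0 a j p : (forall x, (x, j) <> p) -> pick a j p = 0.
Proof. by case: p => x j' h; rewrite /pick /=; case: eqP => // jj; case: (h x); rewrite jj. Qed.

Let pickE a j : pick a j \o (fun x => (x, j)) = fun x => a (x, j).
Proof. by apply/funext => x; rewrite /pick /= eqxx. Qed.

Let pair_inj (j : J) : injective (fun x : X => (x, j)).
Proof. by move=> x y []. Qed.

Let asum_pick a j : asum (fun x => a (x, j)) -> asum (pick a j).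
Proof. by move=> sa; apply: (asum_injE (@pair_inj j) (@pick0 a j)); rewrite pickE. Qed.

Lemma asum_prod a : (forall j, asum (fun x => a (x, j))) -> asum a.
Proof. by move=> sa; rewrite (pick_sum a); apply: asum_sum => j; exact: asum_pick. Qed.

Lemma rsum_prod a : asum a -> rsum a = \sum_j rsum (fun x => a (x, j)).
Proof.
move=> sa; rewrite [in LHS](pick_sum a) rsum_sum; last by move=> j; apply/asum_pick/asum_slice.
by apply: eq_bigr => j _; rewrite (rsum_inj (@pair_inj j) (@pick0 a j)) pickE.
Qed.

End Product.

(** Ordered partial sums compute an unconditional sum over [nat]; this gives the Cesaro argument for
    the symplectic form access to an [rsum]. *)
Lemma cvg_rsum (f : nat -> R) : asum f ->
  (fun n => \sum_(0 <= k < n) f k) @ \oo --> rsum f.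
Proof.
have pos (g : nat -> R) : asum g -> (forall k, 0 <= g k) ->
    (fun n => \sum_(0 <= k < n) g k) @ \oo --> fine (\esum_(x in setT) (g x)%:E).
  move=> sg g0.
  suff /fine_cvg : (fun n => (\sum_(0 <= k < n) g k)%:E) @ \oo -->
    (fine (\esum_(x in setT) (g x)%:E))%:E by [].
  rewrite fineK; last exact: asum_fin.
  rewrite -nneseries_esumT; last by move=> n; rewrite lee_fin.
  have -> : (fun n => (\sum_(0 <= k < n) g k)%:E) = (fun n => (\sum_(0 <= k < n) (g k)%:E)%E).
    by apply/funext => n; rewrite sumEFin.
  by apply: is_cvg_nneseries => n _ _; rewrite lee_fin.
move=> sf; have [fp fn] := asum_parts sf.
have m0 (r : R) : 0 <= Num.max r 0 by rewrite le_max lexx orbT.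
rewrite (_ : (fun n => _) =
  (fun n => \sum_(0 <= k < n) Num.max (f k) 0) \- (fun n => \sum_(0 <= k < n) Num.max (- f k) 0)).
  exact: cvgB (pos _ fp (fun k => m0 _)) (pos _ fn (fun k => m0 _)).
apply/funext => n; rewrite /= -sumrB; apply: eq_bigr => k _.
by case: (leP (f k) 0); case: (leP (- f k) 0); lra.
Qed.

End RealSums.

(** * Hilbert spaces *)

Section RealInnerProduct.
Variables (R : realType) (H : hilbert R).
Implicit Types (x y z : H) (r : R).

(** The underlying real inner product. Projection and the Riesz theorem need only real scalars, and
    [hdotE] recovers the complex product. *)
Definition redot x y : R := complex.Re (hdot x y).

Lemma redotC x y : redot y x = redot x y.
Proof. by rewrite /redot hdotC; case: (hdot x y). Qed.

Lemma redotDr x y z : redot x (y + z) = redot x y + redot x z.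
Proof. by rewrite /redot hdotDr; case: (hdot x y) (hdot x z) => ? ? []. Qed.

Lemma redotDl x y z : redot (x + y) z = redot x z + redot y z.
Proof. by rewrite redotC redotDr !(redotC z). Qed.

Lemma redotZr r x y : redot x (r%:C *: y) = r * redot x y.
Proof. by rewrite /redot hdotZr; case: (hdot x y) => a b /=; rewrite mul0r subr0. Qed.

Lemma redotZl r x y : redot (r%:C *: x) y = r * redot x y.
Proof. by rewrite redotC redotZr redotC. Qed.

Lemma redotNr x y : redot x (- y) = - redot x y.
Proof. by rewrite -scaleN1r -(rmorph1 (real_complex R)) -rmorphN redotZr mulN1r. Qed.

Lemma redotNl x y : redot (- x) y = - redot x y.
Proof. by rewrite redotC redotNr redotC. Qed.

Lemma redotBr x y z : redot x (y - z) = redot x y - redot x z.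
Proof. by rewrite redotDr redotNr. Qed.

Lemma redotBl x y z : redot (x - y) z = redot x z - redot y z.
Proof. by rewrite redotDl redotNl. Qed.

Lemma redot0r x : redot x 0 = 0.
Proof. by rewrite /redot hdot0r. Qed.

Lemma redot0l x : redot 0 x = 0.
Proof. by rewrite redotC redot0r. Qed.

Lemma redotxx x : redot x x = hnorm2 x.
Proof. by []. Qed.

Lemma redot_iZl x y : redot ('i *: x) y = complex.Im (hdot x y).
Proof. by rewrite /redot hdotZl; case: (hdot x y) => a b /=; ring. Qed.

Lemma redot_iZr x y : redot x ('i *: y) = - complex.Im (hdot x y).
Proof. by rewrite /redot hdotZr; case: (hdot x y) => a b /=; ring. Qed.

Lemma hdotE x y : hdot x y = redot x y +i* redot ('i *: x) y.
Proof. by rewrite redot_iZl /redot; case: (hdot x y). Qed.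

Lemma hdotNr x y : hdot x (- y) = - hdot x y.
Proof. by rewrite -scaleN1r hdotZr mulN1r. Qed.

Lemma hdot0l x : hdot 0 x = 0.
Proof. by rewrite hdotC hdot0r rmorph0. Qed.

Lemma redot_eq0 x : (forall y, redot y x = 0) -> x = 0.
Proof. by move=> h; apply: hnorm2_eq0; exact: (h x). Qed.

Lemma redot_inj x y : (forall z, redot z x = redot z y) -> x = y.
Proof.
by move=> h; apply/eqP; rewrite -subr_eq0; apply/eqP/redot_eq0 => z; rewrite redotBr h subrr.
Qed.

Lemma hdot_inj x y : (forall z, hdot z x = hdot z y) -> x = y.
Proof. by move=> h; apply: redot_inj => z; rewrite /redot h. Qed.

Lemma hnorm2B x y : hnorm2 (x - y) = hnorm2 x + hnorm2 y - 2 * redot x y.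
Proof. by rewrite hnorm2D hnorm2N -/(redot _ _) redotNr mulrN. Qed.

Lemma hnorm2Zr r x : hnorm2 (r%:C *: x) = r ^+ 2 * hnorm2 x.
Proof. by rewrite hnorm2Z /=; ring. Qed.

Lemma hnorm2_gt0 x : x != 0 -> 0 < hnorm2 x.
Proof.
by move=> x0; rewrite lt_neqAle hnorm2_ge0 andbT eq_sym; apply: contra x0 => /eqP/hnorm2_eq0 ->.
Qed.

Lemma Cauchy_Schwarz x y : redot x y ^+ 2 <= hnorm2 x * hnorm2 y.
Proof.
have [->|x0] := eqVneq x 0; first by rewrite redot0l expr0n mulr_ge0 ?hnorm2_ge0.
have nx := hnorm2_gt0 x0.
have := hnorm2_ge0 ((hnorm2 x)%:C *: y - (redot x y)%:C *: x).
rewrite hnorm2B !hnorm2Zr redotZl redotZr (redotC x y).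
set a := hnorm2 x in nx *; set b := redot x y; set c := hnorm2 y => h.
have : 0 <= a * (a * c - b ^+ 2) by move: h; lra.
by rewrite pmulr_rge0// subr_ge0.
Qed.

(** AM-GM with a free weight: a small r makes the coefficient of the first term nearly 1, so that
    sharp norm bounds pass to limits. *)
Lemma hnorm2D_weighted x y r : 0 < r ->
  hnorm2 (x + y) <= (1 + r) * hnorm2 x + (1 + r^-1) * hnorm2 y.
Proof.
move=> r0; have := hnorm2_ge0 (r%:C *: x - y).
rewrite hnorm2B hnorm2D -/(redot x y) hnorm2Zr redotZl => h.
have : 0 <= r^-1 * (r ^+ 2 * hnorm2 x + hnorm2 y - 2 * (r * redot x y)).
  by rewrite mulr_ge0// invr_ge0 ltW.
have -> : r^-1 * (r ^+ 2 * hnorm2 x + hnorm2 y - 2 * (r * redot x y)) =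
  r * hnorm2 x + r^-1 * hnorm2 y - 2 * redot x y by field; rewrite gt_eqF.
lra.
Qed.

Lemma hnorm_ge0 x : 0 <= hnorm x.
Proof. exact: sqrtr_ge0. Qed.

Lemma sqr_hnorm x : hnorm x ^+ 2 = hnorm2 x.
Proof. by rewrite sqr_sqrtr ?hnorm2_ge0. Qed.

Lemma redot_le x y : `|redot x y| <= hnorm x * hnorm y.
Proof.
rewrite -ler_sqr ?nnegrE ?mulr_ge0 ?hnorm_ge0// real_normK ?num_real// exprMn !sqr_hnorm.
exact: Cauchy_Schwarz.
Qed.

Lemma hnorm_le x y c : 0 <= c -> (hnorm x <= c * hnorm y) = (hnorm2 x <= c ^+ 2 * hnorm2 y).
Proof.
by move=> c0; rewrite -ler_sqr ?nnegrE ?mulr_ge0 ?hnorm_ge0// exprMn !sqr_hnorm.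
Qed.

Lemma hcauchy (u : nat -> H) :
  (forall eps : R, 0 < eps -> exists N, forall m n, (N <= m)%N -> (N <= n)%N ->
     hnorm2 (u m - u n) < eps) ->
  exists l, forall eps : R, 0 < eps -> exists N, forall n, (N <= n)%N ->
     hnorm2 (u n - l) < eps.
Proof.
move=> uc; have [eps e0|l lP] := @hcomplete R H u.
  have [N NP] := uc _ (exprn_gt0 2 e0); exists N => m n Nm Nn.
  by have := NP _ _ Nm Nn; rewrite -hnorm_lt.
exists l => eps e0; have s0 : 0 < Num.sqrt eps by rewrite sqrtr_gt0.
have [N NP] := lP _ s0; exists N => n Nn.
by have := NP _ Nn; rewrite -/(hnorm2 _) -/(hnorm _) hnorm_lt// sqr_sqrtr ?ltW.
Qed.

End RealInnerProduct.

(** * Closed real subspaces, orthogonal projection and Riesz representation *)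

Section Projection.
Variables (R : realType) (H : hilbert R).
Implicit Types (K T : set H) (x y z : H) (r : R).

Definition hclosed K := forall x,
  (forall eps : R, 0 < eps -> exists2 k, K k & hnorm2 (x - k) < eps) -> K x.

Record real_subspace K : Prop := {
  subspace0 : K 0;
  subspaceD : forall x y, K x -> K y -> K (x + y);
  subspaceZ : forall r x, K x -> K (r%:C *: x) }.

Lemma subspaceB K x y : real_subspace K -> K x -> K y -> K (x - y).
Proof.
move=> Ks Kx Ky; apply: (subspaceD Ks) => //.
by have := subspaceZ Ks (-1) Ky; rewrite rmorphN rmorph1 scaleN1r.
Qed.

(** A minimising sequence is Cauchy by the parallelogram law, its limit attains the distance, and
    minimality forces orthogonality. *)
Lemma projection K x : real_subspace K -> hclosed K ->
  exists2 p, K p & forall k, K k -> redot k (x - p) = 0.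
Proof.
move=> Ks Kc; pose D := [set hnorm2 (x - k) | k in K].
have D0 : has_inf D.
  split; first by exists (hnorm2 (x - 0)), 0 => //; exact: subspace0.
  by exists 0 => _ [k _ <-]; exact: hnorm2_ge0.
set d := inf D.
have dle k : K k -> d <= hnorm2 (x - k).
  by move=> Kk; apply: ge_inf; [exact: D0.2 | exists k].
have /choice[u uP] (n : nat) : exists k, K k /\ hnorm2 (x - k) < d + n.+1%:R^-1.
  have [_ [k Kk <-] kd] := @inf_adherent _ D (n.+1%:R^-1) ltac:(by rewrite invr_gt0) D0.
  by exists k.
(* Parallelogram law at the midpoint of a and b, which lies in K and hence at squared distance at
   least d from x. *)
have para (a b : H) : K a -> K b ->
    hnorm2 (a - b) <= 2 * hnorm2 (x - a) + 2 * hnorm2 (x - b) - 4 * d.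
  move=> Ka Kb; have := dle _ (subspaceZ Ks 2^-1 (subspaceD Ks Ka Kb)).
  have -> : x - (2^-1)%:C *: (a + b) = (2^-1)%:C *: ((x - a) + (x - b)).
    have half : x = (2^-1)%:C *: (x + x).
      rewrite scalerDr -scalerDl -rmorphD (_ : 2^-1 + 2^-1 = 1); last by field.
      by rewrite rmorph1 scale1r.
    by rewrite [x in LHS]half -scalerBr opprD addrACA.
  have -> : a - b = (x - b) - (x - a) by rewrite opprB [RHS]addrC addrA subrK.
  rewrite hnorm2Zr hnorm2B hnorm2D -/(redot _ _) (redotC (x - a)); lra.
have [p pP] : exists p, forall eps : R, 0 < eps -> exists N, forall n, (N <= n)%N ->
    hnorm2 (u n - p) < eps.
  apply: hcauchy => eps e0.
  have [N _ NP] : \forall n \near \oo, n.+1%:R^-1 < eps / 4.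
    by apply: near_infty_natSinv_lt (PosNum _); rewrite divr_gt0.
  exists N => m n Nm Nn; have [Km um] := uP m; have [Kn un] := uP n.
  apply: le_lt_trans (para _ _ Km Kn) _.
  have /= := NP _ Nm; have /= := NP _ Nn; move: um un.
  move: (m.+1%:R^-1) (n.+1%:R^-1) => A B; lra.
have Kp : K p.
  apply: Kc => eps e0; have [N NP] := pP _ e0; exists (u N); first by case: (uP N).
  by rewrite -opprB hnorm2N; exact: NP.
exists p => // k Kk.
have pd : hnorm2 (x - p) <= d.
  apply/ler_addgt0Pl => eps e0.
  have d0 : 0 <= d by apply: lb_le_inf; [exact: D0.1 | move=> _ [k' _ <-]; exact: hnorm2_ge0].
  (* The weight t keeps [t * (d + 1)] at eps / 4, and the tolerance in [e1] then makes the second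
     term of the weighted bound at most eps / 4. *)
  pose t := eps / (4 * (d + 1)); have t0 : 0 < t by rewrite divr_gt0//; lra.
  have d1 : d + 1 != 0 by apply: lt0r_neq0; move: d0; lra.
  have tE : t * (d + 1) = eps / 4 by rewrite /t; field.
  have t1 : 0 < 1 + t by lra.
  have e1 : 0 < t * (eps / 4) / (1 + t).
    by apply: divr_gt0 => //; apply: mulr_gt0 => //; exact: divr_gt0.
  have [N NP] := pP _ e1.
  have [M _ MP] : \forall n \near \oo, n.+1%:R^-1 < Num.min (eps / 4) 1.
    by apply: near_infty_natSinv_lt (PosNum _); rewrite lt_min divr_gt0/=.
  have := NP _ (leq_maxl N M); have /= := MP _ (leq_maxr N M); have [_] := uP (maxn N M).
  set n := maxn N M; set v := u n; rewrite lt_min => h1 /andP[h2 h3] h4.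
  have {}h4 : (1 + t^-1) * hnorm2 (v - p) <= eps / 4.
    have -> : eps / 4 = (1 + t^-1) * (t * (eps / 4) / (1 + t)) by field; rewrite (gt_eqF t0) (gt_eqF t1).
    by apply: ler_wpM2l; [rewrite addr_ge0// invr_ge0 ltW | exact: ltW].
  have -> : x - p = (x - v) + (v - p) by rewrite addrA subrK.
  apply: le_trans (hnorm2D_weighted _ _ t0) _.
  by move: h1 h2 h3 h4 tE; move: (hnorm2 _) (hnorm2 _) (n.+1%:R^-1) => A B E; nra.
have key r : 0 <= r ^+ 2 * hnorm2 k - 2 * r * redot k (x - p).
  have := dle _ (subspaceD Ks Kp (subspaceZ Ks r Kk)).
  rewrite opprD addrA hnorm2B hnorm2Zr redotZr (redotC k); lra.
(* At this r the quadratic is negative unless the inner product vanishes; the denominator 1 + hnorm2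
   k also covers k = 0. *)
have := key (redot k (x - p) / (1 + hnorm2 k)).
have := hnorm2_ge0 k; move: (hnorm2 k) (redot k (x - p)) => n q n0.
have n2 : 0 < 1 + n by lra.
have n1 : 0 < (1 + n) ^+ 2 by exact: exprn_gt0.
rewrite -(pmulr_rge0 _ n1) => h.
have {}h : 0 <= - (q ^+ 2 * (n + 2)).
  apply: le_trans h _; rewrite le_eqVlt; apply/orP; left; apply/eqP; field; by rewrite (gt_eqF n2).
have q2 := sqr_ge0 q; have : q ^+ 2 = 0 by nra.
by move=> /eqP; rewrite sqrf_eq0 => /eqP.
Qed.

(** Orthogonality is tested in the real product, so the total families below carry a free complex
    scalar or are stable under complex multiples. *)
Definition total T := forall z, (forall t, T t -> redot t z = 0) -> z = 0.

Lemma closed_total K T x : real_subspace K -> hclosed K -> T `<=` K -> total T -> K x.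
Proof.
move=> Ks Kc TK Tt; have [p Kp pP] := projection x Ks Kc.
suff /eqP : x - p = 0 by rewrite subr_eq0 => /eqP ->.
by apply: Tt => t /TK; exact: pP.
Qed.

(** For a bounded sequence, the vectors whose pairing with it tends to 0 form a closed real
    subspace. *)
Lemma weak_cvg_total T (v : nat -> H) (B : R) : (forall j, hnorm2 (v j) <= B) -> total T ->
  (forall t, T t -> (fun j => redot t (v j)) @ \oo --> (0 : R)) ->
  forall y, (fun j => redot y (v j)) @ \oo --> (0 : R).
Proof.
move=> vB Tt T0 y.
apply: (@closed_total [set y | (fun j => redot y (v j)) @ \oo --> (0 : R)] T) => //.
  split=> /=.
  - by under eq_fun do rewrite redot0l; exact: cvg_cst.
  - move=> a b ha hb; under eq_fun do rewrite redotDl.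
    by have := cvgD ha hb; rewrite addr0; exact.
  - move=> r a ha; under eq_fun do rewrite redotZl.
    by have := cvgM (cvg_cst r) ha; rewrite mulr0; exact.
have B0 : 0 <= B by apply: le_trans (vB 0%N); exact: hnorm2_ge0.
move=> z zP; apply/cvgrPdist_lt => eps e0 /=.
have e1 : 0 < (eps / 2) ^+ 2 / (B + 1) by rewrite divr_gt0 ?exprn_gt0 ?divr_gt0//; lra.
have [k kP zk] := zP _ e1.
have e2 : 0 < eps / 2 by rewrite divr_gt0.
have /cvgrPdist_lt/(_ _ e2)[N _ NP] := kP.
exists N => // j Nj; have := NP _ Nj; rewrite !sub0r !normrN /= => h.
have -> : z = (z - k) + k by rewrite subrK.
rewrite redotDl; apply: le_lt_trans (ler_normD _ _) _.
suff : `|redot (z - k) (v j)| < eps / 2 by lra.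
rewrite -ltr_sqr ?nnegrE ?(ltW e2)// real_normK ?num_real//.
apply: le_lt_trans (Cauchy_Schwarz _ _) _.
have -> : (eps / 2) ^+ 2 = (eps / 2) ^+ 2 / (B + 1) * (B + 1) by rewrite divfK//; lra.
move: (vB j) (hnorm2_ge0 (v j)) (hnorm2_ge0 (z - k)) zk.
move: (_ / (B + 1)) e1 (hnorm2 _) (hnorm2 _) => E E0 p q; nra.
Qed.

Lemma Riesz (f : H -> R) (c : R) : (forall x y, f (x + y) = f x + f y) ->
  (forall r x, f (r%:C *: x) = r * f x) -> (forall x, `|f x| <= c * hnorm x) ->
  exists z, forall x, f x = redot z x.
Proof.
move=> fD fZ fc; pose K := [set x | f x = 0].
have f0 : f 0 = 0 by rewrite -(scale0r 0) -(rmorph0 (real_complex R)) fZ mul0r.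
have fN x : f (- x) = - f x by apply/eqP; rewrite -addr_eq0 -fD addNr f0.
have [K1|] := pselect (forall x, f x = 0).
  by exists 0 => x; rewrite redot0l K1.
move=> /existsNP[x0 /eqP fx0].
have Ks : real_subspace K.
  by split => //= [x y|r x]; rewrite /K/= ?fD ?fZ; [move=> -> ->; rewrite addr0 | move=> ->; rewrite mulr0].
have Kc : hclosed K.
  move=> x xP; apply/eqP; rewrite -normr_eq0 eq_le normr_ge0 andbT.
  have c0 : 0 < `|c| + 1 by rewrite ltr_wpDl.
  apply/ler_addgt0Pl => eps e0; rewrite addr0.
  have [k Kk xk] := xP ((eps / (`|c| + 1)) ^+ 2) ltac:(by rewrite exprn_gt0// divr_gt0).
  have -> : f x = f (x - k) by rewrite fD fN Kk oppr0 addr0.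
  rewrite -hnorm_lt ?divr_gt0// in xk.
  apply: le_trans (fc _) _; have hx := hnorm_ge0 (x - k).
  apply: (@le_trans _ _ ((`|c| + 1) * hnorm (x - k))).
    by apply: ler_wpM2r => //; have := ler_norm c; lra.
  by rewrite mulrC -ler_pdivlMr// ltW.
have [p Kp pP] := projection x0 Ks Kc; set w := x0 - p in pP.
have fw : f w = f x0 by rewrite fD fN Kp oppr0 addr0.
have w0 : w != 0 by apply: contra fx0 => /eqP w0; rewrite -fw w0 f0.
have nw := hnorm2_gt0 w0.
exists ((f w / hnorm2 w)%:C *: w) => x; rewrite redotZl.
have : K (x - (f x / f w)%:C *: w) by rewrite /K/= fD fN fZ divfK ?subrr// fw.
move=> /pP; rewrite redotBl redotZl redotxx (redotC w) => /eqP; rewrite subr_eq0 => /eqP ->.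
by field; rewrite fw fx0 gt_eqF.
Qed.

End Projection.

(** * Operators and bicommutants *)

Section BoundedOperators.
Variables (R : realType) (H : hilbert R).
Implicit Types (S T : H -> H) (A M : set (H -> H)) (x y z : H).

Lemma bounded_opP T : linear T ->
  (exists2 c : R, 0 < c & forall x, hnorm2 (T x) <= c ^+ 2 * hnorm2 x) <-> bounded_op T.
Proof.
move=> Tl; split=> [[c c0 cT]|[_ [c cT]]].
  by split=> //; exists c => x; rewrite hnorm_le; [exact: cT | exact: ltW].
exists (`|c| + 1); first by rewrite ltr_wpDl.
move=> x; rewrite -hnorm_le ?addr_ge0//; apply: le_trans (cT x) _.
by apply: ler_wpM2r; [exact: hnorm_ge0 | have := ler_norm c; lra].
Qed.

Lemma bounded_op_pos T : bounded_op T ->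
  exists2 c : R, 0 < c & forall x, hnorm2 (T x) <= c ^+ 2 * hnorm2 x.
Proof. by move=> Tb; apply/(bounded_opP (proj1 Tb)). Qed.

Lemma bounded_linear T a x y : bounded_op T -> T (a *: x + y) = a *: T x + T y.
Proof. by case=> Tl _; exact: Tl. Qed.

Lemma bounded0 T : bounded_op T -> T 0 = 0.
Proof.
move=> Tb; have := bounded_linear (-1) 0 0 Tb.
by rewrite !scaleN1r oppr0 addr0 addNr.
Qed.

Lemma boundedD T x y : bounded_op T -> T (x + y) = T x + T y.
Proof. by move=> Tb; have := bounded_linear 1 x y Tb; rewrite !scale1r. Qed.

Lemma boundedZ T a x : bounded_op T -> T (a *: x) = a *: T x.
Proof. by move=> Tb; rewrite -[a *: x]addr0 bounded_linear// bounded0// addr0. Qed.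

Lemma boundedN T x : bounded_op T -> T (- x) = - T x.
Proof. by move=> Tb; rewrite -scaleN1r boundedZ// scaleN1r. Qed.

Lemma boundedB T x y : bounded_op T -> T (x - y) = T x - T y.
Proof. by move=> Tb; rewrite boundedD// boundedN. Qed.

Lemma bounded_id : bounded_op (@id H).
Proof. by split=> //; exists 1 => x; rewrite mul1r. Qed.

Lemma bounded_comp S T : bounded_op S -> bounded_op T -> bounded_op (S \o T).
Proof.
move=> Sb Tb; have [c c0 cS] := bounded_op_pos Sb; have [d d0 dT] := bounded_op_pos Tb.
apply/bounded_opP => [a x y|]; first by rewrite /= !bounded_linear.
exists (c * d); first exact: mulr_gt0.
move=> x /=; apply: le_trans (cS _) _; rewrite exprMn -(mulrA (c ^+ 2)).
by apply: ler_wpM2l; rewrite ?sqr_ge0.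
Qed.

Lemma bounded_lin a S T : bounded_op S -> bounded_op T -> bounded_op (a *: S + T).
Proof.
move=> Sb Tb; have [c c0 cS] := bounded_op_pos Sb; have [d d0 dT] := bounded_op_pos Tb.
have a0 : 0 <= complex.Re (a^* * a) by case: a => p q /=; rewrite mulNr opprK addr_ge0// -expr2 sqr_ge0.
set r := complex.Re (a^* * a) in a0; apply/bounded_opP.
  move=> b x y.
  change (a *: S (b *: x + y) + T (b *: x + y) = b *: (a *: S x + T x) + (a *: S y + T y)).
  by rewrite (bounded_linear b x y Sb) (bounded_linear b x y Tb) !scalerDr !scalerA mulrC addrACA.
have e0 : 0 < 2 * (r * c ^+ 2 + d ^+ 2).
  by rewrite mulr_gt0// ltr_wpDl ?exprn_gt0// mulr_ge0// sqr_ge0.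
exists (Num.sqrt (2 * (r * c ^+ 2 + d ^+ 2))); first by rewrite sqrtr_gt0.
move=> x; rewrite sqr_sqrtr ?(ltW e0)//; change (hnorm2 (a *: S x + T x) <= 2 * (r * c ^+ 2 + d ^+ 2) * hnorm2 x).
apply: le_trans (hnorm2D_le _ _) _; rewrite hnorm2Z -/r -(mulrA 2).
apply: ler_wpM2l => //; rewrite mulrDl -(mulrA r); apply: lerD => //.
by apply: ler_wpM2l.
Qed.

Lemma adjoint_sym S T : adjoint S T -> adjoint T S.
Proof. by move=> ST x y; rewrite hdotC -ST -hdotC. Qed.

Lemma adjoint_uniq S T T' : adjoint S T -> adjoint S T' -> T = T'.
Proof.
move=> h h'; apply/funext => x; apply: hdot_inj => z.
by rewrite hdotC -h h' -hdotC.
Qed.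

Lemma adjoint_comp S S' T T' : adjoint S S' -> adjoint T T' -> adjoint (S \o T) (T' \o S').
Proof. by move=> hS hT x y; rewrite /= hS hT. Qed.

Lemma adjoint_bound S T (c : R) : adjoint S T -> 0 < c ->
  (forall x, hnorm2 (S x) <= c ^+ 2 * hnorm2 x) -> forall x, hnorm2 (T x) <= c ^+ 2 * hnorm2 x.
Proof.
move=> ST c0 cS x; have [->|Tx0] := eqVneq (T x) 0.
  by rewrite hnorm2_0 mulr_ge0 ?sqr_ge0 ?hnorm2_ge0.
have nT := hnorm2_gt0 Tx0.
have : hnorm2 (T x) ^+ 2 <= hnorm2 x * (c ^+ 2 * hnorm2 (T x)).
  have -> : hnorm2 (T x) = redot x (S (T x)) by rewrite /redot ST.
  apply: le_trans (Cauchy_Schwarz _ _) _; apply: ler_wpM2l; first exact: hnorm2_ge0.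
  by apply: le_trans (cS _) _; rewrite /redot ST.
by rewrite expr2 mulrA ler_pM2r// mulrC.
Qed.

Lemma adjoint_linear S T : adjoint S T -> linear T.
Proof.
move=> ST a x y; apply: hdot_inj => z; have TS := adjoint_sym ST.
by rewrite TS hdotDr hdotZr -!TS -hdotZr -hdotDr.
Qed.

Lemma adjoint_bounded S T : adjoint S T -> bounded_op S -> bounded_op T.
Proof.
move=> ST Sb; have [c c0 cS] := bounded_op_pos Sb.
apply/bounded_opP; first exact: adjoint_linear ST.
by exists c => //; exact: adjoint_bound cS.
Qed.

Lemma adjoint_exists T : bounded_op T -> exists2 T', bounded_op T' & adjoint T T'.
Proof.
move=> Tb; have [c c0 cT] := bounded_op_pos Tb.
have /choice[T' T'P] x : exists z, forall y, redot x (T y) = redot z y.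
  apply: (@Riesz _ _ _ (hnorm x * c)) => [y z|r y|y].
  - by rewrite boundedD// redotDr.
  - by rewrite boundedZ// redotZr.
  - apply: le_trans (redot_le _ _) _; rewrite -mulrA; apply: ler_wpM2l; first exact: hnorm_ge0.
    by rewrite hnorm_le// ltW.
(* [T'] is so far the adjoint for the real product; since T commutes with i, it also matches the
   imaginary parts. *)
have adj : adjoint T T'.
  move=> x y; rewrite !hdotE -T'P; congr (_ +i* _).
  have r_iN (u v : H) : redot ('i *: u) v = - redot u ('i *: v).
    by rewrite redot_iZl redot_iZr opprK.
  by rewrite !r_iN -T'P boundedZ.
by exists T' => //; exact: adjoint_bounded adj Tb.
Qed.

Lemma unitary_isometry T x : unitary T -> hnorm2 (T x) = hnorm2 x.
Proof. by case=> _ iT _; rewrite /hnorm2 iT. Qed.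

Lemma unitary_bounded T : unitary T -> bounded_op T.
Proof.
move=> Tu; have [Tl _ _] := Tu; apply/bounded_opP => //.
by exists 1 => // x; rewrite unitary_isometry// expr1n mul1r.
Qed.

Lemma unitary_adjointK T T' : unitary T -> adjoint T T' -> T' \o T = id /\ T \o T' = id.
Proof.
move=> [_ iT sT] TT'; have K x : T' (T x) = x.
  by apply: hdot_inj => z; rewrite (adjoint_sym TT') iT.
split; apply/funext => x //=; have [y <-] := sT x; by rewrite K.
Qed.

Lemma bounded_ext S T (D : set H) : bounded_op S -> bounded_op T -> total D ->
  (forall d, D d -> S d = T d) -> S = T.
Proof.
move=> Sb Tb Dt ST; have Ub := bounded_lin (-1) Tb Sb.
have [c c0 cU] := bounded_op_pos Ub.
apply/funext => x; apply: (@closed_total _ _ [set x | S x = T x] D) => //.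
  split=> /=; first by rewrite !bounded0.
    by move=> y z; rewrite !boundedD// => -> ->.
  by move=> r y; rewrite !boundedZ// => ->.
move=> y yP /=; apply/eqP; rewrite -subr_eq0; apply/eqP/hnorm2_eq0/eqP.
rewrite eq_le hnorm2_ge0 andbT; apply/ler_addgt0Pl => eps e0; rewrite addr0.
have e1 : 0 < eps / c ^+ 2 by rewrite divr_gt0// exprn_gt0.
have [k kP yk] := yP _ e1.
have -> : S y - T y = (-1 *: T + S) (y - k).
  change (S y - T y = -1 *: T (y - k) + S (y - k)).
  by rewrite (boundedB _ _ Sb) (boundedB _ _ Tb) (kP : S k = T k) scaleN1r opprB [RHS]addrC addrA subrK.
apply: le_trans (cU _) _; rewrite mulrC -ler_pdivlMr ?exprn_gt0//; exact: ltW.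
Qed.

End BoundedOperators.

(** * Commutants and generated von Neumann algebras *)

Section Commutants.
Variables (R : realType) (H : hilbert R).
Implicit Types (S T : H -> H) (A B M : set (H -> H)).

Definition star_closed A := forall S, A S -> exists2 S', A S' & adjoint S S'.

Record star_algebra A : Prop := {
  sa_bounded : forall S, A S -> bounded_op S;
  sa_id : A id;
  sa_lin : forall a S T, A S -> A T -> A (a *: S + T);
  sa_comp : forall S T, A S -> A T -> A (S \o T);
  sa_star : star_closed A }.

Lemma commutant_anti A B : A `<=` B -> commutant B `<=` commutant A.
Proof. by move=> AB T [Tb TB]; split=> // S /AB; exact: TB. Qed.

Lemma bicommutant_mono A B : A `<=` B -> bicommutant A `<=` bicommutant B.
Proof. by move=> AB; apply/commutant_anti/commutant_anti. Qed.

Lemma sub_bicommutant A S : A S -> bounded_op S -> bicommutant A S.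
Proof. by move=> AS Sb; split=> // T [_ /(_ _ AS)]. Qed.

Lemma commutant_star A T T' : star_closed A -> commutant A T -> adjoint T T' -> commutant A T'.
Proof.
move=> As [Tb TA] TT'; split=> [|S AS]; first exact: adjoint_bounded TT' Tb.
have [S' AS' SS'] := As _ AS.
have := adjoint_comp TT' (adjoint_sym SS'); rewrite (TA _ AS').
by move/adjoint_uniq => /(_ _ (adjoint_comp (adjoint_sym SS') TT')).
Qed.

Lemma commutant_star_algebra A : star_closed A -> (forall T, A T -> bounded_op T) ->
  star_algebra (commutant A).
Proof.
move=> As Ab; split.
- by move=> S [].
- by split=> //; exact: bounded_id.
- move=> a S T [Sb SA] [Tb TA]; split=> [|U AU]; first exact: bounded_lin.
  apply/funext => x; have := congr1 (@^~ x) (SA _ AU); have := congr1 (@^~ x) (TA _ AU).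
  by rewrite /= !fctE /= (bounded_linear _ _ _ (Ab _ AU)) => -> ->.
- move=> S T [Sb SA] [Tb TA]; split=> [|U AU]; first exact: bounded_comp.
  by rewrite -compA (TA _ AU) compA (SA _ AU) compA.
- move=> T TA; have [T' T'b TT'] := adjoint_exists (proj1 TA).
  by exists T' => //; exact: commutant_star TA TT'.
Qed.

Lemma bicommutant_star_algebra A : star_closed A -> (forall T, A T -> bounded_op T) ->
  star_algebra (bicommutant A).
Proof.
move=> As Ab; apply: commutant_star_algebra; last by move=> T [].
exact: sa_star (commutant_star_algebra As Ab).
Qed.

Definition with_adjoints A := A `|` [set T | exists2 S, A S & adjoint S T].

Lemma with_adjoints_bounded A : (forall T, A T -> bounded_op T) ->
  forall T, with_adjoints A T -> bounded_op T.
Proof. by move=> Ab T [/Ab//|[S /Ab Sb ST]]; exact: adjoint_bounded ST Sb. Qed.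

Lemma with_adjoints_star A : (forall T, A T -> bounded_op T) -> star_closed (with_adjoints A).
Proof.
move=> Ab S [AS|[T AT TS]]; last by exists T; [left | exact: adjoint_sym].
have [S' _ SS'] := adjoint_exists (Ab _ AS).
by exists S' => //; right; exists S.
Qed.

Lemma vN_generated_star_algebra A : (forall T, A T -> bounded_op T) ->
  star_algebra (vN_generated A).
Proof.
move=> Ab; apply: bicommutant_star_algebra; first exact: with_adjoints_star.
exact: with_adjoints_bounded.
Qed.

Lemma sub_vN_generated A S : A S -> bounded_op S -> vN_generated A S.
Proof. by move=> AS; apply: sub_bicommutant; left. Qed.

(** Brings [local_algebra], a bare bicommutant, under the results on [vN_generated]. *)
Lemma star_closed_vN_generated A : star_closed A -> bicommutant A = vN_generated A.
Proof.
move=> As; rewrite /vN_generated; congr bicommutant; apply/seteqP; split=> [T AT|T []//].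
  by left.
by move=> [S AS ST]; have [T' AT' ST'] := As _ AS; rewrite (adjoint_uniq ST ST').
Qed.

End Commutants.

(** * Square-summable families and direct sums *)

Section SquareSummable.
Variables (R : realType) (X : choiceType) (e : rel X) (H : hilbert R).
Implicit Types (z w : l2invH e H) (f : X -> H).

Lemma mkl2E f : (forall x y, e x y -> f x = f y) -> asum (fun x => hnorm2 (f x)) ->
  (mkl2 e f : X -> H) = f.
Proof. by move=> fe fs; rewrite /mkl2 val_insubd ifT//; apply/asboolP. Qed.

Lemma l2_ext z w : (forall x, z x = w x) -> z = w.
Proof. by move=> zw; apply/val_inj/funext. Qed.

Lemma l2D z w x : (z + w) x = z x + w x. Proof. by []. Qed.
Lemma l2Z a z x : (a *: z) x = a *: z x. Proof. by []. Qed.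
Lemma l2N z x : (- z) x = - z x. Proof. by []. Qed.
Lemma l2_0 x : (0 : l2invH e H) x = 0. Proof. by []. Qed.

Lemma l2_hdotE z w : hdot z w = csum (fun x => hdot (z x) (w x)).
Proof. by []. Qed.

Lemma l2_hnorm2E z : hnorm2 z = rsum (fun x => hnorm2 (z x)).
Proof. by []. Qed.

Lemma asum_hnorm2 z : asum (fun x => hnorm2 (z x)).
Proof. exact: l2inv_sum. Qed.

Lemma asum_redot z w : asum (fun x => redot (z x) (w x)).
Proof. by case: (l2dot_casum z w). Qed.

Lemma hnorm2_coord z x : hnorm2 (z x) <= hnorm2 z.
Proof. by rewrite (l2_hnorm2E z); apply: (rsum_ge x (asum_hnorm2 z)) => y; exact: hnorm2_ge0. Qed.

End SquareSummable.

Section DirectSum.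
Variables (R : realType) (X : choiceType) (H : hilbert R).
Implicit Types (z w : dsum X H) (f : X -> H) (x y : X) (h : H) (T : H -> H).

Lemma dsumE f : asum (fun x => hnorm2 (f x)) -> (mkl2 eq_op f : X -> H) = f.
Proof. by apply: mkl2E => x y /eqP ->. Qed.

Definition delta x h : dsum X H := mkl2 eq_op (fun y => if y == x then h else 0).

Lemma deltaE x h y : delta x h y = if y == x then h else 0.
Proof.
rewrite /delta dsumE//; apply: (@asum_supp1 _ _ x) => z /negPf ->.
by rewrite hnorm2_0.
Qed.

Lemma hdot_delta x h z : hdot (delta x h) z = hdot h (z x).
Proof.
have zero (y : X) : y != x -> hdot (delta x h y) (z y) = 0.
  by move=> /negPf yx; rewrite deltaE yx hdot0l.
rewrite l2_hdotE /csum !(@rsum_supp1 _ _ x); do ?[by move=> y /zero ->].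
by rewrite deltaE eqxx; case: (hdot _ _).
Qed.

Lemma redot_delta x h z : redot (delta x h) z = redot h (z x).
Proof. by rewrite /redot hdot_delta. Qed.

Lemma hnorm2_delta x h : hnorm2 (delta x h) = hnorm2 h.
Proof. by rewrite -redotxx redot_delta deltaE eqxx. Qed.

Lemma delta_lin x a h k : delta x (a *: h + k) = a *: delta x h + delta x k.
Proof.
apply: l2_ext => y; rewrite l2D l2Z !deltaE; case: ifP => // _.
by rewrite scaler0 addr0.
Qed.

Lemma total_delta (D : set H) : total D ->
  total [set z : dsum X H | exists x, exists2 d, D d & z = delta x d].
Proof.
move=> Dt z zD; apply: l2_ext => x; apply: Dt => d Dd.
by rewrite -redot_delta; apply: zD; exists x, d.
Qed.

Lemma total_setT : total [set: H].
Proof. by move=> z zP; apply: redot_eq0 => y; exact: zP. Qed.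

Definition diag (S : X -> H -> H) z : dsum X H := mkl2 eq_op (fun x => S x (z x)).

Definition uniformly_bounded (S : X -> H -> H) :=
  (forall x, linear (S x)) /\
  exists2 c : R, 0 < c & forall x h, hnorm2 (S x h) <= c ^+ 2 * hnorm2 h.

Lemma diagE S z x : uniformly_bounded S -> diag S z x = S x (z x).
Proof.
move=> [_ [c c0 cS]]; rewrite /diag dsumE//.
by apply: asum_le (asumZ (c ^+ 2) (asum_hnorm2 z)) => y; rewrite ger0_norm ?hnorm2_ge0.
Qed.

Lemma diag_bounded S : uniformly_bounded S -> bounded_op (diag S).
Proof.
move=> Sb; have [Sl [c c0 cS]] := Sb; apply/bounded_opP.
  by move=> a z w; apply: l2_ext => x; rewrite l2D l2Z !diagE// l2D l2Z Sl.
exists c => // z; rewrite !l2_hnorm2E -rsumZ; last exact: asum_hnorm2.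
apply: rsum_le; [exact: asum_hnorm2 | exact: asumZ (asum_hnorm2 z) |] => x.
by rewrite diagE.
Qed.

Lemma diag_adjoint S S' : uniformly_bounded S -> uniformly_bounded S' ->
  (forall x, adjoint (S x) (S' x)) -> adjoint (diag S) (diag S').
Proof.
move=> Sb Sb' SS' z w; rewrite !l2_hdotE; congr csum; apply/funext => x.
by rewrite !diagE// SS'.
Qed.

Lemma delta_diag S x h : uniformly_bounded S -> diag S (delta x h) = delta x (S x h).
Proof.
move=> Sb; apply: l2_ext => y; rewrite diagE// !deltaE; case: eqP => [->//|_].
by have := (Sb.1 y) (-1) 0 0; rewrite scaleN1r oppr0 addr0 scaleN1r addNr.
Qed.

Lemma const_uniformly_bounded T : bounded_op T -> uniformly_bounded (fun=> T).
Proof. by move=> Tb; split=> [_|]; [case: Tb | have [c] := bounded_op_pos Tb; exists c]. Qed.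

(** The amplification of T. Normal functionals are its matrix coefficients on [dsum nat H], and on
    the crossed space it lets W(xi) act in every summand. *)
Definition amp T := diag (fun=> T).

Lemma ampE T z x : bounded_op T -> amp T z x = T (z x).
Proof. by move=> Tb; rewrite /amp diagE//; exact: const_uniformly_bounded. Qed.

Lemma amp_bounded T : bounded_op T -> bounded_op (amp T).
Proof. by move=> Tb; apply/diag_bounded/const_uniformly_bounded. Qed.

Lemma amp_adjoint T T' : bounded_op T -> bounded_op T' -> adjoint T T' ->
  adjoint (amp T) (amp T').
Proof. by move=> Tb Tb' TT'; apply: diag_adjoint => //; exact: const_uniformly_bounded. Qed.

Lemma amp_delta T x h : bounded_op T -> amp T (delta x h) = delta x (T h).
Proof. by move=> Tb; apply: delta_diag; exact: const_uniformly_bounded. Qed.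

End DirectSum.

(** * Bicommutants and amplified operators *)

Section Density.
Variables (R : realType) (X : choiceType) (H : hilbert R).
Variables (B : set (H -> H)) (Bs : star_algebra B) (y : dsum X H).
Implicit Types (S T : H -> H) (z w : dsum X H).

Let K : set (dsum X H) := [set z | forall eps : R, 0 < eps ->
  exists2 S, B S & hnorm2 (z - amp S y) < eps].

Let K_lin a z w : K z -> K w -> K (a *: z + w).
Proof.
move=> Kz Kw eps e0.
have a0 : 0 <= complex.Re (a^* * a) by case: a => p q /=; rewrite mulNr opprK addr_ge0// -expr2 sqr_ge0.
set r := complex.Re (a^* * a) in a0.
have r1 : 0 < r + 1 by lra.
have e1 : 0 < eps / (4 * (r + 1)) by rewrite divr_gt0// mulr_gt0.
have e2 : 0 < eps / 4 by rewrite divr_gt0.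
have [S BS zS] := Kz _ e1; have [T BT wT] := Kw _ e2.
have Sb := sa_bounded Bs BS; have Tb := sa_bounded Bs BT.
exists (a *: S + T); first exact: (sa_lin Bs).
have -> : a *: z + w - amp (a *: S + T) y = a *: (z - amp S y) + (w - amp T y).
  rewrite (_ : amp (a *: S + T) y = a *: amp S y + amp T y).
    by rewrite scalerBr opprD addrACA.
  by apply: l2_ext => x; rewrite l2D l2Z !ampE//; exact: bounded_lin.
apply: le_lt_trans (hnorm2D_le _ _) _; rewrite hnorm2Z -/r.
have : r * hnorm2 (z - amp S y) <= eps / 4.
  apply: (@le_trans _ _ ((r + 1) * (eps / (4 * (r + 1))))).
    by apply: ler_pM => //; [exact: hnorm2_ge0 | lra | exact: ltW].
  by rewrite le_eqVlt; apply/orP; left; apply/eqP; field; rewrite (gt_eqF r1).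
move: wT; set p := hnorm2 (w - _); set q := r * _ => p4 q4; lra.
Qed.

Let K0 : K 0.
Proof.
move=> eps e0; exists (-1 *: id + id); first by apply: (sa_lin Bs); exact: (sa_id Bs).
rewrite (_ : amp _ y = 0) ?subr0 ?hnorm2_0//.
apply: l2_ext => x; rewrite ampE; last by apply: bounded_lin; exact: bounded_id.
by change (-1 *: y x + y x = 0); rewrite scaleN1r addNr.
Qed.

Let K_Z a z : K z -> K (a *: z).
Proof. by move=> Kz; rewrite -[_ *: _]addr0; exact: (K_lin a Kz K0). Qed.

Let K_subspace : real_subspace K.
Proof.
split; first exact: K0.
- by move=> z w Kz Kw; rewrite -[z]scale1r; exact: (K_lin 1 Kz Kw).
- by move=> r z; exact: K_Z.
Qed.

Let K_closed : hclosed K.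
Proof.
move=> z zP eps e0; have e4 : 0 < eps / 4 by rewrite divr_gt0.
have [w Kw zw] := zP _ e4; have [S BS wS] := Kw _ e4.
exists S => //; rewrite (_ : z - amp S y = (z - w) + (w - amp S y)); last first.
  by rewrite addrA subrK.
apply: le_lt_trans (hnorm2D_le _ _) _; lra.
Qed.

Let K_y : K y.
Proof.
move=> eps e0; exists id; first exact: (sa_id Bs).
rewrite (_ : amp id y = y) ?subrr ?hnorm2_0//.
by apply: l2_ext => x; rewrite ampE//; exact: bounded_id.
Qed.

Let K_amp S z : B S -> K z -> K (amp S z).
Proof.
move=> BS Kz eps e0; have Sb := sa_bounded Bs BS.
have [c c0 cS] := bounded_op_pos (@amp_bounded _ X _ _ Sb).
have e1 : 0 < eps / c ^+ 2 by rewrite divr_gt0// exprn_gt0.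
have [T BT zT] := Kz _ e1; have Tb := sa_bounded Bs BT.
exists (S \o T); first exact: (sa_comp Bs).
have -> : amp (S \o T) y = amp S (amp T y).
  by apply: l2_ext => x; rewrite !ampE//; exact: bounded_comp.
rewrite -(boundedB _ _ (@amp_bounded _ X _ _ Sb)).
apply: le_lt_trans (cS _) _; rewrite mulrC -ltr_pdivlMr ?exprn_gt0//.
Qed.

Let P_ex z : exists p, K p /\ forall k, K k -> redot k (z - p) = 0.
Proof. by have [p Kp pP] := projection z K_subspace K_closed; exists p. Qed.

Let P z := projT1 (cid (P_ex z)).

Let P_in z : K (P z). Proof. by rewrite /P; case: cid => p []. Qed.

Let P_orth z k : K k -> redot k (z - P z) = 0.
Proof. by rewrite /P; case: cid => p [_] /=; exact. Qed.

Let P_uniq z p : K p -> (forall k, K k -> redot k (z - p) = 0) -> P z = p.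
Proof.
move=> Kp pP; apply/eqP; rewrite -subr_eq0; apply/eqP/hnorm2_eq0.
have Kd : K (P z - p) := subspaceB K_subspace (P_in z) Kp.
have E : P z - p = (z - p) - (z - P z) by rewrite opprB [RHS]addrC addrA subrK.
by rewrite -redotxx {2}E redotBr (pP _ Kd) (P_orth _ Kd) subr0.
Qed.

Let redot_scale a z w : redot z (a *: w) = redot (conjc a *: z) w.
Proof.
rewrite /redot hdotZr hdotZl; congr (complex.Re (_ * _)).
by case: a => p q; congr (_ +i* _); rewrite /= opprK.
Qed.

Let P_bounded : bounded_op P.
Proof.
apply/bounded_opP => [a z w|].
  apply: P_uniq; first exact: (K_lin a (P_in z) (P_in w)).
  move=> k Kk; rewrite (_ : _ - _ = a *: (z - P z) + (w - P w)).
    by rewrite redotDr redot_scale (P_orth _ Kk) (P_orth _ (K_Z _ Kk)) addr0.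
  by rewrite scalerBr opprD addrACA.
exists 1 => // z; rewrite expr1n mul1r.
have : hnorm2 z = hnorm2 (P z + (z - P z)) by rewrite addrC subrK.
rewrite hnorm2D -/(redot _ _) (P_orth _ (P_in _)) mulr0 addr0 => ->.
by rewrite lerDl hnorm2_ge0.
Qed.

Let P_amp S z : B S -> P (amp S z) = amp S (P z).
Proof.
move=> BS; have Sb := sa_bounded Bs BS; have [S' BS' SS'] := sa_star Bs BS.
have Sb' := sa_bounded Bs BS'; apply: P_uniq => [|k Kk]; first exact: (K_amp BS (P_in z)).
rewrite -(boundedB _ _ (@amp_bounded _ X _ _ Sb)) /redot (amp_adjoint Sb Sb' SS').
exact: (P_orth _ (K_amp BS' Kk)).
Qed.

Let entry i j h : H := P (delta j h) i.

Let entry_commutant i j : commutant B (entry i j).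
Proof.
split.
  apply/bounded_opP.
    by move=> a h k; rewrite /entry delta_lin bounded_linear.
  exists 1 => // h; rewrite expr1n mul1r -(hnorm2_delta j h).
  apply: le_trans (hnorm2_coord _ _) _.
  have : hnorm2 (delta j h) = hnorm2 (P (delta j h) + (delta j h - P (delta j h))) by rewrite addrC subrK.
  rewrite hnorm2D -/(redot _ _) (P_orth _ (P_in _)) mulr0 addr0 => ->.
  by rewrite lerDl hnorm2_ge0.
move=> S BS; apply/funext => h; have Sb := sa_bounded Bs BS.
by rewrite /entry /= -amp_delta// P_amp// ampE.
Qed.

Let amp_P T : bicommutant B T -> amp T \o P = P \o amp T.
Proof.
move=> [Tb TB]; have aTb := @amp_bounded _ X _ _ Tb.
apply: (bounded_ext _ _ (@total_delta R X H _ (@total_setT _ H))); do ?exact: bounded_comp.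
move=> _ [j [h _ ->]] /=; rewrite amp_delta//; apply: l2_ext => i; rewrite ampE//.
by have := congr1 (@^~ h) (TB _ (entry_commutant i j)).
Qed.

(* The projection onto the closure of [B y] has its matrix entries in the
   commutant of B. *)
Lemma bicommutant_orthogonal (x : dsum X H) :
  (forall S, B S -> hdot x (amp S y) = 0) ->
  forall T, bicommutant B T -> hdot x (amp T y) = 0.
Proof.
move=> xB T TB.
(* P fixes y because id lies in B; as the amplification of T commutes with P, it keeps y inside the
   closed orbit. *)
have PTy : K (amp T y).
  have Py : P y = y by apply: (P_uniq K_y) => k _; rewrite subrr redot0r.
  by rewrite -{1}Py; have := congr1 (@^~ y) (amp_P TB) => /= ->; exact: P_in.
have orth (v : dsum X H) : (forall S, B S -> redot v (amp S y) = 0) -> redot v (amp T y) = 0.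
  move=> vB; have [v0|v0] := eqVneq (hnorm2 v) 0; first by rewrite (hnorm2_eq0 v0) redot0l.
  have nv : 0 < hnorm2 v by rewrite lt_neqAle eq_sym v0 hnorm2_ge0.
  apply/eqP; rewrite -sqrf_eq0 eq_le sqr_ge0 andbT.
  apply/ler_addgt0Pl => eps e0; rewrite addr0.
  have [S BS TS] := PTy (eps / hnorm2 v) ltac:(by rewrite divr_gt0).
  rewrite -[redot _ _]subr0 -(vB _ BS) -redotBr.
  apply: le_trans (Cauchy_Schwarz _ _) _; rewrite mulrC -ler_pdivlMr//; exact: ltW.
rewrite hdotE !orth// => S BS; first by rewrite redot_iZl xB.
by rewrite /redot xB.
Qed.

End Density.

(** * Normal morphisms *)

Section NormalMorphisms.
Variables (R : realType) (H : hilbert R).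
Implicit Types (S T : H -> H) (M G : set (H -> H)) (alpha : (H -> H) -> (H -> H)).

(** Keeps of an automorphism what the uniqueness argument uses, in a form that conjugations by
    unitaries of M and compositions satisfy directly. *)
Record normal_morphism M alpha : Prop := {
  nm_in : forall T, M T -> M (alpha T);
  nm_id : alpha id = id;
  nm_lin : forall a S T, M S -> M T -> alpha (a *: S + T) = a *: alpha S + alpha T;
  nm_comp : forall S T, M S -> M T -> alpha (S \o T) = alpha S \o alpha T;
  nm_star : forall S T, M S -> M T -> adjoint S T -> adjoint (alpha S) (alpha T);
  nm_normal : forall phi, sigma_weakly_continuous M phi ->
    sigma_weakly_continuous M (phi \o alpha) }.

Lemma automorphism_normal_morphism M alpha : star_algebra M ->
  vN_automorphism M alpha -> normal_morphism M alpha.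
Proof.
move=> Ms [[alphaM _ alphaS] alphal alpham alphas alphan]; split=> //.
(* Unitality comes from surjectivity: if alpha T = id, then id = alpha (id o T) = alpha id o id. *)
have [T MT T1] := alphaS id (sa_id Ms).
have : alpha T = alpha id \o alpha T := alpham _ _ (sa_id Ms) MT.
by rewrite T1 => {2}->.
Qed.

Lemma comp_normal_morphism M alpha beta :
  normal_morphism M alpha -> normal_morphism M beta -> normal_morphism M (alpha \o beta).
Proof.
move=> [a1 a2 a3 a4 a5 a6] [b1 b2 b3 b4 b5 b6]; split.
- by move=> T /b1 /a1.
- by rewrite /= b2 a2.
- by move=> a S T MS MT; rewrite /= b3// a3//; exact: b1.
- by move=> S T MS MT; rewrite /= b4// a4//; exact: b1.
- by move=> S T MS MT ST; exact: (a5 _ _ (b1 _ MS) (b1 _ MT) (b5 _ _ MS MT ST)).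
- by move=> phi /a6 /b6.
Qed.

Lemma matrix_coefficient_continuous M (xi eta : H) : (forall T, M T -> bounded_op T) ->
  sigma_weakly_continuous M (fun T => hdot xi (T eta)).
Proof.
move=> Mb; exists (delta 0%N xi), (delta 0%N eta) => T /Mb Tb.
have := hdot_delta 0%N xi (amp T (delta 0%N eta)).
rewrite ampE// deltaE eqxx => <-; rewrite l2_hdotE; congr csum; apply/funext => n.
by rewrite ampE.
Qed.

Lemma Ad_normal_morphism M (u v : H -> H) : star_algebra M -> M u -> M v ->
  unitary u -> adjoint u v -> normal_morphism M (fun T => u \o T \o v).
Proof.
move=> Ms Mu Mv uu uv; have [vu1 uv1] := unitary_adjointK uu uv.
have ub := sa_bounded Ms Mu; split.
- by move=> T MT; do 2?[apply: (sa_comp Ms) => //].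
- exact: uv1.
- move=> a S T MS MT; apply/funext => x /=.
  by change (u (a *: S (v x) + T (v x)) = a *: u (S (v x)) + u (T (v x))); rewrite bounded_linear.
- move=> S T MS MT; apply/funext => x /=; congr (u (S _)).
  by have := congr1 (@^~ (T (v x))) vu1 => /= ->.
- move=> S T MS MT ST x y /=; rewrite uv ST; exact: (adjoint_sym uv).
- move=> phi [x [y xy]]; exists (amp v x), (amp v y) => T MT /=.
  rewrite xy; last by do 2?[apply: (sa_comp Ms) => //].
  have vb := sa_bounded Ms Mv.
  by congr csum; apply/funext => n; rewrite /= !ampE// uv.
Qed.

Lemma csum_pair_bool (f : nat * bool -> R[i]) : casum f ->
  csum f = csum (fun n => f (n, true)) + csum (fun n => f (n, false)).
Proof.
move=> [fr fi]; rewrite /csum !rsum_prod// !big_bool /=.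
by congr (_ +i* _).
Qed.

(** The operators on which alpha and beta agree form a star-algebra B that contains the generators
    and their adjoints. The difference of corresponding matrix coefficients is a normal functional
    vanishing on B, hence on its bicommutant. *)
Lemma normal_morphism_unique G alpha beta : (forall T, G T -> bounded_op T) ->
  normal_morphism (vN_generated G) alpha -> normal_morphism (vN_generated G) beta ->
  (forall T, G T -> alpha T = beta T) -> forall T, vN_generated G T -> alpha T = beta T.
Proof.
move=> Gb am bm GE; set M := vN_generated G in am bm *.
have Ms : star_algebra M := vN_generated_star_algebra Gb.
pose B := [set T | M T /\ alpha T = beta T].
have Bs : star_algebra B.
  split.
  - by move=> S [MS _]; exact: (sa_bounded Ms MS).
  - by split; [exact: (sa_id Ms) | rewrite (nm_id am) (nm_id bm)].
  - move=> a S T [MS SE] [MT TE]; split; first exact: (sa_lin Ms).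
    by rewrite (nm_lin am)// (nm_lin bm)// SE TE.
  - move=> S T [MS SE] [MT TE]; split; first exact: (sa_comp Ms).
    by rewrite (nm_comp am)// (nm_comp bm)// SE TE.
  - move=> S [MS SE]; have [S' MS' SS'] := sa_star Ms MS; exists S' => //; split=> //.
    have := nm_star am MS MS' SS'; rewrite SE => /adjoint_uniq; apply.
    exact: (nm_star bm MS MS' SS').
have GB : with_adjoints G `<=` B.
  have GB T : G T -> B T by move=> GT; split; [exact: (sub_vN_generated GT (Gb _ GT)) | exact: GE].
  move=> T [/GB//|[S /GB BS ST]]; have [S' BS' SS'] := sa_star Bs BS.
  by rewrite (adjoint_uniq ST SS').
move=> T MT; have BT : bicommutant B T := bicommutant_mono GB MT.
apply/funext => eta; apply: hdot_inj => xi.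
have [x [y xy]] := nm_normal am (matrix_coefficient_continuous xi eta (sa_bounded Ms)).
have [x' [y' xy']] := nm_normal bm (matrix_coefficient_continuous xi eta (sa_bounded Ms)).
rewrite -[LHS]/((fun T => hdot xi (T eta)) (alpha T)) -[RHS]/((fun T => hdot xi (T eta)) (beta T)).
(* Indexing by [nat * bool] joins the vectors of the two normal functionals; with [- y'] in the
   second half, their difference is a single coefficient of an amplified operator. *)
have glue (a b : dsum nat H) : exists z : dsum (nat * bool)%type H,
    forall n, z (n, true) = a n /\ z (n, false) = b n.
  pose f (p : nat * bool) : H := if p.2 then a p.1 else b p.1.
  have fs : asum (fun p => hnorm2 (f p)).
    by apply: asum_prod => -[]; exact: asum_hnorm2.
  by exists (mkl2 eq_op f) => n; rewrite dsumE.
have [v vP] := glue x x'; have [w wP] := glue y (- y').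
have hvw S : M S -> hdot v (amp S w) = hdot xi (alpha S eta) - hdot xi (beta S eta).
  move=> MS; have Sb := sa_bounded Ms MS.
  rewrite l2_hdotE csum_pair_bool; last by case: (l2dot_casum v (amp S w)).
  rewrite (xy _ MS : hdot xi (alpha S eta) = _) (xy' _ MS : hdot xi (beta S eta) = _).
  congr (_ + _); first by congr csum; apply/funext => n; rewrite ampE// (vP n).1 (wP n).1.
  transitivity (hdot x' (- amp S y')); last by rewrite hdotNr l2_hdotE; congr (- csum _); apply/funext => n; rewrite ampE.
  rewrite l2_hdotE; congr csum; apply/funext => n; rewrite ampE// (vP n).2 (wP n).2.
  by rewrite !l2N boundedN// ampE.
apply/eqP; rewrite -subr_eq0 -(hvw _ MT); apply/eqP.
apply: (bicommutant_orthogonal Bs) => // S [MS SE].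
by rewrite hvw// SE subrr.
Qed.

(* The moments [<x, alpha ((S^* S)^(2^k)) x>] are bounded in k by normality, and
   they would grow without bound if [alpha S] did not contract x. *)
Lemma normal_morphism_contraction M alpha S : star_algebra M -> normal_morphism M alpha ->
  M S -> (forall x, hnorm2 (S x) <= hnorm2 x) -> forall x, hnorm2 (alpha S x) <= hnorm2 x.
Proof.
move=> Ms am MS S1 x; have [S' MS' SS'] := sa_star Ms MS.
have S'1 z : hnorm2 (S' z) <= hnorm2 z.
  have := @adjoint_bound _ _ S S' 1 SS' ltr01; rewrite expr1n.
  by move=> /(_ (fun z => ltac:(rewrite mul1r; exact: S1)) z); rewrite mul1r.
pose A k := iter k (fun T => T \o T) (S' \o S).
have MA k : M (A k) by elim: k => [|k IH] /=; exact: (sa_comp Ms).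
have A1 k z : hnorm2 (A k z) <= hnorm2 z.
  elim: k z => [|k IH] z /=; first exact: le_trans (S'1 _) (S1 _).
  exact: le_trans (IH _) (IH _).
have Aadj k : adjoint (A k) (A k).
  by elim: k => [|k IH] /=; [exact: adjoint_comp (adjoint_sym SS') SS' | exact: adjoint_comp].
pose m k := redot x (alpha (A k) x).
have m0 : m 0%N = hnorm2 (alpha S x).
  rewrite /m /= (nm_comp am)// /redot.
  by have /adjoint_sym -> := nm_star am MS MS' SS'.
have mS k : m k.+1 = hnorm2 (alpha (A k) x).
  rewrite /m /= (nm_comp am)// /redot.
  by have -> := nm_star am (MA k) (MA k) (Aadj k).
have m2 k : m k ^+ 2 <= hnorm2 x * m k.+1 by rewrite mS; exact: Cauchy_Schwarz.
(* By normality [m k] is a coefficient, between fixed vectors, of the amplification of the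
   contraction [A k]. *)
have [K mK] : exists K, forall k, m k <= K.
  have [y [z yz]] := nm_normal am (matrix_coefficient_continuous x x (sa_bounded Ms)).
  exists (hnorm2 y + hnorm2 z) => k; have Ab := sa_bounded Ms (MA k).
  have -> : m k = redot y (amp (A k) z).
    rewrite /m /redot (yz _ (MA k) : hdot x (alpha (A k) x) = _) l2_hdotE.
    by congr (complex.Re (csum _)); apply/funext => n; rewrite ampE.
  apply: le_trans (ler_norm _) _; apply: le_trans (hdotRe_le _ _) _.
  apply: lerD => //; rewrite !l2_hnorm2E; apply: rsum_le; do ?exact: asum_hnorm2.
  by move=> n; rewrite ampE.
rewrite -m0 leNgt; apply/negP => xm.
have N0 : 0 < hnorm2 x.
  rewrite lt_neqAle hnorm2_ge0 andbT; apply/negP => /eqP x0.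
  by move: xm; rewrite -x0 m0 (hnorm2_eq0 (esym x0)) bounded0 ?hnorm2_0 ?ltxx//; exact/(sa_bounded Ms)/(nm_in am).
move: (hnorm2 x) N0 xm m2 => N N0 xm m2.
(* The relative excess at the start. Cauchy-Schwarz at least squares [m k / N] at each step; the
   linear growth extracted from it already exceeds K. *)
pose d := m 0%N / N - 1; have d0 : 0 < d by rewrite subr_gt0 ltr_pdivlMr// mul1r.
have grow k : N * (1 + k.+1%:R * d) <= m k.
  elim: k => [|k IH]; first by rewrite /d mul1r addrC subrK mulrCA mulfV ?mulr1// gt_eqF.
  have kd : 0 <= k.+1%:R * d by rewrite mulr_ge0// ltW.
  rewrite -(ler_pM2l N0); apply: le_trans (m2 k).
  apply: (@le_trans _ _ ((N * (1 + k.+1%:R * d)) ^+ 2)); last first.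
    by rewrite ler_sqr// nnegrE; [|apply: le_trans IH]; apply: mulr_ge0; [exact: ltW | lra | exact: ltW | lra].
  rewrite exprMn expr2 -mulrA; apply: ler_wpM2l; first exact: ltW.
  apply: ler_wpM2l; first exact: ltW.
  have dk : d <= k.+1%:R * d by rewrite ler_peMl ?(ltW d0)// ler1n.
  rewrite -[k.+2]addn1 natrD mulrDl mul1r sqrrD expr1n; move: kd dk; move: (_ * d) => t; nra.
have := mK (Num.truncn (K / (N * d))); apply/negP; rewrite -ltNge.
apply: lt_le_trans (grow _); apply: (@lt_trans _ _ (N * d * (Num.truncn (K / (N * d))).+1%:R)).
  by rewrite mulrC -ltr_pdivrMr ?mulr_gt0// Num.Theory.truncnS_gt.
by rewrite -mulrA ltr_pM2l// mulrC ltrDr.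
Qed.

Lemma normal_morphism_bound M alpha S (c : R) : star_algebra M -> normal_morphism M alpha ->
  M S -> 0 < c -> (forall x, hnorm2 (S x) <= c ^+ 2 * hnorm2 x) ->
  forall x, hnorm2 (alpha S x) <= c ^+ 2 * hnorm2 x.
Proof.
move=> Ms am MS c0 cS x; have c20 : 0 < c ^+ 2 by exact: exprn_gt0.
(* The zero operator is spelled as a combination of id with itself, so that [nm_lin] applies to a
   pure multiple of S. *)
pose a := (c^-1)%:C; pose S1 := a *: S + ((-1 : R[i]) *: id + id).
have M0 : M (-1 *: id + id) := sa_lin Ms (-1) (sa_id Ms) (sa_id Ms).
have comb (T U : H -> H) z : (a *: T + ((-1 : R[i]) *: U + U)) z = a *: T z.
  by change (a *: T z + (-1 *: U z + U z) = a *: T z); rewrite scaleN1r addNr addr0.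
have := @normal_morphism_contraction M alpha S1 Ms am (sa_lin Ms a MS M0) _ x.
rewrite {2}/S1 (nm_lin am a MS M0) (nm_lin am (-1) (sa_id Ms) (sa_id Ms)).
rewrite comb hnorm2Zr exprVn mulrC ler_pdivrMr// mulrC; apply => z.
by rewrite /S1 comb hnorm2Zr exprVn mulrC ler_pdivrMr// mulrC.
Qed.

End NormalMorphisms.

(** * Exponential vectors are total in the Fock space *)

Section ExponentialVectors.
Variables (R : realType) (X : choiceType).
Implicit Types (s t w : seq X) (xi eta : l2 R X) (phi : fock R X).

Lemma uniq_sum_le (Y : eqType) (f : Y -> R) (s t : seq Y) : uniq s -> {subset s <= t} ->
  (forall y, 0 <= f y) -> \sum_(y <- s) f y <= \sum_(y <- t) f y.
Proof.
move=> us st f0; elim: s t us st => [|x s IH] t /=.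
  by move=> _ _; rewrite big_nil sumr_ge0.
move=> /andP[xs us] st; have xt : x \in t by apply: st; rewrite mem_head.
rewrite (perm_big _ (perm_to_rem xt)) !big_cons /= lerD2l; apply: IH => // y ys.
have := st y; rewrite in_cons ys orbT (perm_mem (perm_to_rem xt)) in_cons => /(_ isT).
by case/predU1P => // yx; rewrite -yx ys in xs.
Qed.

Fixpoint words s k : seq (seq X) :=
  if k is k'.+1 then [seq x :: w | x <- s, w <- words s k'] else [:: [::]].

Lemma mem_words s w : {subset w <= s} -> w \in words s (size w).
Proof.
elim: w => [|x w IH] ws //=; apply/allpairsP; exists (x, w); split=> //=.
  by apply: ws; rewrite mem_head.
by apply: IH => y yw; apply: ws; rewrite in_cons yw orbT.
Qed.

Lemma sum_words (a : X -> R) s k :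
  \sum_(w <- words s k) \prod_(x <- w) a x = (\sum_(x <- s) a x) ^+ k.
Proof.
elim: k => [|k IH] /=; first by rewrite big_seq1 big_nil.
rewrite big_allpairs_dep exprS -IH mulr_suml; apply: eq_bigr => x _.
by rewrite mulr_sumr; apply: eq_bigr => w _; rewrite big_cons.
Qed.

Lemma size_words s k w : w \in words s k -> size w = k.
Proof. by elim: k w => [|k IH] w /=; [rewrite inE => /eqP -> | case/allpairsP => -[x v] /= [_ /IH <- ->]]. Qed.

Lemma exp_partial_sum (q : R) n : 0 <= q -> \sum_(0 <= k < n) q ^+ k / k`!%:R <= expR q.
Proof.
move=> q0; have := @nondecreasing_cvgn_le R (series (exp_coeff q)) _ (is_cvg_series_exp_coeff q) n.
apply; apply/nondecreasing_seqP => k; rewrite /series /= big_nat_recr//= lerDl.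
by rewrite /exp_coeff /= divr_ge0// exprn_ge0.
Qed.

(** Finitely many words lie among the words of length below some N over a finite alphabet t, and the
    sum over those is a partial sum of the series of exp at the sum of a over t. *)
Lemma asum_exp (a : X -> R) : (forall x, 0 <= a x) -> asum a ->
  asum (fun s => \prod_(x <- s) a x / (size s)`!%:R).
Proof.
move=> a0 sa; have P0 s : 0 <= \prod_(x <- s) a x / (size s)`!%:R.
  by rewrite divr_ge0// prodr_ge0.
apply: (@asum_bounded _ _ _ (expR (rsum a))) => S uS.
under eq_bigr do rewrite ger0_norm//.
pose t := undup (flatten S); pose N := (\max_(w <- S) size w).+1.
apply: (@le_trans _ _ (\sum_(w <- flatten [seq words t k | k <- index_iota 0 N])
    \prod_(x <- w) a x / (size w)`!%:R)).
  apply: uniq_sum_le => // w wS; apply/flatten_mapP; exists (size w).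
    by rewrite mem_index_iota /= ltnS (leq_bigmax_seq _ wS).
  by apply: mem_words => x xw; rewrite mem_undup; apply/flattenP; exists w.
rewrite big_flatten big_map.
apply: (@le_trans _ _ (\sum_(0 <= k < N) (\sum_(x <- t) a x) ^+ k / k`!%:R)).
  rewrite le_eqVlt; apply/orP; left; apply/eqP; apply: eq_bigr => k _.
  by rewrite -sum_words mulr_suml big_seq [RHS]big_seq; apply: eq_bigr => w /size_words ->.
have q0 : 0 <= \sum_(x <- t) a x by rewrite sumr_ge0.
apply: le_trans (exp_partial_sum _ q0) _; rewrite ler_expR.
by apply: partial_sum_le_rsum => //; exact: undup_uniq.
Qed.

Definition cnorm2 (z : complexH R) : R := hnorm2 z.

Lemma cnorm2E (z : R[i]) : cnorm2 z = complex.Re z ^+ 2 + complex.Im z ^+ 2.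
Proof. by case: z => a b; rewrite /cnorm2 /hnorm2 /=; ring. Qed.

Lemma cnorm2M (z w : R[i]) : cnorm2 (z * w) = cnorm2 z * cnorm2 w.
Proof. by rewrite !cnorm2E; case: z w => a b [c d] /=; ring. Qed.

Lemma cnorm2_prod s (f : X -> R[i]) : cnorm2 (\prod_(x <- s) f x) = \prod_(x <- s) cnorm2 (f x).
Proof.
elim: s => [|x s IH]; last by rewrite !big_cons cnorm2M IH.
by rewrite !big_nil cnorm2E /=; ring.
Qed.

Lemma cnorm2_real (r : R) : cnorm2 r%:C = r ^+ 2.
Proof. by rewrite cnorm2E /= expr0n addr0. Qed.

Lemma expvecE xi s : expvec xi s = (\prod_(x <- s) (xi x : R[i])) / (Num.sqrt (size s)`!%:R)%:C.
Proof.
rewrite /expvec mkl2E//.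
  by move=> w t wt; rewrite (perm_big _ wt) (perm_size wt).
have := asum_exp (fun x => hnorm2_ge0 (xi x)) (asum_hnorm2 xi).
congr asum; apply/funext => w; rewrite -/(cnorm2 _) cnorm2M cnorm2_prod; congr (_ * _).
by rewrite -fmorphV cnorm2_real exprVn sqr_sqrtr.
Qed.

End ExponentialVectors.

(** * Polarization of products over words *)

Section Polarization.
Variables (R : realType) (X : choiceType) (s0 : seq X).
Let k := size s0.
Let x0 (i : 'I_k) : X := tnth (in_tuple s0) i.

Definition polar_vec (eps : {ffun 'I_k -> bool}) (x : X) : R :=
  \sum_i (eps i)%:R * (x == x0 i)%:R.
Definition polar_sgn (eps : {ffun 'I_k -> bool}) : R := \prod_i (if eps i then 1 else -1).

(* The polarization formula for the coefficient of the product of all the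
   [eps i] in the degree-k part of [prod_(x <- s) polar_vec eps x]. *)
Definition polar (s : seq X) : R :=
  \sum_eps polar_sgn eps * \prod_(x <- s) polar_vec eps x.

(** Expand over maps f from the positions of s to those of s0. The signed sum over eps factors over
    i, with factor 1 if f hits i and 1 - 1 = 0 otherwise, so only bijections survive. *)
Let polarE (s : k.-tuple X) :
  polar s = \sum_(f : {ffun 'I_k -> 'I_k})
    (\prod_(j < k) (tnth s j == x0 (f j))%:R) * \prod_i (i \in codom f)%:R.
Proof.
have vE eps : \prod_(x <- s) polar_vec eps x = \sum_(f : {ffun 'I_k -> 'I_k})
    \prod_(j < k) ((eps (f j))%:R * (tnth s j == x0 (f j))%:R).
  rewrite -(bigA_distr_bigA (fun j i => (eps i)%:R * (tnth s j == x0 i)%:R)).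
  by rewrite big_tuple.
rewrite /polar; under eq_bigr do rewrite vE mulr_sumr.
rewrite exchange_big /=; apply: eq_bigr => f _.
under eq_bigr do rewrite big_split /= [X in _ * X]mulrC mulrCA.
rewrite -mulr_sumr; congr (_ * _).
rewrite (eq_bigr (fun eps : {ffun 'I_k -> bool} =>
  \prod_i ((if eps i then 1 else -1) * (if i \in codom f then (eps i)%:R else 1)))); last first.
  move=> eps _; rewrite big_split /=; congr (_ * _).
  have [h|/existsNP[j /negP ej]] := pselect (forall j, eps (f j)).
    rewrite big1 ?big1// => [i _|j _]; last by rewrite h.
    by case: ifP => // /codomP[j ->]; rewrite h.
  rewrite (bigD1 j)//= (negPf ej) mul0r; apply/esym.
  by rewrite (bigD1 (f j))//= codom_f (negPf ej) mul0r.
rewrite -(bigA_distr_bigA (fun i b => (if b then 1 else -1) * (if i \in codom f then b%:R else 1))).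
apply: eq_bigr => i _; rewrite big_bool /=; case: ifP => _; rewrite ?mulr1 ?mulr0 ?addr0//.
by rewrite subrr.
Qed.

Lemma polar_ge0 s : size s = k -> 0 <= polar s.
Proof.
move=> sk; have := polarE (Tuple (introT eqP sk)) => /= ->; apply: sumr_ge0 => f _.
by rewrite mulr_ge0//; apply: prodr_ge0 => i _; rewrite ler0n.
Qed.

Lemma polar_perm s : size s = k -> polar s != 0 -> perm_eq s s0.
Proof.
move=> sk; have := polarE (Tuple (introT eqP sk)) => /= ->; set t := Tuple _.
move=> /eqP p0.
have [f] : exists f : {ffun 'I_k -> 'I_k},
    (\prod_(j < k) (tnth t j == x0 (f j))%:R) * \prod_i (i \in codom f)%:R != 0 :> R.
  apply: contrapT => h; apply: p0; apply: big1 => f _; apply/eqP.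
  by apply: contrapT => /negP hf; apply: h; exists f.
rewrite mulf_eq0 negb_or => /andP[/prodf_neq0 hs /prodf_neq0 hc].
have fsurj i : i \in codom f by have := hc i isT; case: (i \in codom f) => //; rewrite eqxx.
have -> : s = map x0 (codom f).
  rewrite -[LHS]/(tval t) -[LHS]map_tnth_enum /codom /image_mem -map_comp; apply: eq_map => j /=.
  by have := hs j isT; case: (tnth t j =P x0 (f j)) => // _; rewrite eqxx.
have -> : s0 = map x0 (enum 'I_k) by rewrite map_tnth_enum.
apply/perm_map/uniq_perm; last by move=> i; rewrite fsurj mem_enum.
  apply: (leq_size_uniq (enum_uniq 'I_k)) => [i _|]; first exact: fsurj.
  by rewrite size_codom size_enum_ord card_ord.
exact: enum_uniq.
Qed.

Lemma polar_self : 1 <= polar s0.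
Proof.
have := polarE (in_tuple s0) => /= ->; rewrite (bigD1 [ffun i => i])//= -[leLHS]addr0 lerD//; last first.
  by apply: sumr_ge0 => f _; apply: mulr_ge0; apply: prodr_ge0 => i _; exact: ler0n.
rewrite !big1 ?mulr1// => i _; last by rewrite ffunE eqxx.
have -> // : i \in codom [ffun i : 'I_k => i].
by apply/codomP; exists i; rewrite ffunE.
Qed.

End Polarization.

Section Totality.
Variables (R : realType) (X : choiceType).
Implicit Types (s : seq X) (phi : fock R X).

Lemma l2_sum_delta (I : finType) (b : I -> R) (y : I -> X) :
  exists z : l2 R X, forall x, z x = (\sum_i b i * (x == y i)%:R)%:C.
Proof.
exists (\sum_i (b i)%:C *: (delta (y i) (1 : complexH R) : l2 R X)) => x.
rewrite (big_morph (fun z : l2 R X => z x) (fun z w => erefl _) (erefl _)).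
rewrite rmorph_sum; apply: eq_bigr => i _.
by rewrite l2Z deltaE rmorphM; congr (_ * _); case: ifP; rewrite ?rmorph1 ?rmorph0.
Qed.

Lemma redot_complexM (a w : R[i]) (c : R) :
  redot (a * c%:C : complexH R) w = c * redot (a : complexH R) w.
Proof. by rewrite mulrC -redotZl. Qed.

(** Induction on the length k of a word s0. Combining the exponential vectors of r * [polar_vec]
    with the polarization signs isolates, as r tends to 0, the degree-k words that are permutations
    of s0. A Fock vector is constant on these, so its coordinate at s0 vanishes. *)
Lemma exponential_total :
  total [set z : fock R X | exists a xi, z = a *: expvec xi].
Proof.
move=> phi hphi; apply: l2_ext => s0; rewrite l2_0; apply: redot_eq0 => a.
pose h s := redot (a : complexH R) (phi s : complexH R).
have [n] := ubnP (size s0); elim: n s0 => // n IH s0; rewrite ltnS => s0n.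
have hlow s : (size s < size s0)%N -> h s = 0.
  by move=> /leq_trans /(_ s0n); exact: IH.
set k := size s0 in hlow.
pose q s : R := Num.sqrt (size s)`!%:R.
have q0 s : q s != 0 by rewrite gt_eqF// sqrtr_gt0 ltr0n fact_gt0.
(* Orthogonality of phi to the exponential vector of r * [polar_vec eps], scaled by a, written as a
   sum over words. *)
have test (r : R) (eps : {ffun 'I_k -> bool}) :
    let f := fun s => r ^+ size s * (\prod_(x <- s) polar_vec R eps x) / q s * h s in
    asum f /\ rsum f = 0.
  have [z zE] := l2_sum_delta (fun i : 'I_k => r * (eps i)%:R) (tnth (in_tuple s0)).
  have zE' x : z x = (r * polar_vec R eps x)%:C.
    by rewrite zE; congr _%:C; rewrite mulr_sumr; apply: eq_bigr => i _; rewrite mulrA.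
  have -> : (fun s => r ^+ size s * (\prod_(x <- s) polar_vec R eps x) / q s * h s) =
      (fun s => redot ((a *: expvec z) s) (phi s)).
    apply/funext => s; rewrite l2Z expvecE.
    have -> : \prod_(x <- s) (z x : R[i]) / (Num.sqrt (size s)`!%:R)%:C =
        (r ^+ size s * (\prod_(x <- s) polar_vec R eps x) / q s)%:C.
      rewrite rmorphM fmorphV; congr (_ / _); under eq_bigr do rewrite zE'.
      by rewrite -rmorph_prod big_split /= big_const_seq count_predT iter_mulr_1.
    by rewrite -[RHS]/(redot (a * _ : complexH R) _) redot_complexM.
  by split; [exact: asum_redot | apply: hphi; exists a, z].
pose c s := polar R s0 s / q s * h s.
have cE r : (fun s => r ^+ size s * c s) = (fun s => \sum_(eps : {ffun 'I_k -> bool})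
    polar_sgn R eps * (r ^+ size s * (\prod_(x <- s) polar_vec R eps x) / q s * h s)).
  apply/funext => s; rewrite /c /polar !mulr_suml mulr_sumr.
  by apply: eq_bigr => eps _; ring.
have [sc rc] : (forall r, asum (fun s => r ^+ size s * c s)) /\
    (forall r, rsum (fun s => r ^+ size s * c s) = 0).
  split=> r; rewrite cE; first by apply: asum_sum => eps; apply: asumZ; exact: (test r eps).1.
  rewrite rsum_sum; last by move=> eps; apply: asumZ; exact: (test r eps).1.
  by apply: big1 => eps _; rewrite rsumZ; [rewrite (test r eps).2 mulr0 | exact: (test r eps).1].
have {}sc : asum c by have := sc 1; congr asum; apply/funext => s; rewrite expr1n mul1r.
pose ck s := if size s == k then c s else 0.
have sck : asum ck.
  by apply: asum_le (asum_norm sc) => s; rewrite /ck; case: ifP; rewrite ?normr0.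
have clow s : (size s < k)%N -> c s = 0 by move=> /hlow h0; rewrite /c h0 mulr0.
have ck0 : rsum ck = 0.
  pose C := rsum (fun s => `|c s|); have C0 : 0 <= C by apply: rsum_ge0.
  (* The full sum vanishes and words shorter than k contribute nothing; after division by r^k, the
     words longer than k carry at least one factor r. *)
  have small r : 0 < r -> r <= 1 -> `|rsum ck| <= r * C.
    move=> r0 r1; have rk : 0 < r ^+ k by exact: exprn_gt0.
    rewrite -(ler_pM2l rk) -{1}(gtr0_norm rk) -normrM -rsumZ//.
    have sr : asum (fun s => r ^+ size s * c s).
      apply: asum_le (asum_norm sc) => s; rewrite normrM ler_piMl// normrX gtr0_norm//.
      exact: exprn_ile1 (ltW r0) r1.
    rewrite -[rsum _]subr0 -(rc r) -rsumB//; last exact: asumZ.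
    apply: le_trans (rsum_norm _) _; first by apply: asumB => //; exact: asumZ.
    rewrite mulrA -exprSr -(rsumZ _ (asum_norm sc)).
    apply: rsum_le; first by apply/asum_norm/asumB => //; exact: asumZ.
      exact/asumZ/asum_norm.
    move=> s; rewrite /ck; case: ltngtP => sk.
    - by rewrite clow// !mulr0 subrr normr0 mulr0.
    - rewrite mulr0 sub0r normrN normrM ler_wpM2r// normrX gtr0_norm//.
      by rewrite ler_wiXn2l// ltW.
    - by rewrite sk subrr normr0 mulr_ge0// exprn_ge0// ltW.
  apply/eqP; rewrite -normr_eq0 eq_le normr_ge0 andbT; apply/ler_addgt0Pl => e e0.
  have C1 : 0 < C + e by rewrite ltr_wpDl.
  rewrite addr0; apply: le_trans (small (e / (C + e)) _ _) _.
  - exact: divr_gt0.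
  - by rewrite ler_pdivrMr// mul1r lerDr.
  - by rewrite mulrAC ler_pdivrMr// ler_pM2l// lerDl ltW.
have [//|hs0] := eqVneq (h s0) 0.
(* On permutations of s0 both h and q are constant, so [ck] is a multiple of the nonnegative family
   d, whose sum is at least 1. *)
pose d s : R := if size s == k then polar R s0 s else 0.
have ckE : ck = fun s => (h s0 / q s0) * d s.
  apply/funext => s; rewrite /ck /d; case: eqP => [sk|_]; last by rewrite mulr0.
  have [p0|p0] := eqVneq (polar R s0 s) 0; first by rewrite /c p0 !mul0r mulr0.
  have ps := polar_perm sk p0.
  have -> : h s0 = h s by rewrite /h (l2inv_inv phi ps).
  by rewrite /c /q (perm_size ps); ring.
have u0 : h s0 / q s0 != 0 by rewrite mulf_neq0// invr_eq0.
have sd : asum d.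
  have := asumZ (h s0 / q s0)^-1 sck; rewrite ckE; congr asum.
  by apply/funext => s; rewrite mulKf.
have d1 : 1 <= rsum d.
  apply: le_trans (rsum_ge s0 sd _); first by rewrite /d eqxx polar_self.
  by move=> s; rewrite /d; case: eqP => // /polar_ge0.
move: ck0; rewrite ckE rsumZ// => /eqP; rewrite mulf_eq0 (negPf u0) /= => /eqP d0.
by move: d1; rewrite d0 ler10.
Qed.

End Totality.

(** * Weyl operators *)

Section Expi.
Variable R : realType.
Implicit Types x y : R.

Lemma expi0 : expi (0 : R) = 1.
Proof. by rewrite /expi cos0 sin0. Qed.

Lemma expiD x y : expi (x + y) = expi x * expi y.
Proof. by rewrite /expi cosD sinD; congr (_ +i* _); ring. Qed.

Lemma expi_pi : expi (pi : R) = -1.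
Proof. by rewrite /expi cospi sinpi; congr (_ +i* _); rewrite oppr0. Qed.

Lemma conjc_expi x : conjc (expi x) = expi (- x).
Proof. by rewrite /expi cosN sinN. Qed.

End Expi.

Section WeylOperators.
Variables (R : realType) (X : choiceType) (W : l2 R X -> fock R X -> fock R X).
Hypothesis Ww : weyl W.
Implicit Types (xi eta zeta : l2 R X) (x y : fock R X).

Let vacuum : fock R X := expvec 0.

Lemma omegaE xi eta : omega xi eta = redot ('i *: xi) eta.
Proof. by rewrite redot_iZl. Qed.

Lemma omegaE' xi eta : omega xi eta = - redot ('i *: eta) xi.
Proof. by rewrite redotC redot_iZr opprK. Qed.

Lemma omegaDr xi eta zeta : omega xi (eta + zeta) = omega xi eta + omega xi zeta.
Proof. by rewrite !omegaE redotDr. Qed.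

Lemma omegaNl xi eta : omega (- xi) eta = - omega xi eta.
Proof. by rewrite !omegaE scalerN redotNl. Qed.

Lemma omegaC xi eta : omega eta xi = - omega xi eta.
Proof. by rewrite omegaE' omegaE. Qed.

Lemma omegaxx xi : omega xi xi = 0.
Proof. by have := omegaC xi xi; lra. Qed.

Lemma weylM xi eta x : W xi (W eta x) = expi (- omega xi eta) *: W (xi + eta) x.
Proof. by have := congr1 (@^~ x) (weyl_mul Ww xi eta). Qed.

Lemma weyl_bounded xi : bounded_op (W xi).
Proof. exact/unitary_bounded/weyl_unitary. Qed.

Lemma weyl_isometry xi x : hnorm2 (W xi x) = hnorm2 x.
Proof. exact/unitary_isometry/weyl_unitary. Qed.

Lemma weyl0 x : W 0 x = x.
Proof.
apply/eqP; rewrite -subr_eq0; apply/eqP/hnorm2_eq0; rewrite -(weyl_isometry 0).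
have Wb := weyl_bounded 0.
by rewrite (boundedB _ _ Wb) weylM omegaxx oppr0 expi0 scale1r addr0 subrr hnorm2_0.
Qed.

Lemma weylK xi x : W (- xi) (W xi x) = x.
Proof. by rewrite weylM omegaNl omegaxx !oppr0 expi0 scale1r addNr weyl0. Qed.

Lemma weyl_adjoint xi : adjoint (W xi) (W (- xi)).
Proof.
move=> x y; have [_ isoW _] := weyl_unitary Ww (- xi).
by rewrite -isoW weylK.
Qed.

Lemma hdot_vacuum xi : hdot vacuum (expvec xi) = 1.
Proof.
have v0 s : s != [::] -> vacuum s = 0.
  case: s => // z s _; rewrite expvecE big_cons l2_0.
  by rewrite (mul0r (\prod_(j <- s) _)) mul0r.
have vE z : expvec z [::] = 1 :> R[i].
  by rewrite expvecE big_nil /= fact0 sqrtr1 rmorph1 divr1.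
have zero s : s != [::] -> hdot (vacuum s) (expvec xi s) = 0 by move=> /v0 ->; rewrite hdot0l.
rewrite l2_hdotE /csum !(@rsum_supp1 _ _ [::]); do ?[by move=> y /zero ->].
rewrite !vE; rewrite /hdot /= ; by congr (_ +i* _); ring.
Qed.

Lemma weyl_vacuumE xi : W xi vacuum = (expR (- hnorm2 xi / 2))%:C *: expvec xi.
Proof. exact: weyl_vacuum. Qed.

Lemma weyl_coefficient xi eta zeta :
  hdot (W eta vacuum) (W xi (W zeta vacuum)) =
  expi (omega eta (xi + zeta) - omega xi zeta) *
  (expR (- hnorm2 (xi + (zeta - eta)) / 2))%:C.
Proof.
rewrite -[in LHS](opprK eta) -weyl_adjoint (weylM xi zeta).
have Wb := weyl_bounded (- eta).
rewrite (boundedZ _ _ Wb) weylM omegaNl opprK scalerA -expiD weyl_vacuumE scalerA hdotZr hdot_vacuum mulr1.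
have -> : - eta + (xi + zeta) = xi + (zeta - eta) by rewrite addrC addrA.
by congr (expi _ * _); rewrite addrC.
Qed.

Lemma coherent_total : total [set z | exists a xi, z = a *: W xi vacuum].
Proof.
move=> z hz; apply: (@exponential_total R X) => _ [a [xi ->]].
apply: hz; exists (a * (expR (hnorm2 xi / 2))%:C), xi.
rewrite weyl_vacuumE scalerA -mulrA -rmorphM -expRD mulNr subrr expR0.
by rewrite rmorph1 mulr1.
Qed.

Section WeakLimit.
Variables (xi : nat -> l2 R X) (B : R).
Hypothesis xi_bounded : forall j, hnorm2 (xi j) <= B.
Hypothesis xi_weak : forall eta, (fun j => redot eta (xi j)) @ \oo --> (0 : R).

(** Cancels the vacuum expectation of W(xi_j), whose convergence is not known. *)
Let E j : R := expR (hnorm2 (xi j) / 2).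

(** After this normalisation the explicit coefficient depends on xi_j only through real pairings
    with fixed vectors, which tend to 0. *)
Let coherent_cvg a b eta zeta :
  (fun j => E j * redot (a *: W eta vacuum) (W (xi j) (b *: W zeta vacuum))) @ \oo -->
  redot (a *: W eta vacuum) (b *: W zeta vacuum).
Proof.
pose c := conjc a * b; pose d := zeta - eta.
pose r j := expR (- redot d (xi j) - hnorm2 d / 2).
pose t j := omega eta zeta + (redot ('i *: eta) (xi j) + redot ('i *: zeta) (xi j)).
have conv (v : l2 R X) : redot (a *: W eta vacuum) (W v (b *: W zeta vacuum)) =
    complex.Re (c * (expi (omega eta (v + zeta) - omega v zeta) *
      (expR (- hnorm2 (v + d) / 2))%:C)).
  have Wb := weyl_bounded v.
  rewrite (boundedZ _ _ Wb) /redot hdotZl hdotZr weyl_coefficient; congr complex.Re.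
  exact: mulrA.
have val (z : R[i]) (p q : R) : complex.Re (z * (expi p * q%:C)) =
    q * (complex.Re z * cos p - complex.Im z * sin p).
  by case: z => u v /=; ring.
have limE : redot (a *: W eta vacuum) (b *: W zeta vacuum) =
    expR (- hnorm2 d / 2) * (complex.Re c * cos (omega eta zeta) - complex.Im c * sin (omega eta zeta)).
  by rewrite -[b *: _]weyl0 conv !add0r (_ : omega 0 zeta = 0) ?subr0 ?val// omegaE scaler0 redot0l.
have seqE : (fun j => E j * redot (a *: W eta vacuum) (W (xi j) (b *: W zeta vacuum))) =
    (fun j => r j * (complex.Re c * cos (t j) - complex.Im c * sin (t j))).
  apply/funext => j; rewrite conv val.
  have -> : omega eta (xi j + zeta) - omega (xi j) zeta = t j.
    by rewrite omegaDr (omegaE' (xi j)) opprK omegaE /t; ring.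
  have -> : r j = E j * expR (- hnorm2 (xi j + d) / 2).
    by rewrite /r /E -expRD; congr expR; rewrite hnorm2D -/(redot _ _) (redotC d); field.
  by rewrite mulrA.
rewrite limE seqE.
have rcvg : r @ \oo --> expR (- hnorm2 d / 2).
  have : (fun j => - redot d (xi j) - hnorm2 d / 2) @ \oo --> - hnorm2 d / 2.
    have -> : - hnorm2 d / 2 = - 0 - hnorm2 d / 2 by rewrite oppr0 sub0r mulNr.
    by apply: cvgB; [apply: cvgN; exact: xi_weak | exact: cvg_cst].
  move=> h; exact: (cvg_comp _ _ h (@continuous_expR R _)).
have tcvg : t @ \oo --> omega eta zeta.
  have := cvgD (cvg_cst (omega eta zeta)) (cvgD (xi_weak ('i *: eta)) (xi_weak ('i *: zeta))).
  by rewrite !addr0; exact.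
apply: (cvgM rcvg); apply: cvgB; apply: cvgM (cvg_cst _) _.
  exact: (cvg_comp _ _ tcvg (@continuous_cos R _)).
exact: (cvg_comp _ _ tcvg (@continuous_sin R _)).
Qed.

Let coherent := [set z | exists a xi, z = a *: W xi vacuum].

(** Stated for any sequence with the norms of xi because it is applied to - xi as well. *)
Let bound (v : nat -> l2 R X) y : (forall j, hnorm2 (v j) = hnorm2 (xi j)) ->
  forall j, hnorm2 ((E j)%:C *: W (v j) y - y) <= 2 * (expR B * hnorm2 y + hnorm2 y).
Proof.
move=> vE j; apply: le_trans (hnorm2D_le _ _) _; apply: ler_wpM2l => //.
rewrite hnorm2N hnorm2Zr weyl_isometry; apply: lerD => //.
apply: ler_wpM2r; first exact: hnorm2_ge0.
rewrite /E -expRM_natl ler_expR; apply: le_trans (xi_bounded j).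
by rewrite mulrC divfK.
Qed.

Lemma weyl_weak_cvg x y :
  (fun j => E j * redot x (W (xi j) y)) @ \oo --> redot x y.
Proof.
have shift (z w : fock R X) : (fun j => redot z ((E j)%:C *: W (xi j) w - w)) @ \oo --> (0 : R) <->
    (fun j => E j * redot z (W (xi j) w)) @ \oo --> redot z w.
  have eqf : (fun j => redot z ((E j)%:C *: W (xi j) w - w)) =
      (fun j => E j * redot z (W (xi j) w) - redot z w).
    by apply/funext => j; rewrite redotBr redotZr.
  rewrite eqf; split=> h; last by have := cvgB h (cvg_cst (redot z w)); rewrite subrr; exact.
  have -> : (fun j => E j * redot z (W (xi j) w)) =
      (fun j => (E j * redot z (W (xi j) w) - redot z w) + redot z w).
    by apply/funext => j; rewrite subrK.
  by have := cvgD h (cvg_cst (redot z w)); rewrite add0r; exact.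
have step z w : coherent w -> (fun j => redot z ((E j)%:C *: W (xi j) w - w)) @ \oo --> (0 : R).
  move=> [b [zeta ->]]; apply: weak_cvg_total coherent_total _ z; first exact: bound.
  by move=> _ [a [eta ->]]; apply/shift; exact: coherent_cvg.
(* So far W(xi_j) acts on a coherent vector. Adjunction exchanges the two arguments and turns xi
   into - xi, and a second use of totality frees the other argument. *)
apply/shift; have swap j w : redot x ((E j)%:C *: W (xi j) w - w) =
    redot w ((E j)%:C *: W (- xi j) x - x).
  rewrite !redotBr !redotZr (redotC w x); congr (_ * _ - _).
  by rewrite /redot weyl_adjoint -/(redot _ _) redotC.
under eq_fun do rewrite swap.
apply: weak_cvg_total coherent_total _ y.
  by apply: bound => j; rewrite hnorm2N.
by move=> w cw; under eq_fun do rewrite -swap; exact: step.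
Qed.

End WeakLimit.

End WeylOperators.

(** * Fourier coefficients of smooth periodic functions *)

Section DerivativeFunctions.
Variable R : realType.
Implicit Types f g : R -> R.

Definition has_derivative f f' := forall x : R, is_derive x (1 : R) f (f' x).

Lemma has_derivative_ext f g f' g' : has_derivative f f' -> (forall x, f x = g x) ->
  (forall x, f' x = g' x) -> has_derivative g g'.
Proof. by move=> h /funext <- /funext <-. Qed.

Lemma has_derivative_cst (c : R) : has_derivative (fun=> c) (fun=> 0).
Proof. by move=> x; exact: is_derive_cst. Qed.

Lemma has_derivative_id : has_derivative id (fun=> 1).
Proof. by move=> x; exact: is_derive_id. Qed.

Lemma has_derivativeD f g f' g' : has_derivative f f' -> has_derivative g g' ->
  has_derivative (fun x => f x + g x) (fun x => f' x + g' x).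
Proof. by move=> hf hg x; exact: is_deriveD. Qed.

Lemma has_derivativeN f f' : has_derivative f f' ->
  has_derivative (fun x => - f x) (fun x => - f' x).
Proof. by move=> hf x; exact: is_deriveN. Qed.

Lemma has_derivativeM f g f' g' : has_derivative f f' -> has_derivative g g' ->
  has_derivative (fun x => f x * g x) (fun x => f' x * g x + f x * g' x).
Proof.
move=> hf hg x; apply: (@is_derive_eq _ _ _ _ _ _ _ _ (is_deriveM (hf x) (hg x))).
by rewrite /GRing.scale /= addrC mulrC.
Qed.

Lemma has_derivativeZ (c : R) f f' : has_derivative f f' ->
  has_derivative (fun x => c * f x) (fun x => c * f' x).
Proof.
move=> hf; apply: (has_derivative_ext (has_derivativeM (has_derivative_cst c) hf)) => // x.
by rewrite mul0r add0r.
Qed.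

Lemma has_derivative_comp f g f' g' : has_derivative f f' -> has_derivative g g' ->
  has_derivative (f \o g) (fun x => f' (g x) * g' x).
Proof. by move=> hf hg x; exact: is_derive1_comp. Qed.

Lemma has_derivative_continuous f f' : has_derivative f f' -> continuous f.
Proof.
by move=> hf x; apply/differentiable_continuous/derivable1_diffP; case: (hf x).
Qed.

Lemma has_derivative_derive1 f f' : has_derivative f f' -> f^`()%classic = f'.
Proof. by move=> hf; apply/funext => x; rewrite derive1E; case: (hf x). Qed.

Lemma has_derivative_sinZ (a : R) : has_derivative (fun x => sin (a * x)) (fun x => a * cos (a * x)).
Proof.
have := has_derivative_comp (fun x => is_derive_sin x) (has_derivativeZ a has_derivative_id).
move/has_derivative_ext; apply => // x; by rewrite mulr1 mulrC.
Qed.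

Lemma has_derivative_cosZ (a : R) : has_derivative (fun x => cos (a * x)) (fun x => - (a * sin (a * x))).
Proof.
have := has_derivative_comp (fun x => is_derive_cos x) (has_derivativeZ a has_derivative_id).
move/has_derivative_ext; apply => // x; by rewrite mulr1 mulNr mulrC.
Qed.

Lemma cont_cst (c : R) : continuous (fun _ : R => c).
Proof. by move=> x; exact: cvg_cst. Qed.

Lemma contD f g : continuous f -> continuous g -> continuous (fun x => f x + g x).
Proof. by move=> cf cg x; exact: (cvgD (cf x) (cg x)). Qed.

Lemma contN f : continuous f -> continuous (fun x => - f x).
Proof. by move=> cf x; exact: (cvgN (cf x)). Qed.

Lemma contB f g : continuous f -> continuous g -> continuous (fun x => f x - g x).
Proof. by move=> cf cg; apply: contD => //; exact: contN. Qed.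

Lemma contM f g : continuous f -> continuous g -> continuous (fun x => f x * g x).
Proof. by move=> cf cg x; exact: (cvgM (cf x) (cg x)). Qed.

Lemma contZ (c : R) f : continuous f -> continuous (fun x => c * f x).
Proof. by move=> cf; apply: contM => //; exact: cont_cst. Qed.

Lemma cont_sum (J : Type) (s : seq J) (F : J -> R -> R) :
  (forall j, continuous (F j)) -> continuous (fun x => \sum_(j <- s) F j x).
Proof.
move=> cF; elim: s => [|j s IH].
  by under eq_fun do rewrite big_nil; exact: cont_cst.
by under eq_fun do rewrite big_cons; exact: contD.
Qed.

Lemma cont_cosZ (a : R) : continuous (fun x => cos (a * x)).
Proof. exact: has_derivative_continuous (has_derivative_cosZ a). Qed.

Lemma cont_sinZ (a : R) : continuous (fun x => sin (a * x)).
Proof. exact: has_derivative_continuous (has_derivative_sinZ a). Qed.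

End DerivativeFunctions.

Section Mean.
Variable R : realType.
Implicit Types f g : R -> R.

Lemma twopi_gt0 : 0 < 2 * pi :> R.
Proof. by rewrite mulr_gt0 ?pi_gt0. Qed.

Let integrable f : continuous f ->
  (@lebesgue_measure R).-integrable `[0, 2 * pi] (EFin \o f).
Proof.
move=> cf; apply: continuous_compact_integrable; first exact: segment_compact.
exact: continuous_subspaceT.
Qed.

Lemma meanD f g : continuous f -> continuous g ->
  mean (fun x => f x + g x) = mean f + mean g.
Proof. by move=> cf cg; rewrite /mean RintegralD//; do ?exact: integrable; rewrite mulrDr. Qed.

Lemma meanZ (c : R) f : continuous f -> mean (fun x => c * f x) = c * mean f.
Proof. by move=> cf; rewrite /mean RintegralZl//; do ?exact: integrable; rewrite mulrCA. Qed.

Lemma meanN f : continuous f -> mean (fun x => - f x) = - mean f.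
Proof.
by move=> cf; under eq_fun do rewrite -mulN1r; rewrite meanZ// mulN1r.
Qed.

Lemma meanB f g : continuous f -> continuous g ->
  mean (fun x => f x - g x) = mean f - mean g.
Proof. by move=> cf cg; rewrite meanD ?meanN//; exact: contN. Qed.

Lemma mean_le f g : continuous f -> continuous g -> (forall x, f x <= g x) ->
  mean f <= mean g.
Proof.
move=> cf cg fg; rewrite /mean ler_wpM2l ?invr_ge0 ?(ltW twopi_gt0)//.
by apply: le_Rintegral => //; exact: integrable.
Qed.

Lemma mean_cst (c : R) : mean (fun=> c) = c.
Proof.
rewrite /mean Rintegral_cst//= lebesgue_measure_itv/= lte_fin twopi_gt0 /= subr0.
by rewrite mulrCA mulVf ?mulr1// gt_eqF// twopi_gt0.
Qed.

Lemma mean_ge0 f : continuous f -> (forall x, 0 <= f x) -> 0 <= mean f.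
Proof. by move=> cf f0; rewrite -(mean_cst 0); apply: mean_le => //; exact: cont_cst. Qed.

Lemma mean_norm_le f (c : R) : continuous f -> (forall x, `|f x| <= c) -> `|mean f| <= c.
Proof.
move=> cf fc; rewrite ler_norml -(mean_cst (- c)) -{2}(mean_cst c).
by apply/andP; split; apply: mean_le => //; do ?[exact: cont_cst];
  move=> x; have := fc x; rewrite ler_norml => /andP[].
Qed.

Lemma mean_sum (J : Type) (s : seq J) (F : J -> R -> R) :
  (forall j, continuous (F j)) -> mean (fun x => \sum_(j <- s) F j x) = \sum_(j <- s) mean (F j).
Proof.
move=> cF; elim: s => [|j s IH].
  by under eq_fun do rewrite big_nil; rewrite big_nil mean_cst.
under eq_fun do rewrite big_cons.
by rewrite big_cons meanD ?IH//; exact: cont_sum.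
Qed.

Lemma mean_derivative f f' : has_derivative f f' -> continuous f' -> f (2 * pi) = f 0 ->
  mean f' = 0.
Proof.
move=> hf cf' f2; have cf := has_derivative_continuous hf.
rewrite /mean /Rintegral (@continuous_FTC2 _ f' f _ _ twopi_gt0).
- by rewrite f2 -EFinB subrr mulr0.
- exact: continuous_subspaceT.
- split; first by move=> x _; case: (hf x).
    by apply: cvg_at_right_filter; exact: cf.
  by apply: cvg_at_left_filter; exact: cf.
- by move=> x _; rewrite (has_derivative_derive1 hf).
Qed.

Lemma periodic_mulrn f (k : nat) : periodic2pi f -> f (k%:R * (2 * pi)) = f 0.
Proof.
move=> fp; elim: k => [|k IH]; first by rewrite mul0r.
by rewrite -addn1 natrD mulrDl mul1r fp.
Qed.

Lemma cos_periodic2pi : periodic2pi (@cos R).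
Proof. by move=> x; rewrite mulr_natl cosD2pi. Qed.

Lemma sin_periodic2pi : periodic2pi (@sin R).
Proof. by move=> x; rewrite mulr_natl sinD2pi. Qed.

Lemma cos2kpi (k : nat) : cos (k%:R * (2 * pi)) = 1 :> R.
Proof. by rewrite periodic_mulrn ?cos0//; exact: cos_periodic2pi. Qed.

Lemma sin2kpi (k : nat) : sin (k%:R * (2 * pi)) = 0 :> R.
Proof. by rewrite periodic_mulrn ?sin0//; exact: sin_periodic2pi. Qed.

End Mean.

(** * Bessel inequality and the half-order Sobolev sum *)

Section Bessel.
Variable R : realType.
Implicit Types f g : R -> R.

Definition cos_coef f (k : nat) : R := mean (fun x => f x * cos (k%:R * x)).
Definition sin_coef f (k : nat) : R := mean (fun x => f x * sin (k%:R * x)).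

Lemma fourierE f k : fourier f k = cos_coef f k -i* sin_coef f k.
Proof. by []. Qed.

Let mean_cosZ (a : R) : a != 0 -> sin (a * (2 * pi)) = 0 -> mean (fun x => cos (a * x)) = 0.
Proof.
move=> a0 sa; have h := has_derivativeZ a^-1 (has_derivative_sinZ a).
have := mean_derivative h; rewrite sa !mulr0 sin0 mulr0.
rewrite (_ : (fun x => a^-1 * (a * cos (a * x))) = (fun x => cos (a * x))).
  by apply => //; exact: cont_cosZ.
by apply/funext => x; rewrite mulKf.
Qed.

Let mean_sinZ (a : R) : cos (a * (2 * pi)) = 1 -> mean (fun x => sin (a * x)) = 0.
Proof.
have [->|a0] := eqVneq a 0; first by under eq_fun do rewrite mul0r sin0; rewrite mean_cst.
move=> sa; have h := has_derivativeZ (- a^-1) (has_derivative_cosZ a).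
have := mean_derivative h; rewrite sa mulr0 cos0.
rewrite (_ : (fun x => - a^-1 * - (a * sin (a * x))) = (fun x => sin (a * x))).
  by apply => //; exact: cont_sinZ.
by apply/funext => x; rewrite mulrNN mulKf.
Qed.

Let cos2kl (k l : nat) : cos ((k%:R - l%:R) * (2 * pi)) = 1 :> R.
Proof. by rewrite mulrBl cosB !cos2kpi !sin2kpi mulr0 addr0 mulr1. Qed.

Let sin2kl (k l : nat) : sin ((k%:R - l%:R) * (2 * pi)) = 0 :> R.
Proof. by rewrite mulrBl sinB !cos2kpi !sin2kpi mulr0 mul0r subrr. Qed.

Let mean_cos_sub (k l : nat) : mean (fun x => cos ((k%:R - l%:R) * x)) = (k == l)%:R :> R.
Proof.
case: eqP => [->|kl].
  by under eq_fun do rewrite subrr mul0r cos0; rewrite mean_cst.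
by apply: mean_cosZ (sin2kl k l); rewrite subr_eq0 eqr_nat; apply/eqP.
Qed.

Let mean_cos_add (k l : nat) : mean (fun x => cos ((k.+1%:R + l.+1%:R) * x)) = 0 :> R.
Proof.
rewrite -natrD; apply: mean_cosZ; first by rewrite pnatr_eq0.
exact: sin2kpi.
Qed.

Let trig (p : nat * bool) (x : R) : R :=
  if p.2 then cos (p.1.+1%:R * x) else sin (p.1.+1%:R * x).

Let cont_trig p : continuous (trig p).
Proof. by case: p => k []; rewrite /trig /=; [exact: cont_cosZ | exact: cont_sinZ]. Qed.

Let trig_orth p q : mean (fun x => trig p x * trig q x) = (p == q)%:R / 2.
Proof.
case: p q => k a [l b]; rewrite xpair_eqE.
have half (u v : R -> R) : continuous u -> continuous v ->
    mean (fun x => 2^-1 * (u x + v x)) = 2^-1 * (mean u + mean v).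
  by move=> cu cv; rewrite meanZ ?meanD//; exact: contD.
case: a b => [] []; rewrite /trig /=.
- rewrite (_ : (fun x => _) = (fun x => 2^-1 * (cos ((k.+1%:R - l.+1%:R) * x) + cos ((k.+1%:R + l.+1%:R) * x)))).
    rewrite half; do ?exact: cont_cosZ.
    by rewrite mean_cos_sub mean_cos_add addr0 andbT mulrC eqSS.
  by apply/funext => x; rewrite mulrBl mulrDl cosB cosD; field.
- rewrite (_ : (fun x => _) = (fun x => 2^-1 * (sin ((k.+1%:R + l.+1%:R) * x) + sin ((l.+1%:R - k.+1%:R) * x)))).
    rewrite half; do ?exact: cont_sinZ.
    by rewrite -natrD !mean_sinZ ?cos2kl ?cos2kpi// addr0 mulr0 andbF mul0r.
  by apply/funext => x; rewrite mulrBl mulrDl sinB sinD; field.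
- rewrite (_ : (fun x => _) = (fun x => 2^-1 * (sin ((k.+1%:R + l.+1%:R) * x) + sin ((k.+1%:R - l.+1%:R) * x)))).
    rewrite half; do ?exact: cont_sinZ.
    by rewrite -natrD !mean_sinZ ?cos2kl ?cos2kpi// addr0 mulr0 andbF mul0r.
  by apply/funext => x; rewrite mulrBl mulrDl sinB sinD; field.
- rewrite (_ : (fun x => _) = (fun x => 2^-1 * (cos ((k.+1%:R - l.+1%:R) * x) + - cos ((k.+1%:R + l.+1%:R) * x)))).
    rewrite half; [|exact: cont_cosZ|apply: contN; exact: cont_cosZ].
    rewrite meanN; last exact: cont_cosZ.
    by rewrite mean_cos_sub mean_cos_add oppr0 addr0 andbT mulrC eqSS.
  by apply/funext => x; rewrite mulrBl mulrDl cosB cosD; field.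
Qed.

(** Positivity of the mean of (f - P)^2, where P is the projection of f to the span of the chosen
    functions; the factors 2 arise because each has mean square 1/2. *)
Let Bessel_trig f (s : seq (nat * bool)) : continuous f -> uniq s ->
  2 * (\sum_(p <- s) mean (fun x => f x * trig p x) ^+ 2) <= mean (fun x => f x ^+ 2).
Proof.
move=> cf us; pose c p := mean (fun x => f x * trig p x).
pose P x := \sum_(p <- s) (2 * c p) * trig p x.
have cP : continuous P by apply: cont_sum => p; apply: contZ; exact: cont_trig.
have fP : mean (fun x => f x * P x) = 2 * \sum_(p <- s) c p ^+ 2.
  have -> : (fun x => f x * P x) = (fun x => \sum_(p <- s) (2 * c p) * (f x * trig p x)).
    by apply/funext => x; rewrite mulr_sumr; apply: eq_bigr => p _; rewrite mulrCA.
  rewrite mean_sum; last by move=> p; apply/contZ/contM => //; exact: cont_trig.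
  rewrite mulr_sumr; apply: eq_bigr => p _; rewrite meanZ; last by apply: contM => //; exact: cont_trig.
  by rewrite expr2 mulrA.
have PP : mean (fun x => P x * P x) = 2 * \sum_(p <- s) c p ^+ 2.
  have -> : (fun x => P x * P x) =
      (fun x => \sum_(p <- s) \sum_(q <- s) (2 * c p * (2 * c q)) * (trig p x * trig q x)).
    apply/funext => x; rewrite {1}/P mulr_suml; apply: eq_bigr => p _.
    by rewrite mulr_sumr; apply: eq_bigr => q _; rewrite mulrACA.
  rewrite mean_sum; last first.
    by move=> p; apply: cont_sum => q; apply/contZ/contM; exact: cont_trig.
  rewrite mulr_sumr big_seq [RHS]big_seq; apply: eq_bigr => p ps.
  rewrite mean_sum; last by move=> q; apply/contZ/contM; exact: cont_trig.
  rewrite (bigD1_seq p)//= big1 => [|q qp].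
    rewrite addr0 meanZ; last by apply: contM; exact: cont_trig.
    by rewrite trig_orth eqxx mulr1n; field.
  rewrite meanZ; last by apply: contM; exact: cont_trig.
  by rewrite trig_orth eq_sym (negPf qp) mul0r mulr0.
have : 0 <= mean (fun x => (f x - P x) ^+ 2).
  by apply: mean_ge0 => [|x]; [exact: (contM (contB cf cP) (contB cf cP)) | exact: sqr_ge0].
have -> : (fun x => (f x - P x) ^+ 2) = (fun x => f x ^+ 2 - 2 * (f x * P x) + P x * P x).
  by apply/funext => x; ring.
have cf2 : continuous (fun x => f x ^+ 2) by exact: contM.
have cfP : continuous (fun x => 2 * (f x * P x)) by exact/contZ/contM.
rewrite meanD ?meanB ?meanZ ?fP ?PP//; do ?[exact: contM | exact: contB].
rewrite -/c; lra.
Qed.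

Lemma Bessel f N : continuous f ->
  2 * \sum_(0 <= k < N) (cos_coef f k.+1 ^+ 2 + sin_coef f k.+1 ^+ 2) <= mean (fun x => f x ^+ 2).
Proof.
move=> cf; apply: le_trans (@Bessel_trig f [seq (k, b) | k <- index_iota 0 N, b <- [:: true; false]] cf _).
  rewrite big_allpairs_dep /=; apply: ler_wpM2l => //; rewrite le_eqVlt; apply/orP; left; apply/eqP.
  by apply: eq_bigr => k _; rewrite big_cons big_seq1.
by apply: allpairs_uniq => //; [exact: iota_uniq | move=> [? ?] [? ?] _ _ []/= -> ->].
Qed.

Lemma cos_coef_derivative f f' k : has_derivative f f' -> continuous f' -> periodic2pi f ->
  cos_coef f' k = k%:R * sin_coef f k.
Proof.
move=> hf cf' fp; have cf := has_derivative_continuous hf.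
have := mean_derivative (has_derivativeM hf (has_derivative_cosZ k%:R)).
rewrite cos2kpi mulr0 cos0 -[in X in _ -> X -> _](add0r (2 * pi)) fp.
rewrite meanD; last 2 first.
- by apply: contM => //; exact: cont_cosZ.
- by apply: contM => //; apply/contN/contZ/cont_sinZ.
rewrite (_ : (fun x => f x * - (k%:R * sin (k%:R * x))) = (fun x => - k%:R * (f x * sin (k%:R * x)))); last first.
  by apply/funext => x; ring.
rewrite meanZ; last by apply: contM => //; exact: cont_sinZ.
move=> /(_ _ erefl) h; apply/eqP; rewrite -subr_eq0 -mulNr; apply/eqP/h.
apply: contD; first by apply: contM => //; exact: cont_cosZ.
by apply: contM => //; apply/contN/contZ/cont_sinZ.
Qed.

Lemma sin_coef_derivative f f' k : has_derivative f f' -> continuous f' -> periodic2pi f ->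
  sin_coef f' k = - (k%:R * cos_coef f k).
Proof.
move=> hf cf' fp; have cf := has_derivative_continuous hf.
have := mean_derivative (has_derivativeM hf (has_derivative_sinZ k%:R)).
rewrite sin2kpi !mulr0 sin0 mulr0.
rewrite meanD; last 2 first.
- by apply: contM => //; exact: cont_sinZ.
- by apply: contM => //; apply/contZ/cont_cosZ.
rewrite (_ : (fun x => f x * (k%:R * cos (k%:R * x))) = (fun x => k%:R * (f x * cos (k%:R * x)))); last first.
  by apply/funext => x; ring.
rewrite meanZ; last by apply: contM => //; exact: cont_cosZ.
move=> /(_ _ erefl) h; apply/eqP; rewrite -subr_eq0 opprK; apply/eqP/h.
apply: contD; first by apply: contM => //; exact: cont_sinZ.
by apply: contM => //; apply/contZ/cont_cosZ.
Qed.

(* AM-GM interpolates the Sobolev norm of order 1/2 between the L2 norms of f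
   and f'. *)
Lemma half_Sobolev f f' N (r : R) : 0 < r -> has_derivative f f' -> continuous f' -> periodic2pi f ->
  \sum_(0 <= k < N) k.+1%:R * (cos_coef f k.+1 ^+ 2 + sin_coef f k.+1 ^+ 2) <=
  4^-1 * (r * mean (fun x => f x ^+ 2) + r^-1 * mean (fun x => f' x ^+ 2)).
Proof.
move=> r0 hf cf' fp; have cf := has_derivative_continuous hf.
have h1 := Bessel N cf; have h2 := Bessel N cf'.
apply: (@le_trans _ _ (4^-1 * (r * (2 * \sum_(0 <= k < N) (cos_coef f k.+1 ^+ 2 + sin_coef f k.+1 ^+ 2)) +
  r^-1 * (2 * \sum_(0 <= k < N) (cos_coef f' k.+1 ^+ 2 + sin_coef f' k.+1 ^+ 2))))); last first.
  apply: ler_wpM2l; first by rewrite invr_ge0.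
  by apply: lerD; apply: ler_wpM2l => //; rewrite ?invr_ge0 ltW.
rewrite !mulr_sumr -big_split mulr_sumr; apply: ler_sum => k _ /=.
rewrite (cos_coef_derivative k.+1 hf)// (sin_coef_derivative k.+1 hf)//.
move: (cos_coef f _) (sin_coef f _) (k.+1%:R) => a b m; rewrite -subr_ge0.
have -> : 4^-1 * (r * (2 * (a ^+ 2 + b ^+ 2)) + r^-1 * (2 * ((m * b) ^+ 2 + (- (m * a)) ^+ 2))) -
  m * (a ^+ 2 + b ^+ 2) = 2^-1 * r^-1 * ((r - m) ^+ 2 * (a ^+ 2 + b ^+ 2)).
  by field; rewrite gt_eqF.
by apply: mulr_ge0; [rewrite mulr_ge0 ?invr_ge0 ?(ltW r0) | rewrite mulr_ge0 ?addr_ge0 ?sqr_ge0].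
Qed.

End Bessel.

(** * Vanishing of the symplectic form on separated supports *)

Section Locality.
Variable R : realType.
Implicit Types f g : R -> R.

(** The Dirichlet kernel. Its product with 1 - cos x is a difference of cosines, which avoids half
    angles and division at multiples of 2 pi. *)
Let D (n : nat) (x : R) : R := 1 + 2 * \sum_(0 <= k < n) cos (k.+1%:R * x).

Let D_closed n x : (1 - cos x) * D n x = cos (n%:R * x) - cos (n.+1%:R * x).
Proof.
elim: n => [|n IH]; first by rewrite /D big_geq// mul0r mul1r cos0; ring.
have -> : D n.+1 x = D n x + 2 * cos (n.+1%:R * x).
  by rewrite /D big_nat_recr//= mulrDr addrA.
rewrite mulrDr IH; have E (m : nat) : m.+1%:R * x = m%:R * x + x.
  by rewrite -addn1 natrD mulrDl mul1r.
rewrite (E n.+1) cosD.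
have -> : cos (n%:R * x) = cos (n.+1%:R * x) * cos x + sin (n.+1%:R * x) * sin x.
  by rewrite -cosB E addrK.
ring.
Qed.

(** The sum telescopes to the Fejer kernel without its factor 1/N: away from the diagonal it is
    bounded uniformly in N, so Cesaro means are O(1/N). *)
Let Fejer_bound N x : `|(1 - cos x) * \sum_(0 <= n < N) D n x| <= 2.
Proof.
have -> : (1 - cos x) * \sum_(0 <= n < N) D n x = 1 - cos (N%:R * x).
  rewrite mulr_sumr; under eq_bigr do rewrite D_closed.
  rewrite (@telescope_sumr_eq _ _ _ (fun k => - cos (k%:R * x)))//.
    by rewrite mul0r cos0 opprK addrC.
  by move=> k _; rewrite opprK addrC.
by have := cos_max (N%:R * x); rewrite !ler_norml; lra.
Qed.

Definition symplectic_coef f g (k : nat) : R :=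
  k.+1%:R * (cos_coef f k.+1 * sin_coef g k.+1 - sin_coef f k.+1 * cos_coef g k.+1).

(* Cesaro means of the sum are integrals against the Fejer kernel, which decays
   off the diagonal. *)
Lemma separated_symplectic_sum f g g' (F G d : R) : continuous f -> has_derivative g g' ->
  continuous g' -> periodic2pi g -> 0 < d ->
  (forall x, `|f x| <= F) -> (forall x, `|g' x| <= G) ->
  (forall x y, f x != 0 -> g' y != 0 -> d <= 1 - cos (x - y)) ->
  asum (symplectic_coef f g) -> rsum (symplectic_coef f g) = 0.
Proof.
move=> cf hg cg' gp d0 fF gG sep sa; set a := symplectic_coef f g in sa *.
(* Passing to the derivative absorbs the weight k + 1: the symplectic sum becomes the Fourier form
   of the pairing of f with g', whose supports are separated. *)
pose c k := cos_coef g' k.+1; pose s k := sin_coef g' k.+1.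
have aE k : a k = cos_coef f k.+1 * c k + sin_coef f k.+1 * s k.
  by rewrite /c /s (cos_coef_derivative k.+1 hg)// (sin_coef_derivative k.+1 hg)// /a /symplectic_coef; ring.
have ccos k : continuous (fun x : R => cos (k%:R * x)) by exact: cont_cosZ.
have csin k : continuous (fun x : R => sin (k%:R * x)) by exact: cont_sinZ.
have g'0 : mean g' = 0 by apply: (mean_derivative hg) => //; rewrite -[2 * pi]add0r gp.
pose J n x := \sum_(0 <= k < n) (c k * cos (k.+1%:R * x) + s k * sin (k.+1%:R * x)).
have cJ n : continuous (J n).
  by apply: cont_sum => k; apply: contD; apply: contZ.
have SJ n : \sum_(0 <= k < n) a k = mean (fun x => f x * J n x).
  have -> : (fun x => f x * J n x) = (fun x => \sum_(0 <= k < n)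
      (c k * (f x * cos (k.+1%:R * x)) + s k * (f x * sin (k.+1%:R * x)))).
    by apply/funext => x; rewrite mulr_sumr; apply: eq_bigr => k _; ring.
  rewrite mean_sum; last by move=> k; apply: contD; apply: contZ; exact: contM.
  apply: eq_bigr => k _; rewrite meanD; [|by apply/contZ/contM..].
  by rewrite !meanZ; [rewrite aE mulrC [X in _ + X]mulrC | exact: contM..].
(* Partial Fourier sums of g' are convolutions with D; the constant term drops because g' has mean
   0. *)
have JD n x : 2 * J n x = mean (fun y => g' y * D n (x - y)).
  have -> : (fun y => g' y * D n (x - y)) = (fun y => g' y + \sum_(0 <= k < n)
      ((2 * cos (k.+1%:R * x)) * (g' y * cos (k.+1%:R * y)) +
       (2 * sin (k.+1%:R * x)) * (g' y * sin (k.+1%:R * y)))).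
    apply/funext => y; rewrite /D mulrDr mulr1 mulrCA !mulr_sumr; congr (_ + _).
    by apply: eq_bigr => k _; rewrite mulrBr cosB; ring.
  rewrite meanD; [|done|by apply: cont_sum => k; apply: contD; apply/contZ/contM].
  rewrite g'0 add0r mean_sum; last by move=> k; apply: contD; apply/contZ/contM.
  rewrite mulr_sumr; apply: eq_bigr => k _; rewrite meanD; [|by apply/contZ/contM..].
  by rewrite !meanZ; [rewrite /c /s /cos_coef /sin_coef; ring | exact: contM..].
have cD n x : continuous (fun y => D n (x - y)).
  apply: contD; first exact: cont_cst.
  apply/contZ/cont_sum => k.
  have -> : (fun y => cos (k.+1%:R * (x - y))) =
    (fun y => cos (k.+1%:R * x) * cos (k.+1%:R * y) + sin (k.+1%:R * x) * sin (k.+1%:R * y)).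
    by apply/funext => y; rewrite mulrBr cosB.
  by apply: contD; apply: contZ.
have F0 : 0 <= F := le_trans (normr_ge0 _) (fF 0).
have G0 : 0 <= G := le_trans (normr_ge0 _) (gG 0).
have GD0 : 0 <= G * (2 / d) by apply: mulr_ge0 => //; apply: divr_ge0 => //; exact: ltW.
pose C := F * (G * (2 / d)) / 2.
have C0 : 0 <= C by apply: divr_ge0 => //; exact: mulr_ge0.
(* Only pairs x, y with f x and g' y nonzero count, and there the summed kernel is at most 2 / d. *)
have bound N : `|\sum_(0 <= n < N) \sum_(0 <= k < n) a k| <= C.
  under eq_bigr do rewrite SJ.
  rewrite -mean_sum; last by move=> n; exact: contM.
  apply: mean_norm_le; first by apply: cont_sum => n; exact: contM.
  move=> x; rewrite -mulr_sumr normrM.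
  have [->|fx] := eqVneq (f x) 0.
    by rewrite normr0 mul0r.
  rewrite /C -mulrA; apply: ler_pM => //.
  have -> : \sum_(0 <= n < N) J n x = 2^-1 * mean (fun y => \sum_(0 <= n < N) g' y * D n (x - y)).
    rewrite mean_sum; last by move=> n; exact: contM.
    by rewrite mulr_sumr; apply: eq_bigr => n _; rewrite -JD mulKf.
  rewrite normrM ger0_norm ?invr_ge0// mulrC ler_pM2r ?invr_gt0//.
  apply: mean_norm_le; first by apply: cont_sum => n; exact: contM.
  move=> y; rewrite -mulr_sumr normrM.
  have [->|gy] := eqVneq (g' y) 0.
    by rewrite normr0 mul0r.
  apply: ler_pM => //; have dxy := sep _ _ fx gy; have := Fejer_bound N (x - y).
  have dxy0 : 0 < 1 - cos (x - y) by apply: lt_le_trans dxy.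
  rewrite normrM gtr0_norm// => h; rewrite ler_pdivlMr// mulrC.
  by apply: le_trans h; apply: ler_wpM2r.
(* The Cesaro means share the limit [rsum a] of the partial sums, yet are bounded by C / (n + 1). *)
have cv := cesaro (cvg_rsum sa).
rewrite -(cvg_lim (@norm_hausdorff _ _) cv); apply: cvg_lim; first exact: norm_hausdorff.
apply/cvgrPdist_le => eps e0.
have e1 : 0 < eps / (C + 1) by rewrite divr_gt0// ltr_wpDl.
have [N _ NP] := near_infty_natSinv_lt (PosNum e1).
exists N => // n /NP /= h; rewrite sub0r normrN /arithmetic_mean /series /= normrM ger0_norm ?invr_ge0//.
apply: (@le_trans _ _ (n.+1%:R^-1 * (C + 1))).
  by apply: ler_wpM2l; [rewrite invr_ge0 | apply: le_trans (bound _) _; lra].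
by rewrite -ler_pdivlMr ?ltW// ltr_wpDl.
Qed.

End Locality.

(** * Smooth cutoffs *)

Section SmoothFunctions.
Variable R : realType.
Implicit Types f g : R -> R.

(** A form of k-fold differentiability for which sums, products and compositions are handled by
    induction on k. *)
Fixpoint differentiable_times (k : nat) f : Prop :=
  if k is k'.+1 then exists2 f', has_derivative f f' & differentiable_times k' f' else True.

Lemma smoothP f : (forall k, differentiable_times k f) <-> smooth f.
Proof.
split=> [h k x|sf k].
  suff : forall k f, differentiable_times k.+1 f -> derivable (derive1n k f) x 1 by apply.
  move=> {h f k}; elim=> [|k IH] f [f' ff' h]; first by case: (ff' x).
  by rewrite derive1Sn (has_derivative_derive1 ff'); exact: IH.
elim: k f sf => [|k IH] f sf //; exists (f^`())%classic; last first.
  by apply: IH => j x; have := sf j.+1 x; rewrite derive1Sn.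
by move=> x; rewrite derive1E; apply: derivableP; exact: (sf 0%N).
Qed.

Lemma smooth_derivative f : smooth f -> exists2 f', has_derivative f f' & smooth f'.
Proof.
move=> sf; exists (f^`())%classic; last by move=> k x; have := sf k.+1 x; rewrite derive1Sn.
by move=> x; rewrite derive1E; apply: derivableP; exact: (sf 0%N).
Qed.

Lemma smooth_continuous f : smooth f -> continuous f.
Proof. by move=> /smooth_derivative[f' /has_derivative_continuous]. Qed.

Lemma differentiable_timesS k f : differentiable_times k.+1 f -> differentiable_times k f.
Proof. by elim: k f => [|k IH] f //= [f' ff' h]; exists f' => //; exact: IH. Qed.

Lemma differentiable_timesD k f g : differentiable_times k f -> differentiable_times k g ->
  differentiable_times k (fun x => f x + g x).
Proof.
elim: k f g => [|k IH] f g //= [f' ff' hf] [g' gg' hg].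
by exists (fun x => f' x + g' x); [exact: has_derivativeD | exact: IH].
Qed.

Lemma differentiable_timesM k f g : differentiable_times k f -> differentiable_times k g ->
  differentiable_times k (fun x => f x * g x).
Proof.
elim: k f g => [|k IH] f g //= [f' ff' hf] [g' gg' hg].
exists (fun x => f' x * g x + f x * g' x); first exact: has_derivativeM.
by apply: differentiable_timesD; apply: IH => //; apply: differentiable_timesS; [exists g' | exists f'].
Qed.

Lemma differentiable_times_comp k f g : differentiable_times k f -> differentiable_times k g ->
  differentiable_times k (f \o g).
Proof.
elim: k f g => [|k IH] f g //= [f' ff' hf] [g' gg' hg].
exists (fun x => f' (g x) * g' x); first exact: has_derivative_comp.
by apply: differentiable_timesM => //; apply: (IH f') => //; apply: differentiable_timesS; exists g'.
Qed.

Lemma smooth_cst (c : R) : smooth (fun=> c).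
Proof.
apply/smoothP => k; elim: k c => [|k IH] c //=; exists (fun=> 0); last exact: IH.
exact: has_derivative_cst.
Qed.

Lemma smooth_id : smooth (@id R).
Proof.
apply/smoothP => -[|k] //=; exists (fun=> 1); first exact: has_derivative_id.
exact: (proj2 (smoothP _) (@smooth_cst 1) k).
Qed.

Lemma smoothD f g : smooth f -> smooth g -> smooth (fun x => f x + g x).
Proof. by move=> /smoothP sf /smoothP sg; apply/smoothP => k; exact: differentiable_timesD. Qed.

Lemma smoothM f g : smooth f -> smooth g -> smooth (fun x => f x * g x).
Proof. by move=> /smoothP sf /smoothP sg; apply/smoothP => k; exact: differentiable_timesM. Qed.

Lemma smooth_comp f g : smooth f -> smooth g -> smooth (f \o g).
Proof. by move=> /smoothP sf /smoothP sg; apply/smoothP => k; exact: differentiable_times_comp. Qed.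

Lemma smoothZ (c : R) f : smooth f -> smooth (fun x => c * f x).
Proof. by apply: smoothM; exact: smooth_cst. Qed.

Lemma smooth_cos : smooth (@cos R).
Proof.
apply/smoothP => k; suff [] : differentiable_times k (@cos R) /\ differentiable_times k (@sin R) by [].
elim: k => [|k [IHc IHs]] //=; split.
  exists (fun x => - sin x); first by move=> x; exact: is_derive_cos.
  rewrite (_ : (fun x => - sin x) = (fun x => -1 * sin x)); last by apply/funext => x; rewrite mulN1r.
  by apply: (@differentiable_timesM k (fun=> -1)) => //; exact: (proj2 (smoothP _) (@smooth_cst _) k).
by exists (@cos R) => // x; exact: is_derive_sin.
Qed.

(** The powers of 1/x make the linear span of the family closed under differentiation, so all
    members are shown smooth at once. *)
Definition flat (n : nat) (x : R) : R := if 0 < x then x ^- n * expR (- x^-1) else 0.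

Lemma flat_ge0 n x : 0 <= flat n x.
Proof. by rewrite /flat; case: ifP => // x0; rewrite mulr_ge0 ?expR_ge0 ?invr_ge0 ?exprn_ge0 ?ltW. Qed.

Lemma flat_neg n x : x <= 0 -> flat n x = 0.
Proof. by move=> x0; rewrite /flat ltNge x0. Qed.

(** Follows from exp y >= y^(n+1) / (n+1)! at y = 1/x. *)
Lemma flat_le n m x : 0 < x -> flat (n + m) x <= (n.+1)`!%:R * x ^- m * x.
Proof.
move=> x0; rewrite /flat x0 exprD invfM.
have y0 : 0 < x^-1 by rewrite invr_gt0.
have h : x^-1 ^+ n.+1 * expR (- x^-1) <= (n.+1)`!%:R.
  rewrite expRN -ler_pdivlMr ?invr_gt0 ?expR_gt0// invrK mulrC.
  have := expR_ge1Dxn n (ltW y0); rewrite -ler_pdivrMr ?ltr0n ?fact_gt0//; lra.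
have -> : x ^- n / x ^+ m * expR (- x^-1) = x^-1 ^+ n.+1 * expR (- x^-1) * (x ^- m * x).
  rewrite exprS exprVn; field; by rewrite ?gt_eqF// exprn_gt0.
rewrite -[leRHS]mulrA; apply: ler_wpM2r => //.
by rewrite mulr_ge0 ?invr_ge0 ?exprn_ge0 ?ltW.
Qed.

Lemma has_derivative_flat n :
  has_derivative (flat n) (fun x => flat n.+2 x - n%:R * flat n.+1 x).
Proof.
move=> x; have [x0|x0|->] := ltgtP x 0.
- rewrite (flat_neg n.+1 (ltW x0)) (flat_neg n.+2 (ltW x0)) mulr0 subr0.
  apply: (@near_eq_is_derive _ _ _ (fun=> 0)) => //.
  near=> y; rewrite flat_neg// ltW//.
  by near: y; exact: lt_nbhsl.
- apply: (@near_eq_is_derive _ _ _ (fun y : R => y ^- n * expR (- y^-1))) => //.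
    near=> y; rewrite /flat ifT//.
    by near: y; exact: lt_nbhsr.
  have xn0 : x != 0 by rewrite gt_eqF.
  have hV : is_derive x (1 : R) (fun y : R => y^-1) (- x ^- 2).
    apply: DeriveDef; first exact: (@derivableV _ _ id).
    by rewrite (@deriveV _ _ id)// derive_id /GRing.scale /= mulr1.
  have hE : is_derive x (1 : R) (fun y : R => expR (- y^-1)) (expR (- x^-1) * x ^- 2).
    rewrite -[x ^- 2]opprK.
    exact: (@is_derive1_comp _ expR (fun y : R => - y^-1) x _ _ (is_derive_expR _) (is_deriveN hV)).
  have hX : is_derive x (1 : R) (fun y : R => y^-1 ^+ n) (- (n%:R * x^-1 ^+ n.+1)).
    rewrite (_ : (fun y : R => y^-1 ^+ n) = (fun y : R => y^-1) ^+ n); last first.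
      by apply/funext => y; rewrite exprfctE.
    apply: (is_derive_eq (@is_deriveX _ _ _ n x 1 _ hV)).
    case: (n) => [|m]; first by rewrite !mul0r scale0r oppr0.
    by rewrite /GRing.scale /= mulrN -mulrA -exprVn -exprD addn2.
  rewrite (_ : (fun y : R => y ^- n * expR (- y^-1)) =
    (fun y : R => y^-1 ^+ n) * (fun y : R => expR (- y^-1))); last first.
    by apply/funext => y; rewrite fctE exprVn.
  apply: (is_derive_eq (is_deriveM hX hE)).
  by rewrite /flat x0 /GRing.scale /= -!exprVn !exprS; ring.
- rewrite (flat_neg n.+1 (lexx 0)) (flat_neg n.+2 (lexx 0)) mulr0 subrr.
  (* At 0 the difference quotient of [flat n] is [flat n.+1], which tends to 0 by [flat_le]. *)
  apply/is_derive1_caratheodory; exists (flat n.+1); split.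
  + move=> z; rewrite /flat ltxx !subr0; case: ifP => // [z0|]; last by rewrite mul0r.
    by rewrite [RHS]mulrAC exprSr invfM divfK// gt_eqF.
  + apply/cvgrPdist_le => eps e0.
    have f0 : (0 : R) < (n.+2)`!%:R by rewrite ltr0n fact_gt0.
    near=> z; rewrite (flat_neg _ (lexx 0)) sub0r normrN ger0_norm ?flat_ge0//.
    have [z0|z0] := ltP 0 z; last by rewrite flat_neg// ltW.
    have := @flat_le n.+1 0 z z0; rewrite addn0 expr0 invr1 mulr1 => h; apply: le_trans h _.
    rewrite mulrC -ler_pdivlMr// ltW//; near: z.
    by apply: lt_nbhsl; rewrite divr_gt0.
  + by rewrite /flat ltxx.
Unshelve. all: by end_near. Qed.

End SmoothFunctions.

Section Ramp.
Variable R : realType.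
Implicit Types x y : R.

(** Vanishes up to 1 and reaches the value 1 only in the limit at infinity; 1 - ramp decays like
    1/x, which is square-integrable. *)
Definition ramp x : R := flat 0 (x - 1).
Definition ramp' x : R := flat 2 (x - 1).

Lemma smooth_flat n : smooth (@flat R n).
Proof.
apply/smoothP => k; suff : forall n, differentiable_times k (@flat R n) by apply.
elim: k => [|k IH] {}n //=.
exists (fun x => flat n.+2 x - n%:R * flat n.+1 x); first exact: has_derivative_flat.
rewrite (_ : (fun x => flat n.+2 x - n%:R * flat n.+1 x) =
  (fun x => flat n.+2 x + (- n%:R) * flat n.+1 x)); last by apply/funext => x; rewrite mulNr.
apply: differentiable_timesD; first exact: IH.
apply: differentiable_timesM; last exact: IH.
exact: (proj2 (smoothP _) (@smooth_cst R _) k).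
Qed.

Lemma has_derivative_ramp : has_derivative ramp ramp'.
Proof.
have h := has_derivative_comp (has_derivative_flat 0)
  (has_derivativeD (@has_derivative_id R) (has_derivative_cst (-1))).
by apply: (has_derivative_ext h) => x //; rewrite /ramp' mul0r subr0 addr0 mulr1.
Qed.

Lemma smooth_ramp : smooth ramp.
Proof.
apply: (@smooth_comp R (flat 0) (fun x => x + (-1))); first exact: smooth_flat.
by apply: smoothD; [exact: smooth_id | exact: smooth_cst].
Qed.

Lemma ramp_out x : x <= 1 -> ramp x = 0.
Proof. by move=> x1; rewrite /ramp flat_neg// subr_le0. Qed.

Lemma ramp'_out x : x <= 1 -> ramp' x = 0.
Proof. by move=> x1; rewrite /ramp' flat_neg// subr_le0. Qed.

Lemma ramp_ge0 x : 0 <= ramp x. Proof. exact: flat_ge0. Qed.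
Lemma ramp'_ge0 x : 0 <= ramp' x. Proof. exact: flat_ge0. Qed.

Let flat0E y : 0 < y -> flat 0 y = expR (- y^-1).
Proof. by move=> y0; rewrite /flat y0 expr0 invr1 mul1r. Qed.

Lemma ramp_le1 x : ramp x <= 1.
Proof.
have [x1|x1] := leP x 1; first by rewrite ramp_out.
have y0 : 0 < x - 1 by rewrite subr_gt0.
by rewrite /ramp flat0E// -[leRHS]expR0 ler_expR oppr_le0 invr_ge0 ltW.
Qed.

Lemma one_sub_ramp_le x : 1 < x -> 1 - ramp x <= (x - 1)^-1.
Proof.
move=> x1; have y0 : 0 < x - 1 by rewrite subr_gt0.
rewrite /ramp flat0E//; have := expR_ge1Dx (- (x - 1)^-1); lra.
Qed.

Lemma ramp'_le2 x : ramp' x <= 2.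
Proof.
have [x1|x1] := leP x 1; first by rewrite ramp'_out.
have y0 : 0 < x - 1 by rewrite subr_gt0.
have := @flat_le R 1 1 (x - 1) y0; rewrite /ramp' expr1 -mulrA mulVf ?gt_eqF// mulr1.
by rewrite (_ : 2`! = 2%N).
Qed.

Lemma ramp'_le_sqr x : 1 < x -> ramp' x <= (x - 1) ^- 2.
Proof.
move=> x1; have y0 : 0 < x - 1 by rewrite subr_gt0.
rewrite /ramp' /flat y0; apply: ler_piMr; first by rewrite invr_ge0 sqr_ge0.
by rewrite -[leRHS]expR0 ler_expR oppr_le0 invr_ge0 ltW.
Qed.

(** The profile of the dip at an end point: at x = l * arc, the inner and outer cutoffs add up to 1
    - gap. *)
Definition gap x : R := 1 - ramp x - ramp (- x).
Definition gap' x : R := ramp' (- x) - ramp' x.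

Lemma gapN x : gap (- x) = gap x.
Proof. by rewrite /gap opprK addrAC. Qed.

Lemma gap'N x : gap' (- x) = - gap' x.
Proof. by rewrite /gap' opprK opprB. Qed.

Lemma has_derivative_gap : has_derivative gap gap'.
Proof.
have hN := has_derivative_comp has_derivative_ramp (has_derivativeN (@has_derivative_id R)).
have h := has_derivativeD (has_derivativeD (has_derivative_cst 1) (has_derivativeN has_derivative_ramp)) (has_derivativeN hN).
by apply: (has_derivative_ext h) => x //; rewrite /gap' add0r mulrN1 opprK addrC.
Qed.

(** Uses 1 + x^2 <= 5 below 2 and 1 + x^2 <= 2 x^2 above. The constant 20 in the two bounds on [gap]
    and [gap'] is 5 times the square of the bound 2 on [ramp']. *)
Let even_bound (F : R -> R) (c : R) : 0 <= c -> (forall x, F (- x) = F x) ->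
  (forall x, 0 <= x -> x < 2 -> 5 * F x <= c) ->
  (forall x, 2 <= x -> 2 * (F x * x ^+ 2) <= c) ->
  (forall x, 0 <= F x) -> forall x, F x <= c / (1 + x ^+ 2).
Proof.
move=> c0 FN F2 Fx F0 x.
wlog x0 : x / 0 <= x => [hw|].
  by have [/hw//|/ltW x0] := leP 0 x; have := hw (- x); rewrite FN sqrrN; apply; lra.
have p0 : 0 < 1 + x ^+ 2 by rewrite ltr_pwDl// sqr_ge0.
rewrite ler_pdivlMr//; have [x2|x2] := ltP x 2.
  have := F2 x x0 x2; have := F0 x; have : x ^+ 2 <= 4 by nra.
  move: (F x) (x ^+ 2) => a b; nra.
have := Fx x x2; have := F0 x; have : 1 <= x ^+ 2 by nra.
move: (F x) (x ^+ 2) => a b; nra.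
Qed.

Lemma gap_ge0 x : 0 <= gap x.
Proof.
have [x1|x1] := leP x 1.
  by rewrite /gap ramp_out// subr0 subr_ge0 ramp_le1.
by rewrite /gap (@ramp_out (- x)) ?subr0 ?subr_ge0 ?ramp_le1//; lra.
Qed.

Lemma gap_le1 x : gap x <= 1.
Proof. by rewrite /gap; have := ramp_ge0 x; have := ramp_ge0 (- x); lra. Qed.

Lemma gap_bound x : gap x ^+ 2 <= 20 / (1 + x ^+ 2).
Proof.
apply: (@even_bound (fun x => gap x ^+ 2)) => // {}x; first by rewrite gapN.
- move=> _ _; have := gap_ge0 x; have := gap_le1 x; nra.
- move=> x2; have x0 : 0 < x - 1 by lra.
  have h : gap x <= (x - 1)^-1.
    by rewrite /gap (@ramp_out (- x)) ?subr0; [apply: one_sub_ramp_le; lra | lra].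
  have hx : gap x * x <= 2.
    apply: (@le_trans _ _ ((x - 1)^-1 * x)); first by apply: ler_wpM2r => //; lra.
    by rewrite mulrC ler_pdivrMr//; lra.
  have h0 : 0 <= gap x * x by apply: mulr_ge0; [exact: gap_ge0 | lra].
  rewrite -exprMn; move: hx h0; move: (gap x * x) => a; nra.
- exact: sqr_ge0.
Qed.

Lemma gap'_bound x : gap' x ^+ 2 <= 20 / (1 + x ^+ 2).
Proof.
apply: (@even_bound (fun x => gap' x ^+ 2)) => // {}x; first by rewrite gap'N sqrrN.
- move=> x0 _; rewrite /gap' (@ramp'_out (- x)) ?sub0r ?sqrrN; last by lra.
  have := ramp'_le2 x; have := ramp'_ge0 x; nra.
- move=> x2; rewrite /gap' (@ramp'_out (- x)) ?sub0r ?sqrrN; last by lra.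
  have x0 : 0 < x - 1 by lra.
  have h := @ramp'_le_sqr x ltac:(lra).
  have hx : ramp' x * x <= 2.
    apply: (@le_trans _ _ ((x - 1) ^- 2 * x)); first by apply: ler_wpM2r => //; lra.
    by rewrite mulrC ler_pdivrMr ?exprn_gt0//; nra.
  have h0 : 0 <= ramp' x * x by apply: mulr_ge0; [exact: ramp'_ge0 | lra].
  rewrite -exprMn; move: hx h0; move: (ramp' x * x) => a; nra.
- exact: sqr_ge0.
Qed.

End Ramp.

(** * Cutoffs adapted to an arc of the circle *)

Section CircleCutoffs.
Variables (R : realType) (m kappa : R).
Hypothesis kappa_lt1 : `|kappa| < 1.
Implicit Types (x y l : R).

(* [arc] is positive on the interval with midpoint m that is cut out by
   [kappa < cos (x - m)], and negative on the interior of its complement. *)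
Definition arc x : R := cos (x - m) - kappa.

Lemma arc_periodic : periodic2pi arc.
Proof. by move=> x; rewrite /arc -addrA [2 * pi - m]addrC addrA cos_periodic2pi. Qed.

Lemma smooth_arc : smooth arc.
Proof.
apply: smoothD; last exact: smooth_cst.
apply: (@smooth_comp R (@cos R) (fun x => x + (- m))); first exact: smooth_cos.
by apply: smoothD; [exact: smooth_id | exact: smooth_cst].
Qed.

Lemma has_derivative_sub : has_derivative (fun x => x - m) (fun=> 1).
Proof.
have := has_derivativeD (@has_derivative_id R) (has_derivative_cst (- m)).
by move/has_derivative_ext; apply => // x; rewrite addr0.
Qed.

Lemma has_derivative_arc : has_derivative arc (fun x => - sin (x - m)).
Proof.
have h := has_derivative_comp (fun x => is_derive_cos x) has_derivative_sub.
have := has_derivativeD h (has_derivative_cst (- kappa)).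
by move/has_derivative_ext; apply => // x; rewrite addr0 mulr1.
Qed.

(** The right side is the squared chord between the points at angles x - m and y - m; the left side
    is the squared difference of their first coordinates. *)
Lemma arc_sep x y : (arc x - arc y) ^+ 2 <= 2 * (1 - cos (x - y)).
Proof.
have -> : cos (x - y) = cos (x - m) * cos (y - m) + sin (x - m) * sin (y - m).
  by rewrite -cosB opprB addrA subrK.
rewrite /arc; have := cos2Dsin2 (x - m); have := cos2Dsin2 (y - m).
have := sqr_ge0 (sin (x - m) - sin (y - m)).
move: (cos (x - m)) (cos (y - m)) (sin (x - m)) (sin (y - m)) => a b c d.
have -> : a - kappa - (b - kappa) = a - b by ring.
rewrite !sqrrB; lra.
Qed.

Definition inner_cutoff l x : R := ramp (l * arc x).
Definition outer_cutoff l x : R := ramp (- (l * arc x)).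

Lemma inner_cutoff_periodic l : periodic2pi (inner_cutoff l).
Proof. by move=> x; rewrite /inner_cutoff arc_periodic. Qed.

Lemma outer_cutoff_periodic l : periodic2pi (outer_cutoff l).
Proof. by move=> x; rewrite /outer_cutoff arc_periodic. Qed.

Lemma smooth_inner_cutoff l : smooth (inner_cutoff l).
Proof.
by apply: (@smooth_comp R (@ramp R) (fun x => l * arc x));
  [exact: smooth_ramp | apply: smoothZ; exact: smooth_arc].
Qed.

Lemma smooth_outer_cutoff l : smooth (outer_cutoff l).
Proof.
apply: (@smooth_comp R (@ramp R) (fun x => - (l * arc x))); first exact: smooth_ramp.
rewrite (_ : (fun x => - (l * arc x)) = (fun x => - l * arc x)); last by apply/funext => x; rewrite mulNr.
by apply: smoothZ; exact: smooth_arc.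
Qed.

Lemma inner_cutoff_support l x : inner_cutoff l x != 0 -> 1 <= l * arc x.
Proof. by apply: contraR; rewrite -ltNge => /ltW/ramp_out; rewrite /inner_cutoff => ->. Qed.

Lemma has_derivative_outer_cutoff l :
  has_derivative (outer_cutoff l) (fun x => ramp' (- (l * arc x)) * (l * sin (x - m))).
Proof.
have := has_derivative_comp (@has_derivative_ramp R) (has_derivativeN (has_derivativeZ l has_derivative_arc)).
by move/has_derivative_ext; apply => // x; ring.
Qed.

Section Estimates.
Variable l : R.
Hypothesis l1 : 1 <= l.

(** By the bounds on [gap] and [gap'], 20 * B dominates the squared dip and, up to a factor l^2, its
    squared derivative. *)
Let B x : R := (1 + (l * arc x) ^+ 2)^-1.

Let l0 : 0 < l. Proof. by apply: lt_le_trans l1. Qed.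

Let B_pos x : 0 < 1 + (l * arc x) ^+ 2.
Proof. by rewrite ltr_pwDl// sqr_ge0. Qed.

Let has_derivative_larc : has_derivative (fun x => l * arc x) (fun x => l * - sin (x - m)).
Proof. exact: has_derivativeZ has_derivative_arc. Qed.

Let cont_larc : continuous (fun x => l * arc x).
Proof. exact: has_derivative_continuous has_derivative_larc. Qed.

Let cont_B : continuous B.
Proof.
have c : continuous (fun x => 1 + (l * arc x) ^+ 2).
  by apply: contD; [exact: cont_cst | exact: contM].
by move=> x; apply: (cvgV _ (c x)); rewrite gt_eqF// B_pos.
Qed.

Let cont_sin_sub : continuous (fun x => sin (x - m)).
Proof.
have := has_derivative_comp (fun x => is_derive_sin x) has_derivative_sub.
exact: has_derivative_continuous.
Qed.

Let cont_cos_sub : continuous (fun x => cos (x - m)).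
Proof.
have := has_derivative_comp (fun x => is_derive_cos x) has_derivative_sub.
exact: has_derivative_continuous.
Qed.

Let has_derivative_atan_larc : has_derivative (fun x => atan (l * arc x))
  (fun x => B x * (l * - sin (x - m))).
Proof. exact: has_derivative_comp (fun x => is_derive1_atan x) has_derivative_larc. Qed.

(* Integrating [(atan (l arc) sin)'] bounds the mean of [sin^2 / (1 + (l arc)^2)],
   and [sin^2 = 1 - kappa^2] where [arc] vanishes. *)
Let mean_B : (1 - kappa ^+ 2) * mean B <= 4 / l.
Proof.
have hs := has_derivative_comp (fun x => is_derive_sin x) has_derivative_sub.
have h := has_derivativeM has_derivative_atan_larc hs.
have cat : continuous (fun x => atan (l * arc x)).
  exact: has_derivative_continuous has_derivative_atan_larc.
have csin2 : continuous (fun x => B x * sin (x - m) ^+ 2) by apply: contM => //; exact: contM.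
have catc : continuous (fun x => atan (l * arc x) * cos (x - m)) by exact: contM.
have ibp : l * mean (fun x => B x * sin (x - m) ^+ 2) = mean (fun x => atan (l * arc x) * cos (x - m)).
  have E : (fun x => B x * (l * - sin (x - m)) * (@sin R \o (fun x => x - m)) x +
      atan (l * arc x) * (cos (x - m) * 1)) =
      (fun x => - l * (B x * sin (x - m) ^+ 2) + atan (l * arc x) * cos (x - m)).
    by apply/funext => x /=; ring.
  rewrite E in h; have := mean_derivative h.
  have -> : arc (2 * pi) = arc 0 by rewrite -[2 * pi]add0r arc_periodic.
  have -> : (@sin R \o (fun x => x - m)) (2 * pi) = (@sin R \o (fun x => x - m)) 0.
    by rewrite /= -[2 * pi]add0r -addrA [2 * pi - m]addrC addrA sin_periodic2pi.
  rewrite meanD ?meanZ//; last exact: contZ.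
  move=> H; have {}H := H (contD (contZ (c := - l) csin2) catc) erefl; lra.
have b1 : l * mean (fun x => B x * sin (x - m) ^+ 2) <= 2.
  rewrite ibp; apply: le_trans (ler_norm _) _; apply: mean_norm_le => // x.
  rewrite normrM -[2]mulr1; apply: ler_pM => //; last exact: cos_max.
  have := atan_gtNpi2 (l * arc x); have := atan_ltpi2 (l * arc x); have := @pihalf_lt2 R.
  by rewrite ler_norml; lra.
(* Away from the zeros of [arc], sin^2 differs from 1 - kappa^2 by 2 kappa arc + arc^2, which
   multiplication by B brings down to at most 2 / l. *)
have pt x : (1 - kappa ^+ 2) * B x <= B x * sin (x - m) ^+ 2 + 2 / l.
  have Bx := B_pos x; have -> : sin (x - m) ^+ 2 = 1 - (kappa + arc x) ^+ 2.
    by rewrite sin2cos2; congr (1 - _ ^+ 2); rewrite /arc [RHS]addrC subrK.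
  suff : B x * (2 * kappa * arc x + arc x ^+ 2) <= 2 / l by lra.
  rewrite /B mulrC ler_pdivrMr// -(ler_pM2l l0) mulrA mulrCA mulfV ?gt_eqF// mulr1.
  move: kappa_lt1; rewrite ltr_norml => /andP[k1 k2].
  have ll : l <= l ^+ 2 by rewrite expr2 ler_peMl// ltW.
  have := sqr_ge0 (l * arc x - 1); have := sqr_ge0 (l * arc x + 1); have := sqr_ge0 (arc x).
  move: (arc x) => s s2 h1 h2.
  have a1 : l * (s ^+ 2) <= (l * s) ^+ 2 by rewrite exprMn; apply: ler_wpM2r.
  have a2 : 2 * (kappa * (l * s)) <= 1 + (l * s) ^+ 2.
    move: h1 h2; move: (l * s) => t h1 h2.
    have [t0|t0] := leP 0 t; nra.
  move: a1 a2; move: ((l * s) ^+ 2) => w; lra.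
have := mean_le (contZ (c := 1 - kappa ^+ 2) cont_B) (contD csin2 (@cont_cst R (2 / l))) pt.
rewrite meanZ// meanD//; last exact: cont_cst.
rewrite mean_cst => h'; apply: le_trans h' _.
have : mean (fun x => B x * sin (x - m) ^+ 2) <= 2 / l by rewrite ler_pdivlMr// mulrC.
have -> : 4 / l = 2 / l + 2 / l by field; rewrite gt_eqF.
lra.
Qed.

(** 80 is 20 from the pointwise bounds times 4 from [mean_B]. *)
Definition cutoff_bound : R := 80 / (1 - kappa ^+ 2).

Let k2 : 0 < 1 - kappa ^+ 2.
Proof. by move: kappa_lt1; rewrite ltr_norml => /andP[? ?]; nra. Qed.

Let mean_20B : 20 * mean B <= cutoff_bound / l.
Proof.
rewrite -(ler_pM2l k2) mulrCA; have -> : (1 - kappa ^+ 2) * (cutoff_bound / l) = 20 * (4 / l).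
  by rewrite /cutoff_bound; field; rewrite !gt_eqF.
by rewrite ler_pM2l.
Qed.

Let gapf x := gap (l * arc x).
Let gapf' x := gap' (l * arc x) * (l * - sin (x - m)).

Let has_derivative_gapf : has_derivative gapf gapf'.
Proof. exact: has_derivative_comp (@has_derivative_gap R) has_derivative_larc. Qed.

Let cont_gapf' : continuous gapf'.
Proof.
apply: contM; last by apply/contZ/contN.
have h x : {for x, continuous (@gap' R)}.
  have c2 : continuous (@ramp' R).
    have := has_derivative_comp (has_derivative_flat 2)
      (has_derivativeD (@has_derivative_id R) (has_derivative_cst (-1))).
    exact: has_derivative_continuous.
  have cN : continuous (fun x : R => - x) by apply: contN => x' ; exact: cvg_id.
  by apply: contB => // y; exact: (cvg_comp _ _ (cN y) (c2 _)).
by move=> x; apply: (@continuous_comp _ _ _ (fun x => l * arc x) (@gap' R)); [exact: cont_larc | exact: h].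
Qed.

Let cont_gapf : continuous gapf.
Proof. exact: has_derivative_continuous has_derivative_gapf. Qed.

Let mean_gapf : mean (fun x => gapf x ^+ 2) <= cutoff_bound / l.
Proof.
apply: le_trans mean_20B; rewrite -meanZ//; apply: mean_le => [||x]; [exact: contM|exact: contZ|].
exact: gap_bound.
Qed.

Let mean_gapf' : mean (fun x => gapf' x ^+ 2) <= cutoff_bound * l.
Proof.
have -> : cutoff_bound * l = l ^+ 2 * (cutoff_bound / l) by field; rewrite ?gt_eqF.
apply: (@le_trans _ _ (l ^+ 2 * (20 * mean B))); last first.
  by apply: ler_wpM2l; [exact: sqr_ge0 | exact: mean_20B].
rewrite -meanZ// -meanZ; last exact: contZ.
apply: mean_le => [||x]; [exact: contM | by apply/contZ/contZ |].
rewrite /gapf' exprMn exprMn sqrrN mulrC -mulrA; apply: ler_wpM2l; first exact: sqr_ge0.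
apply: (@le_trans _ _ (1 * gap' (l * arc x) ^+ 2)); last by rewrite mul1r; exact: gap'_bound.
apply: ler_wpM2r; first exact: sqr_ge0.
by rewrite sin2cos2; have := sqr_ge0 (cos (x - m)); lra.
Qed.

Definition cutoff x : R := inner_cutoff l x + outer_cutoff l x.

Let cutoffE x : cutoff x = 1 - gapf x.
Proof. by rewrite /cutoff /gapf /gap /inner_cutoff /outer_cutoff; ring. Qed.

Let trig_coef_cutoff (t : R -> R) : continuous t -> mean t = 0 ->
  mean (fun x => cutoff x * t x) = - mean (fun x => gapf x * t x).
Proof.
move=> ct t0; have -> : (fun x => cutoff x * t x) = (fun x => t x - gapf x * t x).
  by apply/funext => x; rewrite cutoffE; ring.
by rewrite meanB//; [rewrite t0 sub0r | exact: contM].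
Qed.

(** The coefficient formulas for derivatives, applied to the constant 1. *)
Let coef1 k : mean (fun x => cos (k.+1%:R * x)) = 0 :> R /\ mean (fun x => sin (k.+1%:R * x)) = 0 :> R.
Proof.
have h : has_derivative (fun=> 1 : R) (fun=> 0) by exact: has_derivative_cst.
have c0 : continuous (fun _ : R => 0 : R) by exact: cont_cst.
have z (t : R -> R) : mean (fun x => 0 * t x) = 0.
  by under eq_fun do rewrite mul0r; rewrite mean_cst.
have e1 := cos_coef_derivative k.+1 h c0 (fun=> erefl).
have e2 := sin_coef_derivative k.+1 h c0 (fun=> erefl).
have k0 : (k.+1%:R : R) != 0 by rewrite pnatr_eq0.
have cancel (t : R) : k.+1%:R * t = 0 -> t = 0.
  by move=> /eqP; rewrite mulf_eq0 (negPf k0) => /eqP.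
have one (t : R -> R) : (fun x => 1 * t x) = t by apply/funext => x; rewrite mul1r.
move: e1 e2; rewrite /cos_coef /sin_coef !z !one => /esym/cancel -> /esym/eqP.
by rewrite oppr_eq0 => /eqP/cancel ->.
Qed.

Lemma cutoff_coef_sqr k : cos_coef cutoff k.+1 ^+ 2 + sin_coef cutoff k.+1 ^+ 2 =
  cos_coef gapf k.+1 ^+ 2 + sin_coef gapf k.+1 ^+ 2.
Proof.
have [c1 s1] := coef1 k.
by rewrite /cos_coef /sin_coef !trig_coef_cutoff ?sqrrN//; [exact: cont_sinZ | exact: cont_cosZ].
Qed.

Lemma cutoff_half_Sobolev N :
  \sum_(0 <= k < N) k.+1%:R * (cos_coef cutoff k.+1 ^+ 2 + sin_coef cutoff k.+1 ^+ 2) <=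
  cutoff_bound.
Proof.
under eq_bigr do rewrite cutoff_coef_sqr.
(* The weight r = l balances the mean square of the dip, of order 1 / l, against that of its
   derivative, of order l. *)
apply: le_trans (half_Sobolev N l0 has_derivative_gapf cont_gapf' _) _.
  by move=> x; rewrite /gapf arc_periodic.
have h1 : l * mean (fun x => gapf x ^+ 2) <= cutoff_bound.
  by rewrite mulrC -ler_pdivlMr.
have h2 : l^-1 * mean (fun x => gapf' x ^+ 2) <= cutoff_bound.
  by rewrite mulrC ler_pdivrMr.
have : 0 < cutoff_bound by rewrite divr_gt0.
lra.
Qed.

Lemma cutoff_coef_le k :
  cos_coef cutoff k.+1 ^+ 2 + sin_coef cutoff k.+1 ^+ 2 <= cutoff_bound / l.
Proof.
rewrite cutoff_coef_sqr; have := Bessel k.+1 cont_gapf; rewrite big_nat_recr//=.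
have : 0 <= \sum_(0 <= i < k) (cos_coef gapf i.+1 ^+ 2 + sin_coef gapf i.+1 ^+ 2).
  by apply: sumr_ge0 => i _; rewrite addr_ge0 ?sqr_ge0.
have := mean_gapf; have := sqr_ge0 (cos_coef gapf k.+1); have := sqr_ge0 (sin_coef gapf k.+1).
by move: (\sum_(_ <= _ < _) _) => S; lra.
Qed.

End Estimates.

End CircleCutoffs.

(** * Proper intervals as arcs *)

Section IntervalGeometry.
Variable R : realType.
Implicit Types (I U V : set R) (x y a b p : R) (k j : int).

Lemma periodic_int (T : Type) (f : R -> T) x k : periodic2pi f ->
  f (x + k%:~R * (2 * pi)) = f x.
Proof.
move=> fp; have nat_case n y : f (y + n%:R * (2 * pi)) = f y.
  elim: n y => [|n IH] y; first by rewrite mul0r addr0.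
  by rewrite -addn1 natrD (mulrDl _ _ (2 * pi)) mul1r addrA fp.
case: k => n; first by rewrite -pmulrn.
by rewrite NegzE mulrNz mulNr -(nat_case n.+1 (x - _)) pmulrn subrK.
Qed.

Lemma period_shift a x : exists k, a <= x + k%:~R * (2 * pi) < a + 2 * pi.
Proof.
have P0 := @twopi_gt0 R.
exists (- Num.floor ((x - a) / (2 * pi))); have := floor_itv ((x - a) / (2 * pi)).
rewrite ler_pdivlMr// ltr_pdivrMr// intrD mulr1z (mulrDl _ _ (2 * pi)) mul1r mulrNz mulNr => /andP[h1 h2].
by apply/andP; split; lra.
Qed.

Lemma small_period_shift k : `|k%:~R * (2 * pi) : R| < 2 * pi -> k = 0.
Proof.
have P0 := @twopi_gt0 R.
rewrite normrM (gtr0_norm P0) gtr_pMl// -intr_norm -[1]/(1%:~R) ltr_int.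
by case: k => [[|n]|n].
Qed.

Lemma continuous_periodic_bounded (f : R -> R) : continuous f -> periodic2pi f ->
  exists F, forall x, `|f x| <= F.
Proof.
move=> cf fp; have cN : continuous (fun x => `|f x|).
  by move=> x; apply: cvg_norm; exact: cf.
have [c _ cP] := @EVT_max R (fun x => `|f x|) 0 (2 * pi) (ltW (@twopi_gt0 R)) (continuous_subspaceT cN).
exists `|f c| => x; have [k] := period_shift 0 x; rewrite add0r => /andP[k0 k1].
by rewrite -(periodic_int x k fp); apply: cP; rewrite in_itv /= k0 ltW.
Qed.

(** Modulo the period the support is compact, so [arc] attains a positive minimum on it. *)
Lemma supported_arc (f : R -> R) m kappa : periodic2pi f ->
  supported f [set x | 0 < arc m kappa x] ->
  exists2 d, 0 < d & forall x, f x != 0 -> d <= arc m kappa x.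
Proof.
move=> fp fs; pose A := closure [set x | f x != 0] `&` `[0, 2 * pi].
have shift x : f x != 0 -> exists2 y, A y & arc m kappa y = arc m kappa x.
  move=> fx; have [k] := period_shift 0 x; rewrite add0r => /andP[k0 k1].
  exists (x + k%:~R * (2 * pi)); last exact/periodic_int/arc_periodic.
  split; first by apply: subset_closure; rewrite /= (periodic_int x k fp).
  by rewrite /= in_itv /= k0 ltW.
have [A0|A0] := pselect (A !=set0); last first.
  by exists 1 => // x /shift[y Ay _]; case: A0; exists y.
have cA : compact A.
  by rewrite /A setIC; apply: compact_closedI; [exact: segment_compact | exact: closed_closure].
have carc : continuous (arc m kappa) by exact/smooth_continuous/smooth_arc.
have [c] := compact_EVT_min A0 cA (continuous_subspaceT carc).
rewrite inE => -[/fs /= c0 _] cP; exists (arc m kappa c) => // x /shift[y Ay <-].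
by apply: cP; rewrite inE.
Qed.

Section ProperInterval.
Variable I : set R.
Hypothesis I_proper : proper_interval I.

Let I_shift x k : I (x + k%:~R * (2 * pi)) = I x.
Proof. by case: I_proper => Ip _ _ _ _; exact: periodic_int. Qed.

(** A point p outside the closure of I cuts the circle open; a and b are the infimum and supremum of
    I inside (p, p + 2 pi). Openness keeps them out of I, and connectedness fills the space
    between. *)
Lemma proper_interval_endpoints : exists a b, [/\ a < b, b < a + 2 * pi &
  forall x, I x <-> exists k, a < x + k%:~R * (2 * pi) < b].
Proof.
have P0 := @twopi_gt0 R.
have [_ [x0 Ix0] Io Ic Id] := I_proper.
have [p pI] : exists p, ~ closure I p.
  by apply: contrapT => h; apply: Id; apply/seteqP; split=> // p _; apply: contrapT => hp; apply: h; exists p.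
have [r r0 rI] : exists2 r, 0 < r & forall y, `|p - y| < r -> ~ I y.
  have : nbhs p (~` I).
    apply: contrapT => pnI; apply: pI => B /= Bp; apply: contrapT => /nonemptyPn IB0.
    apply: pnI; apply: filterS Bp => y By Iy.
    by have : (I `&` B) y by []; rewrite IB0.
  by case/nbhs_ballP => r /= r0 rI; exists r.
have pnI : ~ I p by apply: rI; rewrite subrr normr0.
pose J := [set x | I x /\ p < x < p + 2 * pi].
have toJ x : I x -> exists k, J (x + k%:~R * (2 * pi)).
  move=> Ix; have [k /andP[k0 k1]] := period_shift p x; exists k.
  split; first by rewrite I_shift.
  rewrite k1 andbT lt_neqAle k0 andbT; apply/eqP => E.
  by apply: pnI; rewrite E I_shift.
have [k0 Jx1] := toJ _ Ix0; set x1 := x0 + _ in Jx1.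
have Jl x : J x -> p + r <= x.
  move=> [Ix /andP[px xp]]; rewrite leNgt; apply/negP => xr.
  by apply: (rI x) => //; rewrite distrC ger0_norm ?subr_ge0 ?(ltW px)//; lra.
have Ju x : J x -> x <= p + 2 * pi - r.
  move=> [Ix /andP[px xp]]; rewrite leNgt; apply/negP => xr.
  apply: (rI (x + (-1)%:~R * (2 * pi))); last by rewrite I_shift.
  by rewrite mulrN1z mulN1r gtr0_norm; lra.
have Jinf : has_inf J by split; [exists (x0 + k0%:~R * (2 * pi)) | exists (p + r)].
have Jsup : has_sup J by split; [exists (x0 + k0%:~R * (2 * pi)) | exists (p + 2 * pi - r)].
pose a := inf J; pose b := sup J.
have pa : p + r <= a by apply: lb_le_inf => //; exact: Jinf.1.
have bp : b <= p + 2 * pi - r by apply: ge_sup => //; exact: Jsup.1.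
have Ja x : J x -> a <= x by move=> Jx; apply: ge_inf => //; exact: Jinf.2.
have Jb x : J x -> x <= b by move=> Jx; apply: ub_le_sup => //; exact: Jsup.2.
have ball_in x : I x -> exists2 e, 0 < e & forall y, `|x - y| < e -> I y.
  by move=> Ix; have /nbhs_ballP[e /= e0 eI] := open_nbhs_nbhs (conj Io Ix); exists e.
have anI : ~ I a.
  move=> /ball_in[e e0 eI]; pose t := Num.min (e / 2) (r / 2).
  have t0 : 0 < t by rewrite lt_min !divr_gt0.
  have [te tr] : t <= e / 2 /\ t <= r / 2 by rewrite !ge_min !lexx orbT.
  have : J (a - t).
    split; first by apply: eI; rewrite opprB addrC subrK gtr0_norm//; lra.
    by have := Ja _ Jx1; have := Ju _ Jx1; lra.
  by move=> /Ja; lra.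
have bnI : ~ I b.
  move=> /ball_in[e e0 eI]; pose t := Num.min (e / 2) (r / 2).
  have t0 : 0 < t by rewrite lt_min !divr_gt0.
  have [te tr] : t <= e / 2 /\ t <= r / 2 by rewrite !ge_min !lexx orbT.
  have : J (b + t).
    split; first by apply: eI; rewrite opprD addrA subrr sub0r normrN gtr0_norm//; lra.
    by have := Jb _ Jx1; have := Jl _ Jx1; lra.
  by move=> /Jb; lra.
have Jab x : J x -> a < x < b.
  move=> Jx; rewrite !lt_neqAle Ja// Jb// !andbT; apply/andP; split; apply/eqP => E.
    by apply: anI; rewrite E; case: Jx.
  by apply: bnI; rewrite -E; case: Jx.
have abI x : a < x < b -> I x.
  move=> /andP[ax xb]; apply: contrapT => xnI.
  (* If x were missing, I would split into its parts over (p, x) and (x, p + 2 pi), both nonempty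
     since x lies strictly between the infimum and the supremum. *)
  pose piece l u := [set y | I y /\ exists k, l < y + k%:~R * (2 * pi) < u].
  have piece_periodic l u : periodic2pi (piece l u).
    move=> y; apply/propext; split=> -[Iy [k kP]].
      split; first by have := I_shift y 1; rewrite mul1r => <-.
      by exists (k + 1); rewrite intrD mulr1z (mulrDl _ _ (2 * pi)) mul1r; move: kP; rewrite -addrA [2 * pi + _]addrC.
    split; first by have := I_shift y 1; rewrite mul1r => ->.
    by exists (k - 1); rewrite intrB mulr1z (mulrBl (2 * pi)) mul1r -addrA [2 * pi + _]addrC subrK.
  have piece_open l u : open (piece l u).
    have -> : piece l u = I `&` \bigcup_k [set y | l < y + k%:~R * (2 * pi) < u].
      by apply/seteqP; split=> y [Iy [k]]; [move=> kP; split=> //; exists k | move=> _ kP; split=> //; exists k].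
    apply: openI => //; apply: bigcup_open => k _.
    rewrite (_ : [set y | _] = `]l - k%:~R * (2 * pi), u - k%:~R * (2 * pi)[%classic); first exact: interval_open.
    by apply/seteqP; split=> y /=; rewrite in_itv /= ltrBlDr ltrBrDr.
  have UV0 : piece p x `&` piece x (p + 2 * pi) = set0.
    apply/seteqP; split=> // y [[_ [k /andP[k1 k2]]] [_ [j /andP[j1 j2]]]] /=.
    have : (0 : R) < (j - k)%:~R * (2 * pi) by rewrite intrB (mulrBl (2 * pi)); lra.
    have : (j - k)%:~R * (2 * pi) < 2 * pi :> R by rewrite intrB (mulrBl (2 * pi)); lra.
    move=> h1 h2; have := @small_period_shift (j - k); rewrite ger0_norm ?(ltW h2)// => /(_ h1) jk.
    by move: h2; rewrite jk mul0r ltxx.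
  have UVI : piece p x `|` piece x (p + 2 * pi) = I.
    apply/seteqP; split=> y; first by case=> -[].
    move=> Iy; have [k [Ik /andP[k1 k2]]] := toJ _ Iy.
    have [h|h|h] := ltgtP (y + k%:~R * (2 * pi)) x.
    - by left; split=> //; exists k; rewrite k1.
    - by right; split=> //; exists k; rewrite h.
    - by rewrite h in Ik.
  have [U0|V0] := Ic _ _ (piece_periodic _ _) (piece_periodic _ _) (piece_open _ _) (piece_open _ _) UV0 UVI.
    have [y Jy yx] := inf_adherent (eps := x - a) ltac:(lra) Jinf.
    have : piece p x y.
      by case: Jy => Iy /andP[py _]; split=> //; exists 0; rewrite mul0r addr0 py; move: yx; rewrite -/a; lra.
    by rewrite U0.
  have [y Jy yx] := sup_adherent (eps := b - x) ltac:(lra) Jsup.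
  have : piece x (p + 2 * pi) y.
    by case: Jy => Iy /andP[_ yp]; split=> //; exists 0; rewrite mul0r addr0 yp andbT; move: yx; rewrite -/b; lra.
  by rewrite V0.
exists a, b; split.
- by have /andP[] := Jab _ Jx1; exact: lt_trans.
- lra.
- move=> x; split=> [/toJ[k /Jab kP]|[k /abI]]; first by exists k.
  by rewrite I_shift.
Qed.

(** m is the midpoint and kappa the cosine of the half-length, which is below pi; cos is even and
    decreasing on [0, pi]. *)
Lemma proper_interval_arc : exists m kappa, `|kappa| < 1 /\ I = [set x | 0 < arc m kappa x].
Proof.
have P0 := @twopi_gt0 R; have [a [b [ab ba IP]]] := proper_interval_endpoints.
pose m := (a + b) / 2; pose y0 := (b - a) / 2; exists m, (cos y0).
have y00 : 0 < y0 by rewrite /y0; lra.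
have y0pi : y0 < pi by rewrite /y0; lra.
split.
  have s0 : 0 < sin y0 by apply: sin_gt0_pi; rewrite y00.
  have : cos y0 ^+ 2 < 1 ^+ 2 by rewrite cos2sin2 expr1n; nra.
  by rewrite -real_normK ?num_real// ltr_sqr ?nnegrE.
have near_mid x : `|x - m| <= pi -> (0 < arc m (cos y0) x) = (a < x < b).
  move=> xm; rewrite /arc subr_gt0 -[in LHS](cos_norm (x - m)) ltr_cos ?in_itv/= ?xm ?normr_ge0 ?(ltW y00) ?(ltW y0pi)//.
  by rewrite ltr_norml /m /y0; apply/andP/andP => -[? ?]; split; lra.
apply/seteqP; split=> x /=.
  move=> Ix; have [k kP] := (IP x).1 Ix.
  rewrite -(periodic_int x k (@arc_periodic R m (cos y0))) near_mid//.
  by move: kP => /andP[k1 k2]; rewrite ler_norml /m; apply/andP; split; lra.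
have [k /andP[k1 k2]] := period_shift (m - pi) x.
rewrite -(periodic_int x k (@arc_periodic R m (cos y0))) near_mid; first by move=> kP; apply/IP; exists k.
by rewrite ler_norml; apply/andP; split; lra.
Qed.

End ProperInterval.

End IntervalGeometry.

(** * One-particle vectors of loops *)

Section LoopClasses.
Variables (R : realType) (F : vectType R) (ip : {dot F for idfun}) (n : nat).
Variable u : 'I_n -> F.
Implicit Types (f g : R -> F) (c v : F).

Lemma ip_sym v c : ip v c = ip c v.
Proof. by rewrite hermC /= expr0 mul1r. Qed.

Lemma ip_gt0 v : v != 0 -> 0 < ip v v.
Proof. exact: neq0_dnorm_gt0. Qed.

Let comp f (j : 'I_n) : R -> R := fun x => ip (f x) (u j).

Lemma smooth_loop_coord f v : smooth_loop ip f -> smooth (fun x => ip (f x) v) /\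
  periodic2pi (fun x => ip (f x) v).
Proof. by move=> [fp fs]; split=> // x; rewrite fp. Qed.

Lemma smooth_loopD f g : smooth_loop ip f -> smooth_loop ip g ->
  smooth_loop ip (fun x => f x + g x).
Proof.
move=> [fp fs] [gp gs]; split=> [x|v]; first by rewrite fp gp.
rewrite (_ : (fun x => _) = (fun x => ip (f x) v + ip (g x) v)); first exact: smoothD.
by apply/funext => x; rewrite linearDl.
Qed.

Lemma smooth_loopZ (h : R -> R) c : smooth h -> periodic2pi h -> smooth_loop ip (fun x => h x *: c).
Proof.
move=> sh hp; split=> [x|v]; first by rewrite hp.
rewrite (_ : (fun x => _) = (fun x => ip c v * h x)); first exact: smoothZ.
by apply/funext => x; rewrite linearZl_LR mulrC.
Qed.

Definition loop_coord f (p : nat * 'I_n) : R[i] :=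
  (Num.sqrt p.1.+1%:R)%:C * conjc (fourier (comp f p.2) p.1.+1).

Lemma cnorm2_loop_coord f p : cnorm2 (loop_coord f p) =
  p.1.+1%:R * (cos_coef (comp f p.2) p.1.+1 ^+ 2 + sin_coef (comp f p.2) p.1.+1 ^+ 2).
Proof.
rewrite /loop_coord cnorm2M cnorm2_real sqr_sqrtr ?ler0n// fourierE cnorm2E /=.
by rewrite opprK.
Qed.

Lemma asum_half_Sobolev (h : R -> R) : smooth h -> periodic2pi h ->
  asum (fun k => k.+1%:R * (cos_coef h k.+1 ^+ 2 + sin_coef h k.+1 ^+ 2)).
Proof.
move=> sh hp; have [h' hh' sh'] := smooth_derivative sh.
pose a k : R := k.+1%:R * (cos_coef h k.+1 ^+ 2 + sin_coef h k.+1 ^+ 2).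
have a0 k : 0 <= a k by rewrite mulr_ge0// addr_ge0 ?sqr_ge0.
apply: (@asum_bounded _ _ a (4^-1 * (1 * mean (fun x => h x ^+ 2) + 1^-1 * mean (fun x => h' x ^+ 2)))) => s us.
under eq_bigr do rewrite ger0_norm//.
apply: le_trans (half_Sobolev (\max_(k <- s) k).+1 ltr01 hh' (smooth_continuous sh') hp).
by apply: uniq_sum_le => // k ks; rewrite mem_index_iota /= ltnS (leq_bigmax_seq _ ks).
Qed.

(** Ensures that [loop_class] does not take the default value of [mkl2] on smooth loops. *)
Lemma asum_loop_coord f : smooth_loop ip f -> asum (fun p => cnorm2 (loop_coord f p)).
Proof.
move=> fl; apply: asum_prod => j; under eq_fun do rewrite cnorm2_loop_coord /=.
by have [sf pf] := smooth_loop_coord (u j) fl; exact: asum_half_Sobolev.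
Qed.

Lemma loop_classE f p : smooth_loop ip f -> loop_class ip u f p = loop_coord f p :> R[i].
Proof.
move=> fl; rewrite /loop_class dsumE//; exact: asum_loop_coord fl.
Qed.

Let cont_comp f j : smooth_loop ip f -> continuous (comp f j).
Proof. by move=> fl; have [/smooth_continuous] := smooth_loop_coord (u j) fl. Qed.

Lemma loop_classD f g : smooth_loop ip f -> smooth_loop ip g ->
  loop_class ip u (fun x => f x + g x) = loop_class ip u f + loop_class ip u g.
Proof.
move=> fl gl; apply: l2_ext => p; rewrite l2D.
rewrite (loop_classE p (smooth_loopD fl gl)) (loop_classE p fl) (loop_classE p gl).
have cf := @cont_comp f p.2 fl; have cg := @cont_comp g p.2 gl.
have E (t : R -> R) : continuous t -> mean (fun x => comp (fun x => f x + g x) p.2 x * t x) =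
    mean (fun x => comp f p.2 x * t x) + mean (fun x => comp g p.2 x * t x).
  move=> ct; rewrite -meanD; [|exact: contM..].
  by congr mean; apply/funext => x; rewrite /comp linearDl mulrDl.
rewrite /loop_coord -mulrDr; congr (_ * _); rewrite !fourierE /cos_coef /sin_coef.
rewrite !E; [|exact: cont_sinZ|exact: cont_cosZ].
by congr (_ +i* _); ring.
Qed.

Lemma loop_omegaE f g : smooth_loop ip f -> smooth_loop ip g ->
  asum (fun p : nat * 'I_n => symplectic_coef (comp f p.2) (comp g p.2) p.1) /\
  omega (loop_class ip u f) (loop_class ip u g) =
  rsum (fun p : nat * 'I_n => symplectic_coef (comp f p.2) (comp g p.2) p.1).
Proof.
move=> fl gl; have E p : complex.Im (hdot (loop_class ip u f p) (loop_class ip u g p)) =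
    symplectic_coef (comp f p.2) (comp g p.2) p.1.
  rewrite (loop_classE p fl) (loop_classE p gl) /loop_coord !fourierE /symplectic_coef /hdot /=.
  have := sqr_sqrtr (ler0n R p.1.+1); move: (Num.sqrt _) => s <-.
  by ring.
have [_ s] := l2dot_casum (loop_class ip u f) (loop_class ip u g).
split; first by move: s; congr asum; apply/funext => p; exact: E.
by rewrite /omega l2_hdotE /csum /=; congr rsum; apply/funext => p; exact: E.
Qed.

Section ProperArc.
Variables (m kappa : R) (I : set R).
Hypothesis kappa_lt1 : `|kappa| < 1.
Hypothesis I_arc : I = [set x | 0 < arc m kappa x].

Definition inner_loop (l : R) c : R -> F := fun x => inner_cutoff m kappa l x *: c.
Definition outer_loop (l : R) c : R -> F := fun x => outer_cutoff m kappa l x *: c.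

Lemma smooth_inner_loop l c : smooth_loop ip (inner_loop l c).
Proof. apply: smooth_loopZ; [exact: smooth_inner_cutoff | exact: inner_cutoff_periodic]. Qed.

Lemma smooth_outer_loop l c : smooth_loop ip (outer_loop l c).
Proof. apply: smooth_loopZ; [exact: smooth_outer_cutoff | exact: outer_cutoff_periodic]. Qed.

Lemma supported_inner_loop (l : R) c : 0 < l -> supported (inner_loop l c) I.
Proof.
move=> l0; rewrite I_arc.
have closed_set_ge : closed [set x | 1 <= l * arc m kappa x].
  rewrite (_ : [set x | _] = (fun x => l * arc m kappa x) @^-1` [set t | 1 <= t]); last by [].
  apply: closed_comp; last exact: closed_ge.
  by move=> x _; apply: contZ; exact/smooth_continuous/smooth_arc.
move=> x xs; have : 1 <= l * arc m kappa x.
  apply: closed_set_ge; apply: closure_subset xs => y /=.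
  move=> fy; apply: inner_cutoff_support; apply: contra fy => /eqP h.
  by rewrite /inner_loop h scale0r.
by rewrite /= -(pmulr_rgt0 _ l0); apply: lt_le_trans.
Qed.

Lemma supported_coord f v : supported f I -> supported (fun x => ip (f x) v) I.
Proof.
move=> fs x xs; apply: fs; apply: closure_subset xs => y /=; apply: contra => /eqP ->.
by rewrite linear0l.
Qed.

(** Where a coordinate of f is nonzero, [arc] is at least some d > 0, while the derivative of the
    outer loop lives where [arc] is negative. By [arc_sep], 1 - cos (x - y) is then at least d^2 /
    2. *)
Lemma omega_outer_loop (l : R) c f : 0 < l -> smooth_loop ip f -> supported f I ->
  omega (loop_class ip u f) (loop_class ip u (outer_loop l c)) = 0.
Proof.
move=> l0 fl fs; have gl := smooth_outer_loop l c.
have [sa ->] := loop_omegaE fl gl; rewrite rsum_prod//; apply: big1 => j _.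
have {}sa := asum_slice j sa; rewrite /= in sa.
have [sf pf] := smooth_loop_coord (u j) fl.
have [sg pg] := smooth_loop_coord (u j) gl.
have fs' := @supported_coord f (u j) fs; rewrite I_arc in fs'.
have [d d0 dP] := supported_arc pf fs'.
have [Fb FbP] := continuous_periodic_bounded (smooth_continuous sf) pf.
pose a := ip c (u j).
pose g' x := a * (ramp' (- (l * arc m kappa x)) * (l * sin (x - m))).
have gE : comp (outer_loop l c) j = (fun x => a * outer_cutoff m kappa l x).
  by apply/funext => x; rewrite /comp /outer_loop linearZl_LR mulrC.
have hg : has_derivative (comp (outer_loop l c) j) g'.
  by rewrite gE; exact/has_derivativeZ/has_derivative_outer_cutoff.
have cg' : continuous g'.
  have [g'' hg'' sg''] := smooth_derivative sg.
  by rewrite -(has_derivative_derive1 hg) (has_derivative_derive1 hg''); exact: smooth_continuous.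
have pg' : periodic2pi g'.
  move=> x; rewrite /g' arc_periodic; congr (_ * (_ * (_ * _))).
  by rewrite -addrA [2 * pi - m]addrC addrA sin_periodic2pi.
have [Gb GbP] := continuous_periodic_bounded cg' pg'.
apply: (@separated_symplectic_sum R (comp f j) (comp (outer_loop l c) j) g' Fb Gb (d ^+ 2 / 2)) => //.
- exact: smooth_continuous.
- by rewrite divr_gt0// exprn_gt0.
move=> x y /dP dx gy; have ay : arc m kappa y < 0.
  rewrite ltNge; apply/negP => ay; move: gy; rewrite /g' ramp'_out ?mul0r ?mulr0 ?eqxx//.
  by apply: (@le_trans _ _ 0) => //; rewrite oppr_le0 mulr_ge0// ltW.
have := @arc_sep R m kappa x y; rewrite ler_pdivrMr// [_ * 2]mulrC; apply: le_trans.
by rewrite ler_sqr ?nnegrE ?(ltW d0)//; lra.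
Qed.

(* Adding up the two loops gives the constant c minus a function concentrated
   near the end points of I. *)
Definition cutoff_class (l : R) c : one_particle R n :=
  loop_class ip u (inner_loop l c) + loop_class ip u (outer_loop l c).

Lemma cnorm2_cutoff_class l c p : cnorm2 (cutoff_class l c p : R[i]) =
  ip c (u p.2) ^+ 2 * (p.1.+1%:R * (cos_coef (cutoff m kappa l) p.1.+1 ^+ 2 +
  sin_coef (cutoff m kappa l) p.1.+1 ^+ 2)).
Proof.
have fl := smooth_inner_loop l c; have gl := smooth_outer_loop l c.
rewrite /cutoff_class -(loop_classD fl gl) (loop_classE p (smooth_loopD fl gl)) cnorm2_loop_coord.
have E (t : R -> R) : continuous t ->
    mean (fun x => comp (fun x => inner_loop l c x + outer_loop l c x) p.2 x * t x) =
    ip c (u p.2) * mean (fun x => cutoff m kappa l x * t x).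
  move=> ct; rewrite -meanZ; last first.
    apply: contM => //; apply: contD; first exact/smooth_continuous/smooth_inner_cutoff.
    exact/smooth_continuous/smooth_outer_cutoff.
  congr mean; apply/funext => x; rewrite /comp /inner_loop /outer_loop -scalerDl linearZl_LR /cutoff.
  by ring.
by rewrite /cos_coef /sin_coef !E; [ring | exact: cont_sinZ | exact: cont_cosZ].
Qed.

Lemma cutoff_class_bounded c : exists B, forall l, 1 <= l -> hnorm2 (cutoff_class l c) <= B.
Proof.
exists (\sum_j ip c (u j) ^+ 2 * cutoff_bound kappa) => l l1.
rewrite l2_hnorm2E rsum_prod; last exact: asum_hnorm2.
apply: ler_sum => j _; apply: rsum_le_bound => [k|s us]; first exact: hnorm2_ge0.
under eq_bigr do rewrite -/(cnorm2 _) cnorm2_cutoff_class /=.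
rewrite -mulr_sumr; apply: ler_wpM2l; first exact: sqr_ge0.
apply: le_trans (cutoff_half_Sobolev m kappa_lt1 l1 (\max_(k <- s) k).+1).
apply: uniq_sum_le => // [k ks|k]; last by rewrite mulr_ge0// addr_ge0 ?sqr_ge0.
by rewrite mem_index_iota /= ltnS (leq_bigmax_seq _ ks).
Qed.

Lemma cutoff_class_weak c eta :
  (fun j => redot eta (cutoff_class j.+1%:R c)) @ \oo --> (0 : R).
Proof.
have [B BP] := cutoff_class_bounded c.
have l1 j : (1 : R) <= j.+1%:R by rewrite ler1n.
apply: (weak_cvg_total (fun j => BP _ (l1 j)) (@total_delta R _ _ _ (@total_setT R (complexH R)))).
move=> _ [p [a _ ->]]; under eq_fun do rewrite redot_delta.
pose K := hnorm2 a * (ip c (u p.2) ^+ 2 * (p.1.+1%:R * cutoff_bound kappa)).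
have K0 : 0 <= K.
  move: kappa_lt1; rewrite ltr_norml => /andP[k1 k2].
  rewrite /K mulr_ge0 ?hnorm2_ge0// mulr_ge0 ?sqr_ge0// mulr_ge0// divr_ge0//; nra.
have bnd j : redot a (cutoff_class j.+1%:R c p) ^+ 2 <= K / j.+1%:R.
  apply: le_trans (Cauchy_Schwarz _ _) _; rewrite -/(cnorm2 (cutoff_class _ _ _)) cnorm2_cutoff_class.
  have -> : K / j.+1%:R = hnorm2 a * (ip c (u p.2) ^+ 2 * (p.1.+1%:R * (cutoff_bound kappa / j.+1%:R))).
    by rewrite /K !mulrA.
  apply: ler_wpM2l; first exact: hnorm2_ge0.
  apply: ler_wpM2l; first exact: sqr_ge0.
  by apply: ler_wpM2l => //; exact: cutoff_coef_le.
apply/cvgrPdist_lt => eps e0.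
have e1 : 0 < eps ^+ 2 / (K + 1) by rewrite divr_gt0 ?exprn_gt0// ltr_wpDl.
have [N _ NP] := near_infty_natSinv_lt (PosNum e1).
exists N => // j /NP /= h; rewrite sub0r normrN -ltr_sqr ?nnegrE ?(ltW e0)// real_normK ?num_real//.
apply: le_lt_trans (bnd j) _; apply: (@le_lt_trans _ _ ((K + 1) / j.+1%:R)).
  by apply: ler_wpM2r; [rewrite invr_ge0 | lra].
by rewrite mulrC -ltr_pdivlMr// ltr_wpDl.
Qed.

(** Where l0 is nonzero, [arc] is bounded below, so the cutoffs tend to 1 uniformly there. *)
Lemma mean_inner_cutoff (l0 : R -> R) : smooth l0 -> periodic2pi l0 -> supported l0 I ->
  (fun j => mean (fun x => inner_cutoff m kappa j.+1%:R x * l0 x)) @ \oo --> mean l0.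
Proof.
move=> sl pl; rewrite I_arc => /(supported_arc pl)[d d0 dP].
have cl := smooth_continuous sl; have [G GP] := continuous_periodic_bounded cl pl.
have G0 : 0 <= G := le_trans (normr_ge0 _) (GP 0).
apply/cvgrPdist_le => eps e0.
(* If 1 / l is below this value then l * d > 1 + G / eps, that is, the error G / (l * d - 1) is at
   most eps. *)
have t0 : 0 < d / (1 + G / eps) by rewrite divr_gt0// ltr_pwDl// divr_ge0// ltW.
have [N _ NP] := near_infty_natSinv_lt (PosNum t0).
exists N => // j /NP /= h; set l : R := j.+1%:R in h *.
have lpos : 0 < l by rewrite ltr0n.
have ci : continuous (inner_cutoff m kappa l) by exact/smooth_continuous/smooth_inner_cutoff.
rewrite -meanB//; last exact: contM.
apply: mean_norm_le => [|x]; first by apply: contB => //; exact: contM.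
have [->|lx] := eqVneq (l0 x) 0; first by rewrite mulr0 subrr normr0 ltW.
have {}h : 1 + G / eps < l * d.
  move: h; rewrite ltr_pdivlMr ?ltr_pwDl ?divr_ge0 ?(ltW e0)// mulrC ltr_pdivrMr//.
  by rewrite [d * l]mulrC.
have ld : 1 + G / eps < l * arc m kappa x.
  by apply: lt_le_trans h _; rewrite ler_pM2l//; exact: dP.
have q0 : 0 <= G / eps by rewrite divr_ge0// ltW.
have a1 : 1 < l * arc m kappa x by lra.
rewrite -{1}[l0 x]mul1r -mulrBl normrM ger0_norm ?subr_ge0 ?ramp_le1//.
apply: (@le_trans _ _ ((l * arc m kappa x - 1)^-1 * G)).
  apply: ler_pM => //; [by rewrite subr_ge0 ramp_le1 | exact: one_sub_ramp_le].
rewrite mulrC ler_pdivrMr ?subr_gt0// mulrC -ler_pdivrMr//; lra.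
Qed.

End ProperArc.

End LoopClasses.

(** * The twisted crossed product *)

Section Bicharacter.
Variables (R : realType) (F : vectType R) (ip : {dot F for idfun}) (n : nat).
Variable e : 'I_n -> F.
Implicit Types l m : 'rV[int]_n.

Lemma latvecD l m : latvec e (l + m) = latvec e l + latvec e m.
Proof. by rewrite /latvec -big_split; apply: eq_bigr => i _ /=; rewrite mxE mulrzDr. Qed.

Lemma latvecN l : latvec e (- l) = - latvec e l.
Proof. by rewrite /latvec -sumrN; apply: eq_bigr => i _; rewrite mxE mulrNz. Qed.

Lemma latvecB l m : latvec e (l - m) = latvec e l - latvec e m.
Proof. by rewrite latvecD latvecN. Qed.

Lemma latvec0 : latvec e 0 = 0.
Proof. by apply: big1 => i _; rewrite mxE mulr0z. Qed.

Let sgnz (z : int) : R[i] := (-1) ^ z.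

Let sgnzD (a b : int) : sgnz (a + b) = sgnz a * sgnz b.
Proof. by rewrite /sgnz expfzDr// oppr_eq0 oner_eq0. Qed.

Let sgnz_sqr (a : int) : sgnz a * sgnz a = 1.
Proof.
by rewrite /sgnz -expfzMl mulrNN mulr1 exp1rz.
Qed.

Let sgnz_conj (a : int) : conjc (sgnz a) = sgnz a.
Proof.
have /eqP := sgnz_sqr a; rewrite -expr2 sqrf_eq1 => /orP[] /eqP ->;
  by congr (_ +i* _); rewrite /= ?oppr0.
Qed.

Let conjc_prod (J : Type) (s : seq J) (P : pred J) (x : J -> R[i]) :
  conjc (\prod_(j <- s | P j) x j) = \prod_(j <- s | P j) conjc (x j).
Proof.
apply: (big_morph (@conjc R)) => [[a b] [c d]|]; congr (_ +i* _) => /=; last exact: oppr0.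
- by rewrite mulrNN.
- by ring.
Qed.

Lemma bicharDr l m m' : bichar ip e l (m + m') = bichar ip e l m * bichar ip e l m'.
Proof.
rewrite /bichar -big_split; apply: eq_bigr => i _ /=; rewrite -big_split.
by apply: eq_bigr => j _ /=; rewrite mxE mulrDr; exact: sgnzD.
Qed.

Lemma bicharDl l l' m : bichar ip e (l + l') m = bichar ip e l m * bichar ip e l' m.
Proof.
rewrite /bichar -big_split; apply: eq_bigr => i _ /=; rewrite -big_split.
by apply: eq_bigr => j _ /=; rewrite mxE mulrDr mulrDl; exact: sgnzD.
Qed.

Lemma bichar_sqr l m : bichar ip e l m * bichar ip e l m = 1.
Proof.
rewrite /bichar -big_split; apply: big1 => i _ /=; rewrite -big_split.
by apply: big1 => j _; exact: sgnz_sqr.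
Qed.

Lemma bichar_conj l m : conjc (bichar ip e l m) = bichar ip e l m.
Proof.
rewrite /bichar conjc_prod; apply: eq_bigr => i _; rewrite conjc_prod.
by apply: eq_bigr => j _; exact: sgnz_conj.
Qed.

Lemma bichar0l m : bichar ip e 0 m = 1.
Proof. by rewrite -(bichar_sqr 0 m) -bicharDl addr0. Qed.

Let expi_pi_int (z : int) : expi (pi * z%:~R) = sgnz z.
Proof.
have nat_case (k : nat) : expi (pi * k%:R : R) = (-1) ^+ k.
  elim: k => [|k IH]; first by rewrite mulr0 expi0.
  by rewrite -addn1 natrD mulrDr mulr1 expiD IH expi_pi exprD expr1.
case: z => k; first by rewrite -pmulrn nat_case.
rewrite NegzE mulrNz mulrN -conjc_expi -pmulrn nat_case (sgnz_conj k.+1).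
by rewrite /sgnz -exprnN -exprVn invrN1.
Qed.

Lemma expi_sum (J : Type) (s : seq J) (P : pred J) (x : J -> R) :
  expi (\sum_(j <- s | P j) x j) = \prod_(j <- s | P j) expi (x j).
Proof. exact: (big_morph _ (@expiD R) (@expi0 R)). Qed.

Section EvenLattice.
Variable L : set F.
Hypotheses (e_basis : lattice_basis e L) (L_even : even_lattice ip L).

Let L_latvec m : L (latvec e m).
Proof. by case: e_basis => _ ->; exists m. Qed.

Let e_latvec i : e i = latvec e (delta_mx 0 i).
Proof.
rewrite /latvec (bigD1 i)//= mxE !eqxx /= mulr1z big1 ?addr0// => j ji.
by rewrite mxE eqxx (negPf ji) /= mulr0z.
Qed.

(** Polarization: twice the product is a combination of three even integers. *)
Let gram_int i j : ip (e i) (e j) = (Num.floor (ip (e i) (e j)))%:~R.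
Proof.
have [a aP] := L_even (L_latvec (delta_mx 0 i + delta_mx 0 j)).
have [b bP] := L_even (L_latvec (delta_mx 0 i)); have [c cP] := L_even (L_latvec (delta_mx 0 j)).
suff -> : ip (e i) (e j) = (a - b - c)%:~R by rewrite intrKfloor.
move: aP bP cP; rewrite latvecD -!e_latvec linearDl !linearDr /= (ip_sym ip (e j) (e i)) !intrM !intrB => h1 h2 h3.
have : 2 * ip (e i) (e j) = 2 * (a%:~R - b%:~R - c%:~R) by lra.
by apply: mulfI; rewrite pnatr_eq0.
Qed.

Let gram_even i : exists k : int, Num.floor (ip (e i) (e i)) = 2 * k.
Proof.
have [b] := L_even (L_latvec (delta_mx 0 i)); rewrite -e_latvec => ->.
by exists b; rewrite intrKfloor.
Qed.

Lemma ip_latvec l m : ip (latvec e l) (latvec e m) =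
  \sum_i \sum_j (Num.floor (ip (e i) (e j)) * l 0 i * m 0 j)%:~R.
Proof.
rewrite {1}/latvec (big_morph (fun x => ip x _) (fun x y => linearDl ip _ x y) (linear0l ip _)).
apply: eq_bigr => i _ /=; rewrite /latvec (big_morph _ (linearDr ip _) (linear0r ip _)); apply: eq_bigr => j _ /=.
rewrite -(scaler_int (l 0 i) (e i)) -(scaler_int (m 0 j) (e j)) linearZl_LR linearZr_LR /=.
by rewrite !intrM -gram_int mulrA mulrC mulrA.
Qed.

(* Evenness kills the diagonal terms. *)
Lemma bichar_symmetrization l m :
  conjc (braiding ip (latvec e l) (latvec e m)) = bichar ip e l m * bichar ip e m l.
Proof.
pose g i j : int := Num.floor (ip (e i) (e j)).
have gC i j : g i j = g j i by rewrite /g ip_sym.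
have diag i : sgnz (g i i * l 0 i * m 0 i) = 1.
  have [k] := gram_even i; rewrite -/(g i i) => ->.
  have -> : 2 * k * l 0 i * m 0 i = k * l 0 i * m 0 i + k * l 0 i * m 0 i by ring.
  by rewrite sgnzD sgnz_sqr.
have -> : braiding ip (latvec e l) (latvec e m) = \prod_i \prod_j sgnz (g i j * l 0 i * m 0 j).
  rewrite /braiding ip_latvec mulr_sumr expi_sum; apply: eq_bigr => i _.
  by rewrite mulr_sumr expi_sum; apply: eq_bigr => j _; exact: expi_pi_int.
(* Split each row at the diagonal: entries above it give b(l, m), the diagonal one is 1, and entries
   below it give b(m, l) after exchanging the indices. *)
rewrite conjc_prod (eq_bigr (fun i : 'I_n => (\prod_(j < n | (i < j)%N) sgnz (g i j * l 0 i * m 0 j)) *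
    \prod_(j < n | (j < i)%N) sgnz (g j i * m 0 j * l 0 i))); last first.
  move=> i _; rewrite conjc_prod (bigID (fun j : 'I_n => (i < j)%N)) /=; congr (_ * _).
    by apply: eq_bigr => j _; exact: sgnz_conj.
  rewrite (bigD1 i) ?ltnn//= sgnz_conj diag mul1r.
  apply: eq_big => [j|j _]; first by rewrite -leqNgt ltn_neqAle andbC.
  by rewrite sgnz_conj gC; congr sgnz; ring.
rewrite big_split /=; congr (_ * _).
rewrite (exchange_big_dep xpredT)//=.
Qed.

End EvenLattice.

End Bicharacter.

(** * Translations of the crossed space *)

Section Translations.
Variables (R : realType) (F : vectType R) (ip : {dot F for idfun}) (n : nat).
Variables (e : 'I_n -> F) (H : hilbert R).
Implicit Types (l m : 'rV[int]_n) (z w : crossed_space n H).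

Let hnorm2_bichar l m (h : H) : hnorm2 (bichar ip e l m *: h) = hnorm2 h.
Proof.
rewrite hnorm2Z; have := bichar_sqr ip e l m; rewrite -{1}bichar_conj => E.
by rewrite (_ : complex.Re _ = 1) ?mul1r// -[RHS]/(complex.Re 1) -E.
Qed.

Lemma cp_psiE l z m : cp_psi ip e l z m = bichar ip e l (m - l) *: z (m - l).
Proof.
rewrite /cp_psi dsumE//; under eq_fun do rewrite hnorm2_bichar.
by apply: (@asum_inj _ _ _ (fun m => m - l) (fun m => hnorm2 (z m)) _ (asum_hnorm2 z)); exact: addIr.
Qed.

Definition cp_psi_adj l z : crossed_space n H := mkl2 eq_op (fun m => bichar ip e l m *: z (m + l)).

Lemma cp_psi_adjE l z m : cp_psi_adj l z m = bichar ip e l m *: z (m + l).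
Proof.
rewrite /cp_psi_adj dsumE//; under eq_fun do rewrite hnorm2_bichar.
by apply: (@asum_inj _ _ _ (fun m => m + l) (fun m => hnorm2 (z m)) _ (asum_hnorm2 z)); exact: addIr.
Qed.

Lemma cp_psiK l z : cp_psi_adj l (cp_psi ip e l z) = z.
Proof. by apply: l2_ext => m; rewrite cp_psi_adjE cp_psiE addrK scalerA bichar_sqr scale1r. Qed.

Lemma cp_psi_adjK l z : cp_psi ip e l (cp_psi_adj l z) = z.
Proof. by apply: l2_ext => m; rewrite cp_psiE cp_psi_adjE subrK scalerA bichar_sqr scale1r. Qed.

Lemma cp_psi_adjoint l : adjoint (cp_psi ip e l) (cp_psi_adj l).
Proof.
move=> z w; rewrite !l2_hdotE /csum.
have shift (f : 'rV[int]_n -> R) : rsum f = rsum (fun m => f (m + l)).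
  by apply: rsum_inj => [|m h]; [exact: addIr | case: (h (m - l)); rewrite subrK].
congr (_ +i* _); rewrite shift; congr rsum; apply/funext => m;
  rewrite cp_psiE cp_psi_adjE addrK hdotZl hdotZr; congr (_ (_ * _)); exact/esym/bichar_conj.
Qed.

Lemma cp_psi_unitary l : unitary (cp_psi ip e l : crossed_space n H -> crossed_space n H).
Proof.
split; first exact: adjoint_linear (adjoint_sym (@cp_psi_adjoint l)).
- by move=> z w; rewrite cp_psi_adjoint cp_psiK.
- by move=> z; exists (cp_psi_adj l z); exact: cp_psi_adjK.
Qed.

Lemma cp_psi0 : cp_psi ip e 0 = @id (crossed_space n H).
Proof. by apply/funext => z; apply: l2_ext => m; rewrite cp_psiE subr0 bichar0l scale1r. Qed.

(** The commutator of two translations is b(l, l') / b(l', l), written as a product because b takes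
    the values 1 and -1. *)
Lemma cp_psi_conj l l' z : cp_psi ip e l (cp_psi ip e l' (cp_psi_adj l z)) =
  (bichar ip e l l' * bichar ip e l' l) *: cp_psi ip e l' z.
Proof.
apply: l2_ext => m; rewrite l2Z !cp_psiE cp_psi_adjE !scalerA.
set x := m - l - l'.
have -> : x + l = m - l' by rewrite /x addrAC subrK.
congr (_ *: _); have -> : m - l = x + l' by rewrite /x subrK.
have -> : m - l' = x + l by rewrite /x addrAC subrK.
rewrite !(bicharDr _ _ _ x); have := bichar_sqr ip e l x; have := bichar_sqr ip e l' l.
move: (bichar ip e l x) (bichar ip e l' x) (bichar ip e l l') (bichar ip e l' l) => a b c d d2 a2.
transitivity (a * a * (b * c)); first by ring.
by rewrite a2 -d2; ring.
Qed.

End Translations.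

Section NegatedLoops.
Variables (R : realType) (F : vectType R) (ip : {dot F for idfun}) (n : nat).
Variables (u : 'I_n -> F) (f : R -> F).

Lemma smooth_loopN : smooth_loop ip f -> smooth_loop ip (fun x => - f x).
Proof.
move=> [fp fs]; split=> [x|v]; first by rewrite fp.
rewrite (_ : (fun x => _) = (fun x => -1 * ip (f x) v)); first exact: smoothZ.
by apply/funext => x; rewrite linearNl mulN1r.
Qed.

Lemma supportedN (I : set R) : supported f I -> supported (fun x => - f x) I.
Proof.
move=> fs x xs; apply: fs; apply: closure_subset xs => y /=.
by rewrite oppr_eq0.
Qed.

Lemma loop_classN : smooth_loop ip f ->
  loop_class ip u (fun x => - f x) = - loop_class ip u f.
Proof.
move=> fl; have nl := smooth_loopN fl; have zl := smooth_loopD fl nl.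
have z0 : loop_class ip u (fun x => f x - f x) = 0.
  apply: (addrI (loop_class ip u (fun x => f x - f x))).
  rewrite addr0 -(loop_classD u zl zl); congr (loop_class ip u _).
  by apply/funext => x; rewrite subrr addr0.
apply: (addrI (loop_class ip u f)).
by rewrite -(loop_classD u fl nl) z0 subrr.
Qed.

End NegatedLoops.

Section NormalMorphismScaling.
Variables (R : realType) (H : hilbert R) (M : set (H -> H)) (alpha : (H -> H) -> (H -> H)).
Hypotheses (Ms : star_algebra M) (am : normal_morphism M alpha).

Lemma star_algebraZ a T : M T -> M (a *: T).
Proof.
move=> MT; have MZ : M ((-1 : R[i]) *: T + T) := sa_lin Ms (-1) MT MT.
by have := sa_lin Ms a MT MZ; rewrite scaleN1r addNr addr0.
Qed.

Lemma nm_Z a T : M T -> alpha (a *: T) = a *: alpha T.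
Proof.
move=> MT; have MZ : M ((-1 : R[i]) *: T + T) := sa_lin Ms (-1) MT MT.
have := nm_lin am a MT MZ; rewrite (nm_lin am (-1) MT MT) !scaleN1r !addNr.
by rewrite !addr0.
Qed.

End NormalMorphismScaling.

(** * Phases of Weyl operators and twisted intertwiners *)

Section Phase.
Variables (R : realType) (n : nat) (F : vectType R) (ip : {dot F for idfun}).
Variables (u : 'I_n -> F) (I : set R) (I_proper : proper_interval I).
Variables (W : one_particle R n -> fockF R n -> fockF R n) (Ww : weyl W).
Variables (l0 : R -> R) (l0_smooth : smooth l0) (l0_periodic : periodic2pi l0).
Hypotheses (l0_supp : supported l0 I) (l0_mean : mean l0 = 1).

Definition phase f t : R := mean (fun theta => ip (f theta) (l0 theta *: t)).

Lemma phaseE f t : phase f t = mean (fun theta => l0 theta * ip (f theta) t).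
Proof. by congr mean; apply/funext => x; rewrite linearZr_LR. Qed.

Lemma phaseD f s t : smooth_loop ip f -> phase f (s + t) = phase f s + phase f t.
Proof.
move=> fl; have c v : continuous (fun x => l0 x * ip (f x) v).
  apply: contM; first exact: smooth_continuous.
  by have [/smooth_continuous] := smooth_loop_coord v fl.
rewrite !phaseE -meanD//; congr mean; apply/funext => x.
by rewrite linearDr mulrDr.
Qed.

Lemma phaseN f t : smooth_loop ip f -> phase f (- t) = - phase f t.
Proof.
move=> fl; have p0 : phase f 0 = 0.
  by apply: (addrI (phase f 0)); rewrite -phaseD// !addr0.
by apply: (addrI (phase f t)); rewrite -phaseD// !subrr.
Qed.

(* W([f]) picks up the phase pi in the limit where f is the constant c on I, while
   W([f + g]) tends, up to normalisation, weakly to 1. *)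
Lemma twisted_intertwiner_eq0 (E E' : fockF R n -> fockF R n) s : s != 0 ->
  adjoint E E' ->
  (forall f x, smooth_loop ip f -> supported f I ->
    E (W (loop_class ip u f) x) = expi (phase f s) *: W (loop_class ip u f) (E x)) ->
  (forall xi x, (forall f, smooth_loop ip f -> supported f I ->
      omega (loop_class ip u f) xi = 0) -> E (W xi x) = W xi (E x)) ->
  forall x, E x = 0.
Proof.
move=> s0 EE' E_inner E_outer x.
have [m [kappa [kappa1 I_arc]]] := proper_interval_arc I_proper.
have ss : 0 < ip s s := ip_gt0 ip s0.
pose c := (pi / ip s s) *: s.
have cs : ip c s = pi by rewrite /c linearZl_LR divfK// gt_eqF.
pose f j := inner_loop m kappa j.+1%:R c.
pose xi j : one_particle R n := cutoff_class ip u m kappa j.+1%:R c.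
pose theta j := phase (f j) s.
have jpos j : (0 : R) < j.+1%:R by rewrite ltr0n.
(* The inner and outer loops are symplectically orthogonal, so W(xi_j) factors without a phase; of
   the two factors only the inner one yields a phase when E passes. *)
have twist j : E (W (xi j) x) = expi (theta j) *: W (xi j) (E x).
  have fl : smooth_loop ip (f j) by exact: smooth_inner_loop.
  have fs : supported (f j) I by exact: (supported_inner_loop I_arc (jpos j)).
  pose g := loop_class ip u (outer_loop m kappa j.+1%:R c).
  have fg h : smooth_loop ip h -> supported h I -> omega (loop_class ip u h) g = 0.
    by move=> hl hs; exact: (omega_outer_loop u I_arc c (jpos j) hl hs).
  have split y : W (xi j) y = W (loop_class ip u (f j)) (W g y).
    by rewrite (weylM Ww) fg// oppr0 expi0 scale1r.
  by rewrite !split E_inner// E_outer.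
have theta_pi : theta @ \oo --> (pi : R).
  have -> : theta = (fun j => pi * mean (fun x => inner_cutoff m kappa j.+1%:R x * l0 x)).
    apply/funext => j; rewrite /theta phaseE -meanZ; last first.
      apply: contM; last exact: smooth_continuous.
      exact/smooth_continuous/smooth_inner_cutoff.
    congr mean; apply/funext => y.
    by rewrite /f /inner_loop linearZl_LR /= cs mulrA mulrC [pi * _]mulrC.
  have lim0 : (fun j => mean (fun x => inner_cutoff m kappa j.+1%:R x * l0 x)) @ \oo --> (1 : R).
    have h := @mean_inner_cutoff R m kappa I I_arc l0 l0_smooth l0_periodic l0_supp.
    by move: h; rewrite l0_mean.
  rewrite -{2}(mulr1 (pi : R)); exact: (cvgM (cvg_cst (pi : R)) lim0).
have [B xi_bounded] := cutoff_class_bounded ip u m kappa1 c.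
have xiB j : hnorm2 (xi j) <= B by apply: xi_bounded; rewrite ler1n.
have xi_weak eta : (fun j => redot eta (xi j)) @ \oo --> (0 : R).
  exact: (@cutoff_class_weak R F ip n u m kappa kappa1 c eta).
pose a j := expR (hnorm2 (xi j) / 2).
have lim y z : (fun j => a j * redot y (W (xi j) z)) @ \oo --> redot y z.
  exact: (@weyl_weak_cvg R _ W Ww xi B xiB xi_weak y z).
set w := E x; suff : hnorm2 w = 0 by exact: hnorm2_eq0.
have adj z : redot w (E z) = redot (E' w) z by rewrite /redot EE'.
(* E is moved to the other side as its adjoint, and the weak limit applies to x. *)
have L1 : (fun j => a j * redot w (E (W (xi j) x))) @ \oo --> hnorm2 w.
  by rewrite -redotxx {2}/w adj; under eq_fun do rewrite adj; exact: lim.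
(* The same sequence with E commuted past W(xi_j): the phase factor tends to exp(i pi) = -1. *)
have L2 : (fun j => a j * redot w (E (W (xi j) x))) @ \oo --> - hnorm2 w.
  have -> : (fun j => a j * redot w (E (W (xi j) x))) = (fun j =>
      cos (theta j) * (a j * redot w (W (xi j) w)) -
      sin (theta j) * (a j * redot ('i *: w) (W (xi j) w))).
    apply/funext => j; rewrite twist {1}/redot hdotZr hdotE /expi /=.
    by ring.
  have cos_lim : (fun j => cos (theta j)) @ \oo --> (-1 : R).
    by rewrite -cospi; apply: continuous_cvg => //; exact: continuous_cos.
  have sin_lim : (fun j => sin (theta j)) @ \oo --> (0 : R).
    by rewrite -sinpi; apply: continuous_cvg => //; exact: continuous_sin.
  have -> : - hnorm2 w = -1 * redot w w - 0 * redot ('i *: w) w.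
    by rewrite mul0r subr0 mulN1r redotxx.
  exact: (cvgB (cvgM cos_lim (lim w w)) (cvgM sin_lim (lim ('i *: w) w))).
have : hnorm2 w = - hnorm2 w by exact: (cvg_unique _ L1 L2).
by lra.
Qed.

End Phase.

(** * Inner induced automorphisms and the lattice *)

Section CrossedProductStructure.
Variables (R : realType) (n : nat) (F : vectType R).
Variables (ip : {dot F for idfun}) (u : 'I_n -> F) (e : 'I_n -> F) (I : set R).
Variables (W : one_particle R n -> fockF R n -> fockF R n) (Ww : weyl W).
Variables (l0 : R -> R) (l0_periodic : periodic2pi l0) (l0_smooth : smooth l0).
Variables (rho : F -> (fockF R n -> fockF R n) -> (fockF R n -> fockF R n)).
Variables (I_proper : proper_interval I) (l0_supp : supported l0 I) (l0_mean : mean l0 = 1).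
Hypothesis rho_aut : forall t, vN_automorphism (local_algebra ip u W I) (rho t).
Hypothesis rhoE : forall t f, smooth_loop ip f -> supported f I ->
    rho t (W (loop_class ip u f)) =
    expi (mean (fun theta => ip (f theta) (l0 theta *: t))) *:
      W (loop_class ip u f).

Let A := local_algebra ip u W I.
Let G : set (fockF R n -> fockF R n) :=
  [set W (loop_class ip u f) | f in [set f | smooth_loop ip f /\ supported f I]].

Lemma local_generators_bounded T : G T -> bounded_op T.
Proof. by move=> [f _ <-]; exact: weyl_bounded. Qed.

Lemma local_generators_star : star_closed G.
Proof.
move=> _ [f [fl fs] <-]; exists (W (- loop_class ip u f)); last exact: weyl_adjoint.
exists (fun x => - f x); last by rewrite loop_classN.
by split; [exact: smooth_loopN | exact: supportedN].
Qed.

Lemma local_algebraE : A = vN_generated G.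
Proof. exact: star_closed_vN_generated local_generators_star. Qed.

Lemma local_star_algebra : star_algebra A.
Proof. by rewrite local_algebraE; exact: vN_generated_star_algebra local_generators_bounded. Qed.

Lemma local_weyl f : smooth_loop ip f -> supported f I -> A (W (loop_class ip u f)).
Proof.
move=> fl fs; rewrite local_algebraE; apply: sub_vN_generated; last exact: weyl_bounded.
by exists f.
Qed.

Lemma rho_normal t : normal_morphism A (rho t).
Proof. exact: automorphism_normal_morphism local_star_algebra (rho_aut t). Qed.

(** The group law follows by uniqueness: both sides are normal and multiply each Weyl generator by
    the same phase. *)
Lemma rho_add s t a : A a -> rho s (rho t a) = rho (s + t) a.
Proof.
move=> Aa; rewrite -[LHS]/((rho s \o rho t) a).
have := @normal_morphism_unique R _ G (rho s \o rho t) (rho (s + t)) local_generators_bounded.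
rewrite -local_algebraE; apply => //; [exact: comp_normal_morphism (rho_normal s) (rho_normal t) | exact: rho_normal |].
move=> _ [f [fl fs] <-]; rewrite /= (rhoE t fl fs) (nm_Z local_star_algebra (rho_normal s)); last exact: local_weyl.
rewrite (rhoE s fl fs) (rhoE (s + t) fl fs) scalerA.
by rewrite -!/(phase ip l0 f _) phaseD// expiD mulrC.
Qed.

(** Makes [cp_iota a] a bounded diagonal operator that never takes the default value of [mkl2]: the
    bound of a serves for every m. *)
Lemma rho_uniformly_bounded a : A a -> uniformly_bounded (fun m => rho (- latvec e m) a).
Proof.
move=> Aa; have ab := sa_bounded local_star_algebra.
split; first by move=> m; case: (ab _ (nm_in (rho_normal (- latvec e m)) Aa)).
have [c c0 cP] := bounded_op_pos (ab _ Aa); exists c => // m.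
exact: normal_morphism_bound local_star_algebra (rho_normal _) Aa c0 cP.
Qed.

Lemma cp_iotaE a (z : crossed_space n (fockF R n)) m : A a ->
  cp_iota e rho a z m = rho (- latvec e m) a (z m).
Proof. by move=> /rho_uniformly_bounded ab; exact: (diagE z m ab). Qed.

Let K := crossed_space n (fockF R n).
Let GM : set (K -> K) := [set cp_iota e rho a | a in A] `|` range (cp_psi ip e).
Let M := crossed_product ip e rho A.

Lemma crossed_generators_bounded T : GM T -> bounded_op T.
Proof.
move=> [[a /rho_uniformly_bounded ab <-]|[l _ <-]]; first exact: (diag_bounded ab).
exact: unitary_bounded (@cp_psi_unitary _ _ _ _ _ _ _).
Qed.

Lemma crossed_star_algebra : star_algebra M.
Proof. exact: vN_generated_star_algebra crossed_generators_bounded. Qed.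

Lemma crossed_generator T : GM T -> M T.
Proof. by move=> GT; exact: (sub_vN_generated GT (crossed_generators_bounded GT)). Qed.

Lemma crossed_iota a : A a -> M (cp_iota e rho a).
Proof. by move=> Aa; apply: crossed_generator; left; exists a. Qed.

Lemma crossed_psi l : M (cp_psi ip e l).
Proof. by apply: crossed_generator; right; exists l. Qed.

Lemma crossed_psi_adj l : M (cp_psi_adj ip e l).
Proof.
have [T MT /adjoint_uniq /(_ (@cp_psi_adjoint _ _ ip _ e _ l)) <-] := sa_star crossed_star_algebra (crossed_psi l).
exact: MT.
Qed.

Lemma cp_iota_id : cp_iota e rho id = @id K.
Proof.
apply/funext => z; apply: l2_ext => m; rewrite cp_iotaE; last exact: sa_id local_star_algebra.
by rewrite (nm_id (rho_normal _)).
Qed.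

Section Induced.
Variable beta : F -> (K -> K) -> (K -> K).
Hypothesis beta_aut : forall t, vN_automorphism M (beta t).
Hypothesis betaE : forall t a l, A a ->
  beta t (cp_iota e rho a \o cp_psi ip e l) =
  cp_iota e rho ((braiding ip t (latvec e l))^*%C *: rho t a) \o cp_psi ip e l.

Lemma beta_normal t : normal_morphism M (beta t).
Proof. exact: automorphism_normal_morphism crossed_star_algebra (beta_aut t). Qed.

Lemma beta_iota t a : A a -> beta t (cp_iota e rho a) = cp_iota e rho (rho t a).
Proof.
move=> Aa; have := betaE t 0 Aa; rewrite cp_psi0 latvec0.
have -> : braiding ip t 0 = 1 by rewrite /braiding linear0r mulr0 expi0.
by rewrite (_ : conjc 1 = 1) ?scale1r//; congr (_ +i* _); rewrite /= oppr0.
Qed.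

Lemma beta_psi t l :
  beta t (cp_psi ip e l) = conjc (braiding ip t (latvec e l)) *: cp_psi ip e l.
Proof.
have Ai := sa_id local_star_algebra; have := betaE t l Ai; rewrite cp_iota_id => E.
apply: (etrans E); rewrite (nm_id (rho_normal t)).
apply/funext => z; apply: l2_ext => m; rewrite /=.
rewrite cp_iotaE; last exact: star_algebraZ local_star_algebra _ _ Ai.
rewrite (nm_Z local_star_algebra (rho_normal _))// (nm_id (rho_normal _)).
by rewrite -[RHS]/((_ *: cp_psi ip e l z) m) l2Z.
Qed.

Variables (L : set F) (e_basis : lattice_basis e L) (L_even : even_lattice ip L).

Lemma inner_lattice t : L t -> inner M (beta t).
Proof.
case: e_basis => _ -> [l _ <-].
exists (cp_psi ip e l), (cp_psi_adj ip e l); split.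
- exact: crossed_psi.
- exact: crossed_psi_adj.
- exact: cp_psi_unitary.
- exact: cp_psi_adjoint.
have Adl := Ad_normal_morphism crossed_star_algebra (crossed_psi l) (crossed_psi_adj l)
  (@cp_psi_unitary _ _ ip _ e _ l) (@cp_psi_adjoint _ _ ip _ e _ l).
apply: (normal_morphism_unique crossed_generators_bounded (beta_normal _) Adl).
move=> _ [[a Aa <-]|[l' _ <-]].
- rewrite beta_iota//; apply/funext => z; apply: l2_ext => m /=.
  rewrite cp_iotaE; last exact: (nm_in (rho_normal (latvec e l)) Aa).
  rewrite cp_psiE cp_iotaE// cp_psi_adjE subrK rho_add//.
  have rb := sa_bounded local_star_algebra (nm_in (rho_normal (- latvec e (m - l))) Aa).
  rewrite (boundedZ _ _ rb) scalerA bichar_sqr scale1r latvecB opprB.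
  by rewrite [in RHS]addrC.
- rewrite beta_psi (bichar_symmetrization e_basis L_even); apply/funext => z.
  exact/esym/cp_psi_conj.
Qed.

Lemma rho_weyl t f : smooth_loop ip f -> supported f I ->
  rho t (W (loop_class ip u f)) = expi (phase ip l0 f t) *: W (loop_class ip u f).
Proof. exact: rhoE. Qed.

(** W(xi) commutes with A, hence with every rho_{-m}(a), which stays in A; and the same operator in
    every summand commutes with the translations. *)
Lemma amp_weyl_commutes xi (U : K -> K) :
  (forall f, smooth_loop ip f -> supported f I -> omega (loop_class ip u f) xi = 0) ->
  M U -> amp (W xi) \o U = U \o amp (W xi).
Proof.
move=> xi0 MU; have Wb eta := weyl_bounded Ww eta.
have commutes eta : (forall f, smooth_loop ip f -> supported f I ->
    omega (loop_class ip u f) eta = 0) -> forall T, GM T -> amp (W eta) \o T = T \o amp (W eta).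
  move=> eta0; have Weta : commutant G (W eta).
    split; first exact: Wb.
    move=> _ [f [fl fs] <-]; apply/funext => x /=.
    by rewrite !(weylM Ww) omegaC eta0// !oppr0 addrC.
  have local_commutes a x : A a -> W eta (a x) = a (W eta x).
    by move=> [_ /(_ _ Weta)] /(congr1 (@^~ x)).
  move=> T [[a Aa <-]|[l _ <-]]; apply/funext => z; apply: l2_ext => m /=.
    rewrite (ampE _ _ (Wb eta)) !cp_iotaE// (ampE _ _ (Wb eta)).
    exact: local_commutes (nm_in (rho_normal _) Aa).
  by rewrite (ampE _ _ (Wb eta)) !cp_psiE (ampE _ _ (Wb eta)) (boundedZ _ _ (Wb eta)).
have Nxi0 f : smooth_loop ip f -> supported f I -> omega (loop_class ip u f) (- xi) = 0.
  by move=> fl fs; rewrite omegaC omegaNl opprK omegaC xi0// oppr0.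
suff Ac : commutant (with_adjoints GM) (amp (W xi)).
  by case: MU => _ /(_ _ Ac).
split; first exact: (amp_bounded _ (Wb xi)).
(* For the adjoint of a generator, take adjoints in the relation for - xi. *)
move=> T [/(commutes _ xi0)//|[S GS ST]].
have Wadj : adjoint (amp (W (- xi)) : K -> K) (amp (W xi)).
  apply: (amp_adjoint (Wb (- xi)) (Wb xi)); exact/adjoint_sym/weyl_adjoint.
have := commutes _ Nxi0 _ GS => E.
apply: (adjoint_uniq (adjoint_comp ST Wadj)).
by rewrite -E; exact: adjoint_comp Wadj ST.
Qed.

Lemma lattice_inner t : inner M (beta t) -> L t.
Proof.
move=> [U [V [MU MV Uu UV betaU]]]; case: e_basis => _ LE; apply: contrapT => Lt.
have [VU _] := unitary_adjointK Uu UV.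
have Ub := sa_bounded crossed_star_algebra MU.
pose E m m' x := U (delta m' x) m : fockF R n.
have E0 m m' x : E m m' x = 0.
  (* After beta_t, summand m sees rho_{t - m}(w), whereas summand m' sees rho_{-m'}(w); s is the
     difference of the parameters, and it vanishes only if t is the lattice vector of m - m'. *)
  pose s := t - latvec e m + latvec e m'.
  have s0 : s != 0.
    apply/eqP => s0; apply: Lt; rewrite LE; exists (m - m') => //.
    by rewrite latvecB; apply/eqP; rewrite eq_sym -subr_eq0 opprB addrCA addrC -/s s0.
  apply: (twisted_intertwiner_eq0 (ip := ip) (u := u) I_proper Ww l0_smooth l0_periodic l0_supp l0_mean
    (E := E m m') (E' := fun y => V (delta m y) m') s0).
  - move=> y z; rewrite /E -hdot_delta UV.
    by rewrite hdotC hdot_delta -hdotC.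
  - move=> f y fl fs; set w := W _; have Aw : A w := local_weyl fl fs.
    have wb := weyl_bounded Ww (loop_class ip u f); rewrite -/w in wb.
    (* beta_t is conjugation by U, and V U = id removes the inverse on the right. *)
    have UE : U (cp_iota e rho w (delta m' y)) = cp_iota e rho (rho t w) (U (delta m' y)).
      rewrite -(beta_iota t Aw) betaU /=; last exact: crossed_iota.
      by have /(congr1 (@^~ (delta m' y))) /= -> := VU.
    have iota_delta : cp_iota e rho w (delta m' y) =
        expi (phase ip l0 f (- latvec e m')) *: delta m' (w y).
      apply: l2_ext => p; rewrite l2Z cp_iotaE// !deltaE.
      have rb := sa_bounded local_star_algebra (nm_in (rho_normal (- latvec e p)) Aw).
      case: (eqVneq p m') => [->|_]; last by rewrite scaler0 bounded0.
      by rewrite (rho_weyl _ fl fs).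
    have := congr1 (fun z : K => z m) UE; rewrite iota_delta (boundedZ _ _ Ub) l2Z.
    rewrite cp_iotaE; last exact: (nm_in (rho_normal t) Aw).
    rewrite (rho_add _ _ Aw) (rho_weyl _ fl fs) -/w => Em.
    have {}Em : expi (phase ip l0 f (- latvec e m')) *: E m m' (w y) =
      expi (phase ip l0 f (- latvec e m + t)) *: w (E m m' y) by exact: Em.
    have -> : s = latvec e m' + (- latvec e m + t) by rewrite /s addrC [t - _]addrC.
    rewrite phaseD// expiD -scalerA -Em scalerA -expiD phaseN// subrr expi0.
    by rewrite scale1r.
  - move=> xi y xi0; have := amp_weyl_commutes xi0 MU.
    move=> /(congr1 (fun T : K -> K => T (delta m' y) m)) /=.
    rewrite ampE; last exact: weyl_bounded.
    by rewrite amp_delta; last exact: weyl_bounded.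
(* U would then annihilate the vacuum placed in summand 0, a unit vector. *)
have Ud x : U (delta 0 x) = 0 by apply: l2_ext => m; rewrite l2_0; exact: E0.
case: Uu => _ /(_ (delta 0 (expvec 0)) (delta 0 (expvec 0))) + _.
rewrite Ud hdot0r hdot_delta deltaE eqxx hdot_vacuum => /eqP.
by rewrite eq_sym oner_eq0.
Qed.

End Induced.

End CrossedProductStructure.

Theorem proposition3p11 (R : realType) (n : nat) (F : vectType R)
  (ip : {dot F for idfun}) (u : 'I_n -> F) (u_basis : orthonormal_basis ip u)
  (L : set F) (e : 'I_n -> F) (e_basis : lattice_basis e L)
  (L_even : even_lattice ip L)
  (I : set R) (I_proper : proper_interval I)
  (W : one_particle R n -> fockF R n -> fockF R n) (W_weyl : weyl W)
  (l0 : R -> R) (l0_periodic : periodic2pi l0) (l0_smooth : smooth l0)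
  (l0_supp : supported l0 I) (l0_mean : mean l0 = 1)
  (rho : F -> (fockF R n -> fockF R n) -> (fockF R n -> fockF R n))
  (rho_aut : forall t, vN_automorphism (local_algebra ip u W I) (rho t))
  (rhoE : forall t f, smooth_loop ip f -> supported f I ->
    rho t (W (loop_class ip u f)) =
    expi (mean (fun theta => ip (f theta) (l0 theta *: t))) *:
      W (loop_class ip u f))
  (beta : F ->
    (crossed_space n (fockF R n) -> crossed_space n (fockF R n)) ->
    (crossed_space n (fockF R n) -> crossed_space n (fockF R n)))
  (beta_aut : forall t,
    vN_automorphism (crossed_product ip e rho (local_algebra ip u W I)) (beta t))
  (betaE : forall t a l, local_algebra ip u W I a ->
    beta t (cp_iota e rho a \o cp_psi ip e l) =
    cp_iota e rho ((braiding ip t (latvec e l))^*%C *: rho t a) \o cp_psi ip e l) :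
  forall t : F,
    inner (crossed_product ip e rho (local_algebra ip u W I)) (beta t) <-> L t.
Proof.
move=> t; split.
- exact: (lattice_inner W_weyl l0_periodic l0_smooth I_proper l0_supp l0_mean rho_aut rhoE betaE e_basis).
- exact: (inner_lattice W_weyl l0_smooth rho_aut rhoE beta_aut betaE e_basis L_even).
Qed.
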